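(* Let $X=T\times\check T=\mathbb{R}^{2n}/\mathbb{Z}^{2n}$ with symplectic form $\omega=\sum_{i=1}^n dy^i\wedge dx^i$ and let $Q^\hbar$ be the Toeplitz operator for the pair of polarizations $(\mathcal{P}^{\check T},\mathcal{P}^T)$ acting on the quantum Hilbert space $\mathcal{H}^\hbar$. If $f\in\mathcal{C}^\infty(X,\mathbb{C})$, then, with $\hbar=\frac1k$, $k\in\mathbb{N}$, $$\operatorname{tr}(Q_f^\hbar)=\hbar^{-n}\left(\int_X fe^{\omega}+\operatorname{O}(\hbar^\infty)\right),$$ i.e. for every $r\in\mathbb{N}$ there is $C_r>0$ (depending on $f$) with $\left|\operatorname{tr}(Q_f^\hbar)-\hbar^{-n}\int_Xfe^\omega\right|\le C_r\hbar^{r-n}$ for all $k\in\mathbb{N}$. Moreover its asymptotic expansion as $\hbar\to0^+$, i.e. the $\mathbb{C}[[\hbar]]$-linear map $\operatorname{Tr}:\mathcal{C}^\infty(X,\mathbb{C})[[\hbar]]\to\hbar^{-n}\mathbb{C}[[\hbar]]$ determined by $f\mapsto\hbar^{-n}\int_Xfe^\omega$ for $f\in\mathcal{C}^\infty(X,\mathbb{C})$, is a trace map for the star product $\star$.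
   Context: Setting. Let $n\ge 1$, $\mathbb{N}=\{1,2,\dots\}$, $T=\check T=\mathbb{R}^n/\mathbb{Z}^n$, $X=T\times\check T=\mathbb{R}^{2n}/\mathbb{Z}^{2n}$ with periodic coordinates $(x,y)$, $x,y\in\mathbb{R}^n$, and $\omega=\sum_{i=1}^n dy^i\wedge dx^i$; $X$ is oriented by $\omega^n$ and only the top-degree part of $fe^\omega$ is integrated, so $\int_Xfe^\omega=\int_Xf\,\omega^n/n!$. $\mathcal{C}^\infty(X,\mathbb{C})$ is identified with the smooth $\mathbb{Z}^{2n}$-periodic functions on $\mathbb{R}^{2n}$. $\mathcal{P}^T$ is the complex span of the $\partial_{x^i}$ and $\mathcal{P}^{\check T}$ the complex span of the $\partial_{y^i}$. For $k\in\mathbb{N}$ put $\hbar=1/k$ and $\mathbb{Z}_k^n=\mathbb{Z}^n/k\mathbb{Z}^n$; $[m]$ is the class of $m\in\mathbb{Z}^n$. Star product and trace map. For $f,g\in\mathcal{C}^\infty(X,\mathbb{C})$, $f\star g=\sum_{j\ge0}\hbar^jC_j(f,g)$ with $C_j(f,g)=\frac{1}{(2\pi\sqrt{-1})^j}\sum_{|I|=j}\frac{1}{I!}\frac{\partial^jf}{\partial y^I}\frac{\partial^jg}{\partial x^I}$ (sum over multi-indices $I\in(\mathbb{N}\cup\{0\})^n$), extended $\mathbb{C}[[\hbar]]$-bilinearly. A trace map for $\star$ is a $\mathbb{C}[[\hbar]]$-linear continuous functional $\operatorname{Tr}:\mathcal{C}^\infty(X,\mathbb{C})[[\hbar]]\to\hbar^{-n}\mathbb{C}[[\hbar]]$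 such that (1) $\operatorname{Tr}(f\star g)=\operatorname{Tr}(g\star f)$ for all $f,g\in\mathcal{C}^\infty(X,\mathbb{C})$, and (2) $\operatorname{Tr}(f)=\int_Xfe^{\omega/\hbar}+\operatorname{O}(\hbar^{1-n})$ for all $f\in\mathcal{C}^\infty(X,\mathbb{C})$, where $\int_Xfe^{\omega/\hbar}=\hbar^{-n}\int_Xf\,\omega^n/n!$. Line bundle. Smooth sections of the prequantum bundle $L^{\otimes k}$ are identified with smooth $s:\mathbb{R}^{2n}\to\mathbb{C}$ satisfying $s(u+\lambda)=\alpha(\lambda)^ke^{-k\pi\sqrt{-1}\,\omega(u,\lambda)}s(u)$ for $\lambda\in\mathbb{Z}^{2n}$, where $\alpha(\lambda)=(-1)^{\sum_i\lambda_i\lambda_{n+i}}$ and $\omega(u,v)=\sum_i(u_{n+i}v_i-u_iv_{n+i})$. The connection is $\nabla^\hbar=d-k\pi\sqrt{-1}\sum_i(y^idx^i-x^idy^i)$, and $\langle s,t\rangle_{L^2}=\int_{[0,1]^{2n}}s\bar t\,d^nx\,d^ny$. A distributional section $s\in\Gamma^{-\infty}(X,L^{\otimes k})$ is a continuous linear functional $t\mapsto s(\bar t)=:\langle s,t\rangle$ of $\bar t$, $t$ smooth, with smooth sections embedded via $\langle\cdot,\cdot\rangle_{L^2}$; products with functions and $\nabla^\hbar$ extend by duality. Weil-Brezin transform. For smooth $s$ and $[m]\in\mathbb{Z}_k^n$ let $(s)_{[m]}(y)=\int_{[0,1]^n}\tilde s(x,y+\hbar m)e^{-2\pi\sqrt{-1}m\cdot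 x}d^nx$, where $\tilde s(x,y)=e^{k\pi\sqrt{-1}x\cdot y}s(x,y)$. This gives isomorphisms $\Gamma^\infty(X,L^{\otimes k})\cong\prod_{\mathbb{Z}_k^n}\mathcal{S}(\mathbb{R}^n)$ and, by extension, $\Gamma^{-\infty}(X,L^{\otimes k})\cong\prod_{\mathbb{Z}_k^n}\mathcal{S}'(\mathbb{R}^n)$, with $\langle a,b\rangle_{L^2}=\sum_{[m]}\int_{\mathbb{R}^n}(a)_{[m]}\overline{(b)_{[m]}}\,d^ny$. Quantum Hilbert spaces. $\mathcal{H}^\hbar=\{s\in\Gamma^{-\infty}(X,L^{\otimes k}):\nabla^\hbar_{\bar\xi}s=0\ \forall\xi\in\Gamma^\infty(X,\mathcal{P}^T)\}\otimes\mathbb{C}\rho$, and $\check{\mathcal{H}}^\hbar$ is defined likewise with $\mathcal{P}^{\check T}$ and $\check\rho$ in place of $\mathcal{P}^T$ and $\rho$. Here $\rho,\check\rho$ are the chosen half-form generators (square roots of $\bigwedge^n(-2\sqrt{-1}dy)$ and $\bigwedge^n(2dx)$), paired by $\langle\rho,\check\rho\rangle=2^{n/2}k^{-n/2}$. Bases indexed by $m\in\mathbb{Z}_k^n$ are $\sigma_\hbar^m=2^{n/4}k^{n/2}\vartheta_\hbar^m\otimes\rho$ of $\mathcal{H}^\hbar$ and $\check\sigma_\hbar^m=2^{n/4}k^{n/2}\check\vartheta_\hbar^m\otimes\check\rho$ of $\check{\mathcal{H}}^\hbar$, where the Weil-Brezin coefficients are $(\vartheta_\hbar^m)_{m'}(\varphi)=\delta_{m,m'}(2k)^{-n/2}\varphi(0)$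 for $\varphi\in\mathcal{S}(\mathbb{R}^n)$, and $(\check\vartheta_\hbar^m)_{m'}$ is the constant function $\delta_{m,m'}2^{-n/2}$. Pairing and Toeplitz operator. Let $\mathrm{WF}^\hbar$, $\check{\mathrm{WF}}^\hbar$ be the unions of wavefront sets of (the section parts of) elements of $\mathcal{H}^\hbar$, $\check{\mathcal{H}}^\hbar$. They are disjoint, so by Hörmander's criterion $\langle\cdot,\cdot\rangle_{L^2}$ extends to a sesquilinear pairing (linear in the first slot) of distributional sections with wavefront set in $\mathrm{WF}^\hbar$ against those with wavefront set in $\check{\mathrm{WF}}^\hbar$; it is tensored with $\langle\rho,\check\rho\rangle$. Concretely, for smooth $f$, $\langle f\vartheta_\hbar^a,\check\vartheta_\hbar^b\rangle=\langle\vartheta_\hbar^a,\bar f\check\vartheta_\hbar^b\rangle=\sum_{c\in\mathbb{Z}_k^n}(\vartheta_\hbar^a)_c\big(\overline{(\bar f\check\vartheta_\hbar^b)_c}\big)$, the pairing of compactly supported distributions with smooth functions on $\mathbb{R}^n$. Then $\langle\sigma_\hbar^m,\check\sigma_\hbar^{m'}\rangle=\delta_{m,m'}$. The projection is $\Pi^\hbar s=\sum_{m\in\mathbb{Z}_k^n}\langle s,\check\sigma_\hbar^m\rangle\sigma_\hbar^m$ and the Toeplitz operator for $(\mathcal{P}^{\check T},\mathcal{P}^T)$ is $Q_f^\hbar s=\Pi^\hbar(fs)$, $f\in\mathcal{C}^\infty(X,\mathbb{C})$, $s\in\mathcal{H}^\hbar$. *)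

(* Defs.v *)
From HB Require Import structures.
From mathcomp Require Import all_boot all_order all_algebra.
From mathcomp Require Import complex ring.
From mathcomp Require Import all_classical all_reals all_analysis.
Set Implicit Arguments.
Unset Strict Implicit.
Unset Printing Implicit Defensive.
Import Order.TTheory GRing.Theory Num.Theory.
Import numFieldNormedType.Exports.
Local Open Scope classical_set_scope.
Local Open Scope ring_scope.
Local Open Scope complex_scope.

Section Smooth.
Variables (R : realType) (N : nat).
Implicit Types (f g : 'rV[R]_N -> R[i]) (u v : 'rV[R]_N).

Definition cdifferentiable f u : Prop :=
  differentiable (fun w => complex.Re (f w)) u /\ differentiable (fun w => complex.Im (f w)) u.

Definition pd (i : 'I_N) f : 'rV[R]_N -> R[i] := fun u =>
  'D_(delta_mx 0 i) (fun w => complex.Re (f w)) u +i*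
  'D_(delta_mx 0 i) (fun w => complex.Im (f w)) u.

Definition pds (s : seq 'I_N) f : 'rV[R]_N -> R[i] := foldr pd f s.

(* C^oo: all the iterated partial derivatives are Frechet differentiable *)
Definition smooth f : Prop := forall s u, cdifferentiable (pds s f) u.

Lemma cdifferentiableD f g u : cdifferentiable f u -> cdifferentiable g u ->
  cdifferentiable (f + g) u.
Proof.
move=> [fr fi] [gr gi]; split.
- have -> : (fun w => complex.Re ((f + g) w)) = (fun w => complex.Re (f w)) + (fun w => complex.Re (g w)).
    by apply/funext => w; rewrite !fctE; case: (f w) (g w) => ? ? [].
  exact: differentiableD.
- have -> : (fun w => complex.Im ((f + g) w)) = (fun w => complex.Im (f w)) + (fun w => complex.Im (g w)).
    by apply/funext => w; rewrite !fctE; case: (f w) (g w) => ? ? [].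
  exact: differentiableD.
Qed.

Lemma cdifferentiableM f g u : cdifferentiable f u -> cdifferentiable g u ->
  cdifferentiable (f * g) u.
Proof.
move=> [fr fi] [gr gi]; split.
- have -> : (fun w => complex.Re ((f * g) w)) = (fun w => complex.Re (f w)) * (fun w => complex.Re (g w))
      - (fun w => complex.Im (f w)) * (fun w => complex.Im (g w)).
    by apply/funext => w; rewrite !fctE; case: (f w) (g w) => ? ? [].
  by apply: differentiableB; exact: differentiableM.
- have -> : (fun w => complex.Im ((f * g) w)) = (fun w => complex.Re (f w)) * (fun w => complex.Im (g w))
      + (fun w => complex.Im (f w)) * (fun w => complex.Re (g w)).
    by apply/funext => w; rewrite !fctE; case: (f w) (g w) => ? ? [].
  by apply: differentiableD; exact: differentiableM.
Qed.

Lemma cdifferentiable_cst (c : R[i]) u : cdifferentiable (cst c) u.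
Proof. by split; exact: differentiable_cst. Qed.

Lemma cdifferentiable_conj f u : cdifferentiable f u ->
  cdifferentiable (fun w => (f w)^*) u.
Proof.
move=> [fr fi]; split.
- have -> // : (fun w => complex.Re (f w)^*) = (fun w => complex.Re (f w)).
  by apply/funext => w; case: (f w).
- have -> : (fun w => complex.Im (f w)^*) = - (fun w => complex.Im (f w)).
    by apply/funext => w; rewrite !fctE; case: (f w).
  exact: differentiableN.
Qed.

Lemma pdD i f g u : cdifferentiable f u -> cdifferentiable g u ->
  pd i (f + g) u = pd i f u + pd i g u.
Proof.
move=> [fr fi] [gr gi]; rewrite /pd.
have -> : (fun w => complex.Re ((f + g) w)) = (fun w => complex.Re (f w)) + (fun w => complex.Re (g w)).
  by apply/funext => w; rewrite !fctE; case: (f w) (g w) => ? ? [].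
have -> : (fun w => complex.Im ((f + g) w)) = (fun w => complex.Im (f w)) + (fun w => complex.Im (g w)).
  by apply/funext => w; rewrite !fctE; case: (f w) (g w) => ? ? [].
by rewrite !deriveD //; exact: diff_derivable.
Qed.

Lemma pdM i f g u : cdifferentiable f u -> cdifferentiable g u ->
  pd i (f * g) u = pd i f u * g u + f u * pd i g u.
Proof.
move=> [fr fi] [gr gi]; rewrite /pd.
have -> : (fun w => complex.Re ((f * g) w)) = (fun w => complex.Re (f w)) * (fun w => complex.Re (g w))
    - (fun w => complex.Im (f w)) * (fun w => complex.Im (g w)).
  by apply/funext => w; rewrite !fctE; case: (f w) (g w) => ? ? [].
have -> : (fun w => complex.Im ((f * g) w)) = (fun w => complex.Re (f w)) * (fun w => complex.Im (g w))
    + (fun w => complex.Im (f w)) * (fun w => complex.Re (g w)).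
  by apply/funext => w; rewrite !fctE; case: (f w) (g w) => ? ? [].
have dM (a b : 'rV[R]_N -> R) : differentiable a u -> differentiable b u ->
    derivable (a * b) u (delta_mx 0 i).
  by move=> da db; apply/diff_derivable/differentiableM.
rewrite deriveB ?deriveD ?deriveM; do ?[exact: diff_derivable|exact: dM].
case: (f u) (g u) => a b [c d].
by rewrite /=; simpc; congr (_ +i* _); rewrite /GRing.scale /=; ring.
Qed.

Lemma pd_cst i (c : R[i]) : pd i (cst c) = cst 0.
Proof. by apply/funext => u; rewrite /pd !derive_cst. Qed.

Lemma pd_conj i f u : cdifferentiable f u ->
  pd i (fun w => (f w)^*) u = (pd i f u)^*.
Proof.
move=> [fr fi]; rewrite /pd.
have -> : (fun w => complex.Re (f w)^*) = (fun w => complex.Re (f w)).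
  by apply/funext => w; case: (f w).
have -> : (fun w => complex.Im (f w)^*) = - (fun w => complex.Im (f w)).
  by apply/funext => w; rewrite !fctE; case: (f w).
rewrite deriveN; last exact: diff_derivable.
by [].
Qed.

Lemma pd_shift i f v : pd i (fun w => f (w + v)) = (fun w => pd i f (w + v)).
Proof.
have shiftE (g : 'rV[R]_N -> R) u d :
    'D_d (fun w => g (w + v)) u = 'D_d g (u + v).
  rewrite /derive; set F := (X in X @ _); set G := (X in _ = lim (X @ _)).
  suff -> : F = G by [].
  by apply/funext => h; rewrite /F /G /= addrA.
apply/funext => u; rewrite /pd.
by rewrite (shiftE (fun w => complex.Re (f w))) (shiftE (fun w => complex.Im (f w))).
Qed.

Let smoothn m f := forall s u, (size s <= m)%N -> cdifferentiable (pds s f) u.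

Let pds_rcons s i f : pds (rcons s i) f = pds s (pd i f).
Proof. by rewrite /pds foldr_rcons. Qed.

Let smoothnS m f : smoothn m.+1 f <->
  (forall u, cdifferentiable f u) /\ forall i, smoothn m (pd i f).
Proof.
split=> [H|[H0 H] s u].
  split=> [u|i s u ss]; first exact: (H [::]).
  by rewrite -pds_rcons; apply: H; rewrite size_rcons.
case/lastP: s => [|s i] ss; first exact: H0.
by rewrite pds_rcons; apply: H; rewrite size_rcons in ss.
Qed.

Let smoothn_le m f : smoothn m.+1 f -> smoothn m f.
Proof. by move=> H s u ss; apply: H; exact: leqW. Qed.

Let smoothnD m f g : smoothn m f -> smoothn m g -> smoothn m (f + g).
Proof.
elim: m f g => [|m IH] f g Hf Hg.
  by case=> // u _; apply: cdifferentiableD; [exact: (Hf [::])|exact: (Hg [::])].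
move/smoothnS: Hf => [Hf0 Hf]; move/smoothnS: Hg => [Hg0 Hg].
apply/smoothnS; split=> [u|i]; first exact: cdifferentiableD.
have -> : pd i (f + g) = pd i f + pd i g by apply/funext => u; rewrite pdD.
exact: IH.
Qed.

Let smoothnM m f g : smoothn m f -> smoothn m g -> smoothn m (f * g).
Proof.
elim: m f g => [|m IH] f g Hf Hg.
  by case=> // u _; apply: cdifferentiableM; [exact: (Hf [::])|exact: (Hg [::])].
have [Hf' Hg'] := (smoothn_le Hf, smoothn_le Hg).
move/smoothnS: Hf => [Hf0 Hf]; move/smoothnS: Hg => [Hg0 Hg].
apply/smoothnS; split=> [u|i]; first exact: cdifferentiableM.
have -> : pd i (f * g) = pd i f * g + f * pd i g by apply/funext => u; rewrite pdM.
by apply: smoothnD; exact: IH.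
Qed.

Let smoothnP f : smooth f <-> forall m, smoothn m f.
Proof. by split=> [H m s u _|H s u]; [exact: H|exact: (H (size s))]. Qed.

Lemma smoothD f g : smooth f -> smooth g -> smooth (f + g).
Proof. by move=> /smoothnP Hf /smoothnP Hg; apply/smoothnP => m; exact: smoothnD. Qed.

Lemma smoothM f g : smooth f -> smooth g -> smooth (f * g).
Proof. by move=> /smoothnP Hf /smoothnP Hg; apply/smoothnP => m; exact: smoothnM. Qed.

Lemma smooth_cst (c : R[i]) : smooth (cst c).
Proof.
move=> s u; suff [d ->] : exists d, pds s (cst c) = cst d
  by exact: cdifferentiable_cst.
elim: s => [|i s [d IH]]; first by exists c.
by exists 0; rewrite /pds /= -/(pds s _) IH pd_cst.
Qed.

Lemma smoothZ (c : R[i]) f : smooth f -> smooth (c *: f).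
Proof.
move=> Hf; have -> : c *: f = cst c * f by apply/funext.
by apply: smoothM => //; exact: smooth_cst.
Qed.

Lemma smooth_pd i f : smooth f -> smooth (pd i f).
Proof. by move=> Hf s u; rewrite -pds_rcons; exact: Hf. Qed.

Lemma smooth_conj f : smooth f -> smooth (fun w => (f w)^*).
Proof.
move=> Hf; suff H s : pds s (fun w => (f w)^*) = (fun w => (pds s f w)^*).
  by move=> s u; rewrite H; apply: cdifferentiable_conj; exact: Hf.
elim: s => // i s IH; rewrite /pds /= -!/(pds s _) IH.
by apply/funext => u; rewrite pd_conj //; exact: Hf.
Qed.

Lemma smooth_by_pd f : (forall u, cdifferentiable f u) ->
  (forall i, smooth (pd i f)) -> smooth f.
Proof.
move=> H0 H; apply/smoothnP => -[|m]; first by case=> // u _; exact: H0.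
by apply/smoothnS; split=> // i; have /smoothnP := H i; exact.
Qed.

End Smooth.

Section Torus.
Variables (R : realType) (n : nat).
Implicit Types (u v : 'rV[R]_(n + n)) (l : 'rV[int]_(n + n)).

Definition xcoord (i : 'I_n) : 'I_(n + n) := lshift n i.
Definition ycoord (i : 'I_n) : 'I_(n + n) := rshift n i.

Definition lattice l : 'rV[R]_(n + n) := map_mx intr l.

Definition periodic (f : 'rV[R]_(n + n) -> R[i]) : Prop :=
  forall l u, f (u + lattice l) = f u.

Definition torus_smooth : {pred 'rV[R]_(n + n) -> R[i]} :=
  fun f => `[< smooth f /\ periodic f >].

Fact torus_smooth_subring : subring_closed torus_smooth.
Proof.
split.
- by apply/asboolP; split; [exact: smooth_cst|].
- move=> f g /asboolP[fs fp] /asboolP[gs gp]; apply/asboolP; split.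
    by rewrite -scaleN1r; apply: smoothD => //; exact: smoothZ.
  by move=> l u; rewrite !fctE fp gp.
- move=> f g /asboolP[fs fp] /asboolP[gs gp]; apply/asboolP; split.
    exact: smoothM.
  by move=> l u; rewrite !fctE fp gp.
Qed.
HB.instance Definition _ :=
  GRing.isSubringClosed.Build ('rV[R]_(n + n) -> R[i]) torus_smooth
    torus_smooth_subring.

Fact torus_smooth_scale : GRing.scaler_closed torus_smooth.
Proof.
move=> a f /asboolP[fs fp]; apply/asboolP; split; first exact: smoothZ.
by move=> l u; rewrite !fctE fp.
Qed.
HB.instance Definition _ :=
  GRing.isScaleClosed.Build R[i] ('rV[R]_(n + n) -> R[i]) torus_smooth
    torus_smooth_scale.

(* C^oo(X, C), as a ring of functions on R^2n *)
Record CinfX := MkCinfX {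
  CinfX_fun :> 'rV[R]_(n + n) -> R[i];
  CinfXP : CinfX_fun \in torus_smooth }.
HB.instance Definition _ := [isSub for CinfX_fun].
HB.instance Definition _ := [Choice of CinfX by <:].
HB.instance Definition _ := [SubChoice_isSubComNzRing of CinfX by <:].
HB.instance Definition _ := [SubZmodule_isSubLmodule of CinfX by <:].

Lemma CinfX_pd_subproof (i : 'I_(n + n)) (f : CinfX) : pd i f \in torus_smooth.
Proof.
have /asboolP[fs fp] := CinfXP f; apply/asboolP; split; first exact: smooth_pd.
move=> l u; rewrite -[LHS](congr1 (@^~ u) (pd_shift i f (lattice l))).
by congr (pd i _ u); apply/funext => w; exact: fp.
Qed.
Definition CinfX_pd i f := MkCinfX (CinfX_pd_subproof i f).

Lemma CinfX_conj_subproof (f : CinfX) : (fun u => (f u)^*) \in torus_smooth.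
Proof.
have /asboolP[fs fp] := CinfXP f; apply/asboolP; split; first exact: smooth_conj.
by move=> l u; rewrite fp.
Qed.
Definition CinfX_conj f := MkCinfX (CinfX_conj_subproof f).

End Torus.

Section Integral.
Variable R : realType.

Definition cintegral (A : set R) (f : R -> R[i]) : R[i] :=
  (\int[lebesgue_measure]_(x in A) complex.Re (f x)) +i*
  (\int[lebesgue_measure]_(x in A) complex.Im (f x)).

(* Iterated integral over A^N; by Fubini it is the Lebesgue integral whenever f is
   absolutely integrable. *)
Fixpoint integral_cube (A : set R) (N : nat) :
    ('rV[R]_N -> R[i]) -> R[i] :=
  match N with
  | 0 => fun f => f 0
  | N'.+1 => fun f => cintegral A (fun x => integral_cube A
      (fun v : 'rV[R]_N' => f (row_mx (x%:M : 'rV[R]_1) v)))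
  end.

Definition integral_unit_cube (N : nat) (f : 'rV[R]_N -> R[i]) : R[i] :=
  integral_cube `[0, 1] f.

Definition integral_Rn (N : nat) (f : 'rV[R]_N -> R[i]) : R[i] :=
  integral_cube setT f.

Definition expi (x : R) : R[i] := cos x +i* sin x.

End Integral.

Section TemperedDistributions.
Variables (R : realType) (n : nat).
Implicit Types (phi chi h : 'rV[R]_n -> R[i]) (y : 'rV[R]_n).
Implicit Types (a b : seq 'I_n).
Implicit Types T : ('rV[R]_n -> R[i]) -> R[i].

Definition test_function phi : Prop :=
  smooth phi /\ exists r : R, forall y, r < `|y| -> phi y = 0.

(* y^a d^b phi, multi-indices being written as words in the coordinates *)
Definition schwartz_term a b phi y : R[i] :=
  (\prod_(i <- a) y 0 i)%:C * pds b phi y.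

Definition schwartz phi : Prop := smooth phi /\
  forall a b, exists M : R, forall y, `|schwartz_term a b phi y| <= M%:C.

(* The values of T outside the Schwartz functions are irrelevant. *)
Definition tempered T : Prop :=
  (forall (c : R[i]) phi psi, schwartz phi -> schwartz psi ->
     T (c *: phi + psi) = c * T phi + T psi) /\
  exists (A : R) (p : nat), forall phi (M : R), schwartz phi ->
    (forall a b y, (size a <= p)%N -> (size b <= p)%N ->
       `|schwartz_term a b phi y| <= M%:C) ->
    `|T phi| <= (A * M)%:C.

Definition distribution_of h : ('rV[R]_n -> R[i]) -> R[i] :=
  fun phi => integral_Rn (h * phi).

Definition represented_by T h : Prop := smooth h /\
  forall phi, test_function phi -> T phi = distribution_of h phi.

(* T is compactly supported and z is the value at the smooth function h of its
   canonical extension *)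
Definition compact_eval T h (z : R[i]) : Prop :=
  exists chi, [/\ test_function chi,
    forall phi, schwartz phi -> T (chi * phi) = T phi
    & z = T (chi * h)].

End TemperedDistributions.

Section LineBundle.
Variables (R : realType) (n k : nat).
Implicit Types (u v : 'rV[R]_(n + n)) (l : 'rV[int]_(n + n)).

Definition omega u v : R := \sum_(i < n)
  (u 0 (ycoord i) * v 0 (xcoord i) - u 0 (xcoord i) * v 0 (ycoord i)).

Definition alpha l : R[i] :=
  (-1) ^ (\sum_(i < n) l 0 (xcoord i) * l 0 (ycoord i)).

Definition multiplier l u : R[i] :=
  alpha l ^+ k * expi (- (k%:R * pi * omega u (lattice R l))).

Definition smooth_section : {pred 'rV[R]_(n + n) -> R[i]} :=
  fun t => `[< smooth t /\
    forall l u, t (u + lattice R l) = multiplier l u * t u >].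

Fact smooth_section_submod : submod_closed smooth_section.
Proof.
split.
  apply/asboolP; split; first exact: smooth_cst.
  by move=> l u; exact/esym/mulr0.
move=> c s t /asboolP[ss sp] /asboolP[ts tp]; apply/asboolP; split.
  by apply: smoothD => //; exact: smoothZ.
by move=> l u; rewrite !fctE sp tp mulrDr [c *: _]mulrCA.
Qed.
HB.instance Definition _ :=
  GRing.isSubmodClosed.Build R[i] ('rV[R]_(n + n) -> R[i]) smooth_section
    smooth_section_submod.

(* Gamma^oo(X, L^k) *)
Record GammaL := MkGammaL {
  GammaL_fun :> 'rV[R]_(n + n) -> R[i];
  GammaLP : GammaL_fun \in smooth_section }.
HB.instance Definition _ := [isSub for GammaL_fun].
HB.instance Definition _ := [Choice of GammaL by <:].
HB.instance Definition _ := [SubChoice_isSubLmodule of GammaL by <:].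

Fact mul_section_subproof (f : CinfX R n) (t : GammaL) :
  ((f : 'rV[R]_(n + n) -> R[i]) * (t : 'rV[R]_(n + n) -> R[i]))
    \in smooth_section.
Proof.
have /asboolP[fs fp] := CinfXP f; have /asboolP[ts tp] := GammaLP t.
apply/asboolP; split; first exact: smoothM.
by move=> l u; rewrite !fctE fp tp mulrCA.
Qed.
Definition mul_section f t : GammaL := MkGammaL (mul_section_subproof f t).

Lemma omegaDl u u' v : omega (u + u') v = omega u v + omega u' v.
Proof.
rewrite /omega -big_split; apply: eq_bigr => i _; rewrite !mxE /=; ring.
Qed.

Lemma omegaZl c u v : omega (c *: u) v = c * omega u v.
Proof.
by rewrite /omega big_distrr; apply: eq_bigr => i _; rewrite !mxE /=; ring.
Qed.

Lemma omegaC u v : omega u v = - omega v u.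
Proof. by rewrite /omega -sumrN; apply: eq_bigr => i _; ring. Qed.

Lemma differentiable_omega v u : differentiable (omega ^~ v) u.
Proof.
have -> : omega ^~ v = \sum_(i < n) (fun u =>
    u 0 (ycoord i) * v 0 (xcoord i) - u 0 (xcoord i) * v 0 (ycoord i)).
  by apply/funext => w; rewrite fct_sumE.
apply: differentiable_sum => i; apply: differentiableB.
- by apply: differentiableM; [exact: differentiable_coord|exact: differentiable_cst].
- by apply: differentiableM; [exact: differentiable_coord|exact: differentiable_cst].
Qed.

Let derive_comp_omega (g : R -> R) (v d u : 'rV[R]_(n + n)) :
  (forall x, derivable g x 1) ->
  'D_d (fun w => g (omega w v)) u = omega d v * 'D_1 g (omega u v).
Proof.
move=> dg; have -> : 'D_d (fun w => g (omega w v)) u = 'D_(omega d v) g (omega u v).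
  rewrite /derive; set F := (X in X @ _); set G := (X in _ = lim (X @ _)).
  suff -> : F = G by [].
  by apply/funext => h; rewrite /F /G /= omegaDl omegaZl.
have dgx : differentiable g (omega u v) by exact/derivable1_diffP.
rewrite !deriveE // -[in LHS](mulr1 (omega d v)).
exact: (linearZZ ('d g (omega u v)) (omega d v) 1).
Qed.

Lemma pd_omega j v :
  pd j (fun u => (omega u v)%:C) = cst (omega (delta_mx 0 j) v)%:C.
Proof.
apply/funext => u; rewrite /pd derive_cst.
rewrite (derive_comp_omega (g := id)) => [|x]; last exact: derivable_id.
by rewrite derive_id mulr1.
Qed.

Lemma smooth_omega v : smooth (fun u => (omega u v)%:C).
Proof.
apply: smooth_by_pd => [u|j].
  by split; [exact: differentiable_omega|exact: differentiable_cst].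
by rewrite pd_omega; exact: smooth_cst.
Qed.

Let derivable_scale (g : R -> R) (c x : R) : (forall x, derivable g x 1) ->
  derivable (fun y => g (c * y)) x 1.
Proof.
move=> dg; apply/derivable1_diffP.
apply: (@differentiable_comp _ _ _ _ ( *%R c) g).
  apply/derivable1_diffP; have -> : *%R c = c *: (id : R -> R) by [].
  exact: derivableZ.
exact/derivable1_diffP.
Qed.

Let derive_scale (g : R -> R) (c x : R) : (forall x, derivable g x 1) ->
  'D_1 (fun y => g (c * y)) x = c * 'D_1 g (c * x).
Proof.
move=> dg; rewrite -!derive1E (@derive1_comp _ ( *%R c) g) //.
  rewrite mulrC; congr (_ * _); rewrite derive1E.
  have -> : *%R c = c *: (id : R -> R) by [].
  by rewrite deriveZ ?derive_id; [exact: mulr1|exact: derivable_id].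
Qed.

Lemma cdifferentiable_expi_omega c v u :
  cdifferentiable (fun w => expi (c * omega w v)) u.
Proof.
have dl : differentiable (fun w => c * omega w v) u.
  exact: (differentiableM (differentiable_cst _ _) (differentiable_omega _ _)).
split; apply: (differentiable_comp dl); apply/derivable1_diffP.
- exact: derivable_cos.
- exact: derivable_sin.
Qed.

Lemma pd_expi_omega c v j u : pd j (fun w => expi (c * omega w v)) u =
  (0 +i* (c * omega (delta_mx 0 j) v)) * expi (c * omega u v).
Proof.
rewrite /pd.
rewrite (derive_comp_omega (g := fun y => cos (c * y))); last first.
  by move=> x; apply: derivable_scale; exact: derivable_cos.
rewrite (derive_comp_omega (g := fun y => sin (c * y))); last first.
  by move=> x; apply: derivable_scale; exact: derivable_sin.
rewrite !derive_scale; [|exact: derivable_sin|exact: derivable_cos].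
rewrite !derive_val /expi; simpc.
by congr (_ +i* _); ring.
Qed.

Definition nabla_fun (j : 'I_(n + n)) (t : 'rV[R]_(n + n) -> R[i]) u : R[i] :=
  pd j t u - (0 +i* (k%:R * pi * omega u (delta_mx 0 j))) * t u.

Fact nabla_subproof j (t : GammaL) : nabla_fun j t \in smooth_section.
Proof.
have /asboolP[ts tp] := GammaLP t; apply/asboolP; split.
  have -> : nabla_fun j t = pd j t + (-1) *:
      (cst (0 +i* (k%:R * pi)) * (fun u => (omega u (delta_mx 0 j))%:C)
       * (t : _ -> R[i])).
    apply/funext => u; rewrite /nabla_fun !fctE scaleN1r; congr (_ - _ * _).
    by simpc.
  apply: smoothD; first exact: smooth_pd.
  apply/smoothZ/smoothM => //; apply: smoothM; first exact: smooth_cst.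
  exact: smooth_omega.
move=> l u; rewrite /nabla_fun tp.
rewrite -[pd j t (u + _)](congr1 (@^~ u) (pd_shift j t (lattice R l))).
have -> : (fun w => t (w + lattice R l)) = cst (alpha l ^+ k) *
    (fun w => expi (- (k%:R * pi) * omega w (lattice R l))) * (t : _ -> R[i]).
  by apply/funext => w; rewrite !fctE tp /multiplier mulNr.
have de := cdifferentiable_expi_omega (- (k%:R * pi)) (lattice R l) u.
have dc := cdifferentiable_cst (alpha l ^+ k) u.
rewrite pdM; [|exact: cdifferentiableM|exact: (ts [::])].
rewrite pdM // pd_cst pd_expi_omega !fctE mul0r add0r.
have -> : multiplier l u =
    alpha l ^+ k * expi (- (k%:R * pi) * omega u (lattice R l)).
  by rewrite /multiplier mulNr.
rewrite omegaDl (omegaC (lattice R l)).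
set e := expi _; set a := alpha l ^+ k.
set w1 := omega (delta_mx 0 j) _; set w2 := omega u (delta_mx 0 j).
have -> : 0 +i* (k%:R * pi * (w2 - w1)) =
  0 +i* (k%:R * pi * w2) + 0 +i* (- (k%:R * pi) * w1) :> R[i].
  by simpc; congr (_ +i* _); ring.
by move: (0 +i* _) (0 +i* _) => c1 c2; ring.
Qed.
Definition nabla j t : GammaL := MkGammaL (nabla_subproof j t).

End LineBundle.

Section Quantization.
Variables (R : realType) (n k : nat).
Implicit Types (t : GammaL R n k) (f : CinfX R n).

Definition hbar : R := k%:R^-1.

Definition unit_cube N : set 'rV[R]_N := [set u | forall j, 0 <= u 0 j <= 1].

(* A functional s in this type stands for t |-> <s, t> = s(\bar t), and is
   therefore conjugate-linear in t when s is a distributional section. *)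
Definition functional := GammaL R n k -> R[i].

Definition distributional (s : functional) : Prop :=
  (forall (c : R[i]) t t', s (c *: t + t') = c^* * s t + s t') /\
  exists (A : R) (p : nat), forall t (M : R),
    (forall (b : seq 'I_(n + n)) u, (size b <= p)%N -> unit_cube u ->
       `|pds b t u| <= M%:C) ->
    `|s t| <= (A * M)%:C.

(* <f s, t> = <s, \bar f t> *)
Definition dmul f (s : functional) : functional :=
  fun t => s (mul_section (CinfX_conj f) t).

(* <nabla_j s, t> = - <s, nabla_j t> *)
Definition dnabla (j : 'I_(n + n)) (s : functional) : functional :=
  fun t => - s (nabla j t).

(* The quantum Hilbert space, the half-form line being identified with C by its
   generator rho: s stands for s (x) rho.  xi runs over the smooth sections
   \sum_i xi_i d/dx^i of the polarization, and the condition is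
   nabla_(\bar xi) s = 0. *)
Definition polarized : set functional := [set s | distributional s /\
  forall xi : 'I_n -> CinfX R n,
    \sum_(i < n) dmul (CinfX_conj (xi i)) (dnabla (xcoord i) s) = 0].

(* Z_k^n, through its representatives in {0, ..., k-1}^n *)
Definition Zkn := {ffun 'I_n -> 'I_k}.
Implicit Types m : Zkn.

Definition Zkn_row m : 'rV[R]_n := \row_i (m i)%:R.

(* s |-> \tilde s *)
Definition twist t (u : 'rV[R]_(n + n)) : R[i] :=
  expi (k%:R * pi * \sum_(i < n) u 0 (xcoord i) * u 0 (ycoord i)) * t u.

Definition weil_brezin t m (y : 'rV[R]_n) : R[i] :=
  integral_unit_cube (fun x : 'rV[R]_n =>
    twist t (row_mx x (y + hbar *: Zkn_row m)) *
    expi (- (2 * pi * \sum_(i < n) Zkn_row m 0 i * x 0 i))).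

(* inverse Weil-Brezin transform of a family of tempered distributions *)
Definition of_weil_brezin (S : Zkn -> ('rV[R]_n -> R[i]) -> R[i]) : functional :=
  fun t => \sum_(m : Zkn) S m (fun y => (weil_brezin t m y)^*).

Definition has_weil_brezin (s : functional)
    (S : Zkn -> ('rV[R]_n -> R[i]) -> R[i]) : Prop :=
  (forall m, tempered (S m)) /\ s = of_weil_brezin S.

(* z = <s, t> where the Weil-Brezin coefficients of s are compactly supported
   and those of t are smooth functions; this is the extension of the L^2 pairing
   given by Hormander's criterion. *)
Definition is_pairing (s t : functional) (z : R[i]) : Prop :=
  exists S T h w, [/\ has_weil_brezin s S, has_weil_brezin t T,
    forall m, represented_by (T m) (h m),
    forall m, compact_eval (S m) (fun y => (h m y)^*) (w m)
    & z = \sum_(m : Zkn) w m].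

Definition pairing (s t : functional) : R[i] := xget 0 (is_pairing s t).

Definition theta m : functional := of_weil_brezin (fun m' phi =>
  if m' == m then ((2 * k%:R) `^ (- (n%:R / 2)))%:C * phi 0 else 0).

Definition theta_check m : functional := of_weil_brezin (fun m' =>
  distribution_of (cst (if m' == m then (2 `^ (- (n%:R / 2)))%:C else 0))).

Definition sigma m : functional :=
  (2 `^ (n%:R / 4) * k%:R `^ (n%:R / 2))%:C *: theta m.

Definition sigma_check m : functional :=
  (2 `^ (n%:R / 4) * k%:R `^ (n%:R / 2))%:C *: theta_check m.

(* <rho, \check rho> *)
Definition half_form_pairing : R[i] :=
  (2 `^ (n%:R / 2) * k%:R `^ (- (n%:R / 2)))%:C.

(* < f (s (x) rho), t (x) \check rho >, where <f s, t> = <s, \bar f t> *)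
Definition hpairing f (s t : functional) : R[i] :=
  half_form_pairing * pairing s (dmul (CinfX_conj f) t).

(* Q_f s = Pi (f s) = \sum_m <f s, \check sigma^m> sigma^m *)
Definition toeplitz f (s : functional) : functional :=
  \sum_(m : Zkn) hpairing f s (sigma_check m) *: sigma m.

End Quantization.

(* t is the trace of the finite-rank endomorphism Q of the subspace V: the trace
   of Q on the span of a free family b of V containing Q(V).  If V has finite
   dimension, b may be any basis of V. *)
Definition is_trace (K : fieldType) (E : lmodType K) (V : set E) (Q : E -> E)
    (t : K) : Prop :=
  exists d (b : 'I_d -> E) (A : 'M[K]_d), [/\ forall i, V (b i),
    forall c : 'I_d -> K, \sum_i c i *: b i = 0 -> forall i, c i = 0,
    forall s, V s -> exists c : 'I_d -> K, Q s = \sum_i c i *: b i,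
    forall j, Q (b j) = \sum_i A i j *: b i
    & t = \tr A].

Section FormalTrace.
Variables (R : realType) (n : nat).
Implicit Types (f g : CinfX R n) (F G : nat -> CinfX R n).

(* \int_X f e^omega = \int_X f omega^n / n!, and omega^n / n! is the volume form
   prod_i dy^i /\ dx^i, which is positive for the chosen orientation *)
Definition integral_X f : R[i] := integral_unit_cube f.

Definition iter_pd (e : 'I_n -> 'I_(n + n)) (I : 'I_n -> nat) f : CinfX R n :=
  foldr (fun i g => iter (I i) (CinfX_pd (e i)) g) f (enum 'I_n).

(* the sum is over the multi-indices of length j *)
Definition star_coef (j : nat) f g : CinfX R n :=
  (0 +i* (2 * pi)) ^- j *:
  \sum_(I : {ffun 'I_n -> 'I_j.+1} | \sum_i (I i : nat) == j)
    ((\prod_i (I i)`!)%:R^-1 : R[i]) *: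
      (iter_pd (@ycoord n) (fun i => I i) f
       * iter_pd (@xcoord n) (fun i => I i) g).

Definition star f g : nat -> CinfX R n := fun j => star_coef j f g.

Definition formal_const (V : nmodType) (v : V) : nat -> V :=
  fun j => if j == 0%N then v else 0.

(* action of C[[hbar]] on V[[hbar]] *)
Definition formal_scale (V : lmodType R[i]) (c : nat -> R[i]) (F : nat -> V) :
    nat -> V :=
  fun j => \sum_(i < j.+1) c i *: F (j - i)%N.

(* Elements of hbar^-n C[[hbar]] are represented by nat -> R[i], the index j
   being that of the coefficient of hbar^(j - n). *)
Definition formal_functional := (nat -> CinfX R n) -> nat -> R[i]^o.
Implicit Types Tr : formal_functional.

Definition formal_linear Tr : Prop :=
  (forall F G, Tr (F + G) = Tr F + Tr G) /\
  forall (c : nat -> R[i]) F, Tr (formal_scale c F) = formal_scale c (Tr F).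

(* continuity for the Frechet topologies of C^oo(X, C)[[hbar]] and
   hbar^-n C[[hbar]] *)
Definition formal_continuous Tr : Prop :=
  forall j, exists (A : R) (p : nat), forall F (M : R),
    (forall l (b : seq 'I_(n + n)) u, (l <= p)%N -> (size b <= p)%N ->
       `|pds b (F l) u| <= M%:C) ->
    `|Tr F j| <= (A * M)%:C.

Definition trace_map Tr : Prop :=
  [/\ formal_linear Tr, formal_continuous Tr,
    forall f g, Tr (star f g) = Tr (star g f)
    & forall f, Tr (formal_const f) 0%N = integral_X f].

(* a k ~ \sum_j c_j hbar^(j - n) as hbar = 1/k -> 0+ *)
Definition asymptotic_expansion (a c : nat -> R[i]) : Prop :=
  forall N : nat, exists (A : R) (k0 : nat), forall k : nat,
    (0 < k)%N -> (k0 <= k)%N ->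
    `|a k - \sum_(j < N) c j * (hbar R k ^ (j%:Z - n%:Z))%:C|
      <= (A * hbar R k ^ (N%:Z - n%:Z))%:C.

End FormalTrace.

(* Main.v *)
Require Import Defs.
From HB Require Import structures.
From mathcomp Require Import all_boot all_order all_algebra.
From mathcomp Require Import complex ring lra zify.
From mathcomp Require Import all_classical all_reals all_analysis.
From mathcomp Require Import measurable_realfun.
Set Implicit Arguments.
Unset Strict Implicit.
Unset Printing Implicit Defensive.
Import Order.TTheory GRing.Theory Num.Theory.
Import numFieldNormedType.Exports.
Local Open Scope classical_set_scope.
Local Open Scope ring_scope.
Local Open Scope complex_scope.

(** The trace can be computed exactly for every k, before any asymptotics.
In the Weil-Brezin picture sigma^m is a multiple of the Dirac mass at the
origin of the m-th copy of R^n.  Pairing f sigma^m with the dual vector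
therefore only requires the value at 0 of the m-th coefficient of conj(f) times
that dual vector.  This coefficient is a smooth periodic function, the finite
Fourier sum of conj(f) over the points x of (1/k)Z^n / Z^n ([hcoef],
[sigma_check_weil_brezin]), and at 0 all the constants cancel
([scale_normalization]): each diagonal entry of Q_f is an average of f over
x in (1/k)Z^n / Z^n at y = m/k ([hpairing_diag]).  Summing over m, tr Q_f is
k^n times the average of f over all the k-torsion points of the torus
([toeplitz_traceE]).  Such an average is the trapezoid rule for a smooth
periodic function, whose error is at most a multiple of k^-r, for every r; the
multiple depends on the r-th derivatives of f in each coordinate ([trapezoid]).
This gives the estimate and the asymptotic expansion.

Two points need real work.

The first is the formula for the coefficients.  The dual vector is an integral
over R^n of Weil-Brezin coefficients, and an integral over R^n of an expression
that is quasi-periodic in y is a sum over torsion points in x of integrals over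
the unit cube: this is Poisson summation in Zak form ([poisson_sum]).  The
one-dimensional case averages the partial sums against the Fejer kernel, which
only uses that the integrand is Lipschitz in x ([poisson_dim1]); the general
case peels off one pair of coordinates at a time.  Applied to both sides of
[sigma_check_weil_brezin] it turns the claim into the orthogonality of the
characters of (Z/k)^n ([wb_char_orth]).  The integrals over R^n converge because
the coefficients of a smooth section decay ([weil_brezin_decay]): covariant
differentiation in x multiplies them by - 2 pi i k y.  The same identity shows
that sigma^m is polarized.

The second is that the pairing is well defined.  It is specified through some
families of coefficients of the two distributional sections, so these
coefficients have to be determined by the sections.  For each test function on
R^n an explicit theta-like series is a smooth section having this function as
its only non-zero coefficient ([wb_section], [weil_brezin_wb_section]); hence
the coefficients are determined on test functions ([of_weil_brezin_inj]), and a
smooth function representing a coefficient is determined at 0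
([represented_eq0]).  The same sections show that the sigma^m are free.

The trace property on formal series holds coefficient by coefficient: the
difference of the j-th coefficients of star f g and star g f is a sum of total
derivatives, by moving j derivatives in y and j derivatives in x across the
product ([star_coef_trace]).

All integrals are iterated one-dimensional Lebesgue integrals.  The class of
functions used throughout is that of sequentially continuous functions dominated
by a product weight w(v_1) ... w(v_N), with w = 1 on [0, 1] and w = 1 / (1 + x^2)
on R: it is stable under partial integration by dominated convergence, and on it
the order of integration may be changed. *)

(** * Row vectors and sequential continuity *)

Section RowVectors.
Variable R : realType.

(** The recursion in the definition of iterated integrals peels off the first
coordinate; vectors are taken apart the same way here. *)
Definition rcons1 N (x : R) (v : 'rV[R]_N) : 'rV[R]_N.+1 := row_mx (x%:M : 'rV[R]_1) v.

Lemma rcons1_0 N x (v : 'rV[R]_N) : rcons1 x v 0 ord0 = x.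
Proof.
rewrite /rcons1; have -> : ord0 = lshift N (ord0 : 'I_1) :> 'I_(1 + N) by exact/val_inj.
by apply: etrans (row_mxEl _ _ _ _) _; rewrite mxE eqxx mulr1n.
Qed.

Lemma rcons1_S N x (v : 'rV[R]_N) i : rcons1 x v 0 (lift ord0 i) = v 0 i.
Proof.
rewrite /rcons1; have -> : lift ord0 i = rshift 1 i :> 'I_(1 + N) by exact/val_inj.
exact: row_mxEr.
Qed.

Lemma rcons1_surj N (v : 'rV[R]_N.+1) : v = rcons1 (v 0 ord0) (\row_i v 0 (lift ord0 i)).
Proof.
apply/rowP => i; case: (unliftP ord0 i) => [j ->|->].
  by rewrite rcons1_S mxE.
by rewrite rcons1_0.
Qed.

Lemma cvg_rowP N (u : nat -> 'rV[R]_N) (v : 'rV[R]_N) :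
  (u n @[n --> \oo] --> v) <-> forall i : 'I_N, u n 0 i @[n --> \oo] --> v 0 i.
Proof.
split=> [uv i|uv].
  have H := @coord_continuous R 1 N 0 i v.
  have := cvg_comp u (fun M : 'rV[R]_N => M 0 i) uv H; exact.
apply/cvgrPdist_le => e e0.
have : \forall n \near \oo, forall i, `|v 0 i - u n 0 i| <= e.
  apply: filter_forall => i.
  by move/cvgrPdist_le : (uv i) => /(_ e e0).
apply: filterS => n H.
rewrite [leLHS]/Num.Def.normr/= mx_normrE; apply/bigmax_leP; split=> [|[i j] _]; first exact: ltW.
by rewrite !mxE /= (ord1 i).
Qed.

(** Sequential rather than topological continuity: dominated convergence is a
statement about sequences, so this is the form of continuity that passes through
an integral sign. *)
Definition scont (T : topologicalType) (f : T -> R) := forall (u : nat -> T) v,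
  u n @[n --> \oo] --> v -> f (u n) @[n --> \oo] --> f v.

Lemma continuous_scont (T : topologicalType) (f : T -> R) : continuous f -> scont f.
Proof. by move=> cf u v uv; exact: (cvg_comp _ _ uv (cf v)). Qed.

Lemma scont_comp (T U : topologicalType) (f : T -> R) (g : U -> T) :
  scont f -> continuous g -> scont (f \o g).
Proof. by move=> sf cg u v uv; apply: sf; exact: (cvg_comp _ _ uv (cg v)). Qed.

Lemma scont_compl (T : topologicalType) (f : R -> R) (g : T -> R) :
  scont f -> scont g -> scont (f \o g).
Proof. by move=> sf sg u v uv; apply: sf; exact: sg. Qed.

Lemma scont_continuous (f : R -> R) : scont f -> continuous f.
Proof.
move=> sf x; apply/(@cvg_nbhsP _ R^o) => u ux; exact: sf.
Qed.

Section Closure.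
Variable T : topologicalType.
Implicit Types f g : T -> R.
Lemma scontD f g : scont f -> scont g -> scont (fun x => f x + g x).
Proof. by move=> sf sg u v uv; apply: cvgD; [exact: sf|exact: sg]. Qed.
Lemma scontN f : scont f -> scont (fun x => - f x).
Proof. by move=> sf u v uv; apply: cvgN; exact: sf. Qed.
Lemma scontB f g : scont f -> scont g -> scont (fun x => f x - g x).
Proof. by move=> sf sg u v uv; apply: cvgB; [exact: sf|exact: sg]. Qed.
Lemma scontM f g : scont f -> scont g -> scont (fun x => f x * g x).
Proof. by move=> sf sg u v uv; apply: cvgM; [exact: sf|exact: sg]. Qed.
Lemma scont_cst (c : R) : scont (fun _ : T => c).
Proof. by move=> u v uv; exact: cvg_cst. Qed.
Lemma scont_sum (I : Type) (r : seq I) (F : I -> T -> R) :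
  (forall i, scont (F i)) -> scont (fun x => \sum_(i <- r) F i x).
Proof.
move=> sF; elim: r => [|i r IH].
  by under eq_fun do rewrite big_nil; exact: scont_cst.
by under eq_fun do rewrite big_cons; apply: scontD.
Qed.
Lemma scont_prod (I : Type) (r : seq I) (F : I -> T -> R) :
  (forall i, scont (F i)) -> scont (fun x => \prod_(i <- r) F i x).
Proof.
move=> sF; elim: r => [|i r IH].
  by under eq_fun do rewrite big_nil; exact: scont_cst.
by under eq_fun do rewrite big_cons; apply: scontM.
Qed.
Lemma scont_ext f g : f =1 g -> scont f -> scont g.
Proof. by move=> /funext ->. Qed.
End Closure.

Lemma cvg_ext (f g : nat -> R) (l : R) : (forall k, f k = g k) ->
  g k @[k --> \oo] --> l -> f k @[k --> \oo] --> l.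
Proof. by move=> /funext ->. Qed.

Lemma cvg_rcons1 N (x : nat -> R) a (v : nat -> 'rV[R]_N) b :
  x n @[n --> \oo] --> a -> v n @[n --> \oo] --> b ->
  rcons1 (x n) (v n) @[n --> \oo] --> rcons1 a b.
Proof.
move=> xa /cvg_rowP vb; apply/cvg_rowP => i; case: (unliftP ord0 i) => [j ->|->].
  by rewrite rcons1_S; apply: cvg_ext (vb j) => k; rewrite rcons1_S.
by rewrite rcons1_0; apply: cvg_ext xa => k; rewrite rcons1_0.
Qed.

Lemma cvg_seq_pair (T U : topologicalType) (f : nat -> T) (g : nat -> U) a b :
  f k @[k --> \oo] --> a -> g k @[k --> \oo] --> b ->
  (f k, g k) @[k --> \oo] --> ((a, b) : T * U).
Proof. move=> fa gb; exact: (cvg_pair fa gb). Qed.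

Lemma cvg_seq_fst (T U : topologicalType) (f : nat -> T * U) (p : T * U) :
  f k @[k --> \oo] --> p -> (f k).1 @[k --> \oo] --> p.1.
Proof. move=> fp; exact: (cvg_comp _ _ fp cvg_fst). Qed.

Lemma cvg_seq_snd (T U : topologicalType) (f : nat -> T * U) (p : T * U) :
  f k @[k --> \oo] --> p -> (f k).2 @[k --> \oo] --> p.2.
Proof. move=> fp; exact: (cvg_comp _ _ fp cvg_snd). Qed.

Lemma scont_seq_bounded (T : topologicalType) (C : T -> R) (t : nat -> T) (s : T) : scont C ->
  t n @[n --> \oo] --> s -> exists B, forall n, C (t n) <= B.
Proof.
move=> sC ts; have cvt : cvgn (C \o t) by apply/cvg_ex; exists (C s); exact: sC.
have [B [_ /(_ (B + 1))]] := cvg_seq_bounded cvt; rewrite ltrDl ltr01 => /(_ isT) HB.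
by exists (B + 1) => n; rewrite (le_trans (ler_norm _))//; exact: HB.
Qed.

End RowVectors.

(** * Real iterated integrals with a dominating weight *)

Section Iterated.
Variable R : realType.
Local Notation mu := (@lebesgue_measure R).

Definition rint (A : set R) (f : R -> R) : R := \int[mu]_(x in A) f x.

Fixpoint rcube (A : set R) (N : nat) : ('rV[R]_N -> R) -> R :=
  match N with
  | 0 => fun f => f 0
  | N'.+1 => fun f => rint A (fun x => rcube A (fun v : 'rV[R]_N' => f (rcons1 x v)))
  end.

Lemma integral_cubeE A N (f : 'rV[R]_N -> R[i]) : integral_cube A f =
  rcube A (fun v => complex.Re (f v)) +i* rcube A (fun v => complex.Im (f v)).
Proof.
elim: N f => [f|N IH f] /=; first by case: (f 0).
rewrite /cintegral /rint; congr (_ +i* _); apply: eq_Rintegral => x _; by rewrite IH.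
Qed.

(** A domain of integration together with an integrable continuous weight on it.
Domination by products of the weight is imposed everywhere, not only on the
domain, so that no side condition on the variables is needed. *)
Record admissible (A : set R) (w : R -> R) : Prop := Admissible {
  adm_meas : measurable A;
  adm_cont : continuous w;
  adm_ge0 : forall x, 0 <= w x;
  adm_int : mu.-integrable A (EFin \o w) }.

Definition dom1 (w : R -> R) (M : R) (f : R -> R) := forall x, `|f x| <= M * w x.
Definition wprod (w : R -> R) N (v : 'rV[R]_N) := \prod_i w (v 0 i).
Definition dom (w : R -> R) N (M : R) (f : 'rV[R]_N -> R) :=
  forall v, `|f v| <= M * wprod w v.

Section OneWeight.
Variables (A : set R) (w : R -> R).
Hypothesis adm : admissible A w.
Let mA := adm_meas adm.

Lemma rint_integrable M f : scont f -> dom1 w M f -> mu.-integrable A (EFin \o f).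
Proof.
move=> /scont_continuous cf df.
apply: (@le_integrable _ _ _ mu A mA _ (fun x => M%:E * (EFin \o w) x)%E).
- apply/measurable_EFinP; apply: (@measurable_funS _ _ _ _ setT) => //.
  exact: continuous_measurable_fun.
- by move=> x _ /=; rewrite lee_fin (le_trans (df x))// ler_norm.
- exact: integrableZl (adm_int adm).
Qed.

Lemma rintD M1 M2 f g : scont f -> scont g -> dom1 w M1 f -> dom1 w M2 g ->
  rint A (fun x => f x + g x) = rint A f + rint A g.
Proof. by move=> sf sg df dg; apply: RintegralD => //; exact: rint_integrable. Qed.

Lemma rintZ M c f : scont f -> dom1 w M f -> rint A (fun x => c * f x) = c * rint A f.
Proof. by move=> sf df; apply: RintegralZl => //; exact: rint_integrable. Qed.

Lemma rint_le M1 M2 f g : scont f -> scont g -> dom1 w M1 f -> dom1 w M2 g ->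
  (forall x, f x <= g x) -> rint A f <= rint A g.
Proof. by move=> sf sg df dg fg; apply: le_Rintegral => //; exact: rint_integrable. Qed.

Lemma scont_w : scont w. Proof. exact: continuous_scont (adm_cont adm). Qed.

Lemma dom1_w1 : dom1 w 1 w.
Proof. by move=> x; rewrite mul1r ger0_norm// (adm_ge0 adm). Qed.

Lemma rint_bound M f : scont f -> dom1 w M f -> `|rint A f| <= M * rint A w.
Proof.
move=> sf df; have dw : dom1 w `|M| (fun x => M * w x).
  by move=> x; rewrite normrM ler_wpM2l// ger0_norm ?(adm_ge0 adm).
have sw : scont (fun x => M * w x) by apply: scontM; [exact: scont_cst|exact: scont_w].
rewrite -(rintZ _ scont_w dom1_w1) ler_norml; apply/andP; split.
  rewrite -mulN1r -(rintZ _ sw dw).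
  apply: (rint_le _ sf _ df) => [||x].
  - by apply: scontM => //; exact: scont_cst.
  - by move=> x; rewrite mulN1r normrN; exact: dw.
  - by rewrite mulN1r; have := df x; rewrite ler_norml => /andP[].
by apply: (rint_le sf sw df dw) => x; have := df x; rewrite ler_norml => /andP[].
Qed.

Lemma rint_dct M (f_ : nat -> R -> R) f : (forall n, scont (f_ n)) -> scont f ->
  (forall n, dom1 w M (f_ n)) -> (forall x, f_ n x @[n --> \oo] --> f x) ->
  rint A (f_ n) @[n --> \oo] --> rint A f.
Proof.
move=> sf_ sf df_ ff.
have meas (g : R -> R) : scont g -> measurable_fun A (EFin \o g).
  move=> /scont_continuous cg; apply/measurable_EFinP.
  by apply: (@measurable_funS _ _ _ _ setT) => //; exact: continuous_measurable_fun.
have [] := @dominated_convergence _ _ _ mu A mA (fun n => EFin \o f_ n)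
  (EFin \o f) (fun x => M%:E * (EFin \o w) x)%E.
- by move=> n; exact: meas.
- exact: meas.
- by apply: aeW => x _ /=; apply: cvg_EFin; [exact: nearW|exact: ff].
- exact: integrableZl (adm_int adm).
- by apply: aeW => x n _; rewrite lee_fin; exact: df_.
move=> intf _ cv; apply: fine_cvg.
by rewrite /rint /Rintegral fineK//; exact: integrable_fin_num.
Qed.

Lemma wprod_rcons1 N x (v : 'rV[R]_N) : wprod w (rcons1 x v) = w x * wprod w v.
Proof.
rewrite /wprod big_ord_recl rcons1_0; congr (_ * _).
by apply: eq_bigr => i _; rewrite rcons1_S.
Qed.

Lemma wprod_ge0 N (v : 'rV[R]_N) : 0 <= wprod w v.
Proof. by apply: prodr_ge0 => i _; exact: (adm_ge0 adm). Qed.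

Lemma dom_rcons1 N M (f : 'rV[R]_N.+1 -> R) x : dom w M f ->
  dom w (M * w x) (fun v => f (rcons1 x v)).
Proof. by move=> df v; rewrite -mulrA -wprod_rcons1; exact: df. Qed.

Lemma scont_rcons1 N (f : 'rV[R]_N.+1 -> R) x : scont f -> scont (fun v => f (rcons1 x v)).
Proof. by move=> sf u v uv; apply: sf; apply: cvg_rcons1 => //; exact: cvg_cst. Qed.

(** Bound, dominated convergence and continuity of partial integrals are proved
together, because integrating out the first coordinate in dimension N + 1 needs
the continuity and the bound of the remaining N-fold integral. *)
Lemma rcube_main N :
  [/\ (forall M (f : 'rV[R]_N -> R), scont f -> dom w M f -> `|rcube A f| <= M * rint A w ^+ N),
  (forall M (f_ : nat -> 'rV[R]_N -> R) f, (forall n, scont (f_ n)) -> scont f ->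
    (forall n, dom w M (f_ n)) -> (forall v, f_ n v @[n --> \oo] --> f v) ->
    rcube A (f_ n) @[n --> \oo] --> rcube A f) &
  (forall M (f : 'rV[R]_N.+1 -> R), scont f -> dom w M f ->
     scont (fun x => rcube A (fun v => f (rcons1 x v))) /\
     dom1 w (M * rint A w ^+ N) (fun x => rcube A (fun v => f (rcons1 x v))))].
Proof.
elim: N => [|N [IHb IHd IHs]].
  have H3 M (f : 'rV[R]_1 -> R) : scont f -> dom w M f ->
     scont (fun x => rcube A (fun v => f (rcons1 x v))) /\
     dom1 w (M * rint A w ^+ 0) (fun x => rcube A (fun v => f (rcons1 x v))).
    move=> sf df; split=> [u v uv|x] /=.
      by apply: sf; apply: cvg_rcons1 => //; exact: cvg_cst.
    by rewrite mulr1 (le_trans (df _))// wprod_rcons1 /wprod big_ord0 mulr1.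
  split=> //.
  - by move=> M f sf df /=; rewrite mulr1 (le_trans (df _))// /wprod big_ord0 mulr1.
  - by move=> M f_ f sf_ sf df ff /=; exact: ff.
have Hb M (f : 'rV[R]_N.+1 -> R) : scont f -> dom w M f ->
    `|rcube A f| <= M * rint A w ^+ N.+1.
  move=> sf df /=; have [sF dF] := IHs _ _ sf df.
  by rewrite exprSr mulrA; exact: rint_bound.
have Hd M (f_ : nat -> 'rV[R]_N.+1 -> R) f : (forall n, scont (f_ n)) -> scont f ->
    (forall n, dom w M (f_ n)) -> (forall v, f_ n v @[n --> \oo] --> f v) ->
    rcube A (f_ n) @[n --> \oo] --> rcube A f.
  move=> sf_ sf df_ ff /=.
  have df : dom w M f.
    move=> v; have H : `|f_ n v| @[n --> \oo] --> `|f v| by exact: cvg_norm (ff v).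
    rewrite -(cvg_lim _ H)//; apply: limr_le; first by apply/cvg_ex; eexists; exact: H.
    by apply: nearW => n; exact: df_.
  apply: (@rint_dct (M * rint A w ^+ N)).
  - by move=> n; have [] := IHs _ _ (sf_ n) (df_ n).
  - by have [] := IHs _ _ sf df.
  - by move=> n; have [] := IHs _ _ (sf_ n) (df_ n).
  - move=> x; apply: (IHd (M * w x)).
    + by move=> n; exact: scont_rcons1.
    + exact: scont_rcons1.
    + by move=> n; exact: dom_rcons1.
    + by move=> v; exact: ff.
split=> // M f sf df; split=> [u x ux|x].
  have [B HB] := scont_seq_bounded (continuous_scont (adm_cont adm)) ux.
  apply: (Hd (`|M| * B)).
  - by move=> n; exact: scont_rcons1.
  - exact: scont_rcons1.
  - move=> n v; rewrite (le_trans (dom_rcons1 (u n) df v))//.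
    rewrite ler_wpM2r ?wprod_ge0// (@le_trans _ _ (`|M| * w (u n)))//.
      by rewrite ler_wpM2r ?(adm_ge0 adm)// ler_norm.
    by rewrite ler_wpM2l.
  - move=> v; apply: sf; apply: cvg_rcons1 => //; exact: cvg_cst.
rewrite (le_trans (Hb _ _ (scont_rcons1 sf) (dom_rcons1 x df)))//.
by rewrite mulrAC.
Qed.

End OneWeight.
End Iterated.

Section Fubini.
Variable R : realType.
Local Notation mu := (@lebesgue_measure R).

(** A jointly continuous function is a limit of functions which are constant in
x on the intervals [z/n, (z+1)/n), hence countable unions of rectangles control
its measurability for the product sigma-algebra. *)
Lemma measurable_joint (f : R * R -> R) : scont f -> measurable_fun setT f.
Proof.
move=> sf.
pose h n (x : R) : R := (Num.floor (x * n.+1%:R))%:~R / n.+1%:R.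
have hcv x : h n x @[n --> \oo] --> x.
  apply/cvgrPdist_le => e e0.
  have := (@cvg_harmonic R); rewrite /harmonic => /cvgrPdist_le /(_ e e0); apply: filterS => n.
  rewrite sub0r normrN ger0_norm ?invr_ge0// => ne; apply: le_trans ne.
  have /andP[l1 l2] := floor_itv (x * n.+1%:R).
  have n0 : 0 < n.+1%:R :> R by [].
  have -> : x - h n x = (x * n.+1%:R - (Num.floor (x * n.+1%:R))%:~R) / n.+1%:R.
    by rewrite /h mulrBl mulfK ?gt_eqF.
  rewrite normrM [X in _ * X]ger0_norm ?invr_ge0// ler_piMl ?invr_ge0//.
  rewrite ger0_norm ?subr_ge0// lerBlDr.
  by apply: ltW; rewrite intrD addrC in l2.
apply: (@measurable_fun_cvg _ _ _ setT (fun n p => f (h n p.1, p.2))).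
  move=> n _ Y mY; rewrite setTI.
  rewrite [X in measurable X](_ : _ =
     \bigcup_(z : int) ([set x : R | Num.floor (x * n.+1%:R) = z] `*`
        [set y : R | Y (f (z%:~R / n.+1%:R, y))])); last first.
    apply/seteqP; split=> [[x y] /= Yf|[x y] [z _] [/= <-]] //.
    by exists (Num.floor (x * n.+1%:R)).
  apply: countable_bigcupT_measurable; first exact: countableP.
  move=> z; apply: measurableX.
    have -> : [set x : R | Num.floor (x * n.+1%:R) = z] =
        [set x | x \in `[z%:~R / n.+1%:R, (z + 1)%:~R / n.+1%:R[].
      apply/seteqP; split=> x /=; rewrite in_itv/= ler_pdivrMr// ltr_pdivlMr// -floor_eq.
        by move=> ->.
      by move/eqP.
    have := @measurable_itv R (Interval (BLeft (z%:~R / n.+1%:R)) (BLeft ((z + 1)%:~R / n.+1%:R))); exact.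
  rewrite -[X in measurable X]setTI. 
  suff H : measurable_fun setT (fun y : R => f (z%:~R / n.+1%:R, y)) by exact: (H measurableT Y mY).
  apply: continuous_measurable_fun; apply: scont_continuous => u v uv.
  apply: (sf (fun k => (z%:~R / n.+1%:R, u k)) (z%:~R / n.+1%:R, v)).
  by apply: cvg_seq_pair => //; exact: cvg_cst.
move=> [x y] _ /=; apply: (sf (fun k => (h k x, y)) (x, y)); apply: cvg_seq_pair => /=; [exact: hcv|exact: cvg_cst].
Qed.

(** The product of the weights dominates, so the integrand extended by zero is
integrable for the product measure. *)
Lemma rint_fubini (A B : set R) w w' (f : R -> R -> R) M :
  admissible A w -> admissible B w' ->
  scont (fun p : R * R => f p.1 p.2) ->
  (forall x y, `|f x y| <= M * w x * w' y) ->
  rint A (fun x => rint B (fun y => f x y)) = rint B (fun y => rint A (fun x => f x y)).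
Proof.
move=> aA aB sf df.
have [mA mB] := (adm_meas aA, adm_meas aB).
pose g (p : R * R) : R := f p.1 p.2 * (\1_A p.1 * \1_B p.2).
have mg : measurable_fun setT g.
  apply: measurable_funM; first exact: measurable_joint.
  apply: measurable_funM.
    have -> : (fun p : R * R => \1_A p.1) = (\1_A : R -> R) \o fst by [].
    by apply: measurableT_comp; [exact: measurable_indic|exact: measurable_fst].
  have -> : (fun p : R * R => \1_B p.2) = (\1_B : R -> R) \o snd by [].
  by apply: measurableT_comp; [exact: measurable_indic|exact: measurable_snd].
have ie (C : set R) (v : R -> R) (c : R) : measurable C -> mu.-integrable C (EFin \o v) ->
   (\int[mu]_y (c * v y * \1_C y)%:E = c%:E * \int[mu]_(y in C) (v y)%:E)%E.
  move=> mC iv; rewrite -integralZl// [RHS]integral_mkcond.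
  apply: eq_integral => y _; rewrite /patch indicE.
  by case: (y \in C); rewrite ?mulr1 ?mulr0// EFinM.
have pos (C : set R) y : 0 <= (\1_C y : R) by rewrite indicE.
have le1 x y : (`|(EFin \o g) (x, y)| <=
    ((`|M| * w x * \1_A x) * w' y * \1_B y)%:E)%E.
  rewrite /g /= lee_fin !normrM !(ger0_norm (pos _ _)) mulrA -(mulrAC _ (w' y)).
  rewrite ler_wpM2r// ler_wpM2r// (le_trans (df x y))//.
  by rewrite ler_wpM2r ?(adm_ge0 aB)// ler_wpM2r ?(adm_ge0 aA)// ler_norm.
have mBw : measurable_fun setT (fun y : R => w' y * \1_B y).
  apply: measurable_funM; last exact: measurable_indic.
  by apply: continuous_measurable_fun; exact: adm_cont aB.
have mAw : measurable_fun setT (fun y : R => w y * \1_A y).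
  apply: measurable_funM; last exact: measurable_indic.
  by apply: continuous_measurable_fun; exact: adm_cont aA.
have ig : (mu \x mu)%E.-integrable setT (EFin \o g).
  apply/integrable12ltyP; first exact/measurable_EFinP.
  have mabs : measurable_fun setT (fun p => `|(EFin \o g) p|%E).
    by apply: measurableT_comp => //; exact/measurable_EFinP.
  apply: (@le_lt_trans _ _ (\int[mu]_x \int[mu]_y ((`|M| * w x * \1_A x) * w' y * \1_B y)%:E)%E).
    apply: ge0_le_integral => //.
    - by move=> x _; exact: integral_ge0.
    - by have := @measurable_fun_fubini_tonelli_F _ _ _ _ _ mu (fun p => `|(EFin \o g) p|%E); apply.
    - under eq_fun do rewrite (ie _ _ _ mB (adm_int aB)).
      have -> : (fun x => (`|M| * w x * \1_A x)%:E * \int[mu]_(y in B) (w' y)%:E)%E =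
        (fun x => \int[mu]_(y in B) (w' y)%:E * (`|M| * (w x * \1_A x))%:E)%E.
        by apply/funext => x; rewrite muleC mulrA.
      apply: emeasurable_funM; first exact: measurable_cst.
      by apply/measurable_EFinP; apply: measurable_funM => //; exact: measurable_cst.
    - move=> x _; apply: ge0_le_integral => //.
      + by apply: measurableT_comp => //; apply/measurable_EFinP; exact: measurable_fun_pair2 mg.
      + apply/measurable_EFinP; under eq_fun do rewrite -mulrA.
        by apply: measurable_funM => //; exact: measurable_cst.
  under eq_integral do rewrite (ie _ _ _ mB (adm_int aB)).
  have fB : (\int[mu]_(y in B) (w' y)%:E)%E \is a fin_num.
    by apply: integrable_fin_num => //; exact: adm_int aB.
  have fA : (\int[mu]_(y in A) (w y)%:E)%E \is a fin_num.
    by apply: integrable_fin_num => //; exact: adm_int aA.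
  rewrite -(fineK fB); set I := fine _.
  have -> : (\int[mu]_x ((`|M| * w x * \1_A x)%:E * I%:E) =
             \int[mu]_x ((I * `|M|) * w x * \1_A x)%:E)%E.
    by apply: eq_integral => x _; rewrite -EFinM; congr _%:E; ring.
  rewrite (ie _ _ _ mA (adm_int aA)).
  by rewrite -(fineK fA) -EFinM ltry.
have := Fubini ig.
have sx x : scont (f x).
  by move=> u v uv; apply: (sf (fun n => (x, u n)) (x, v)); apply: cvg_seq_pair => //; exact: cvg_cst.
have sy y : scont (f ^~ y).
  by move=> u v uv; apply: (sf (fun n => (u n, y)) (v, y)); apply: cvg_seq_pair => //; exact: cvg_cst.
have inB x : (\int[mu]_y (EFin \o g) (x, y))%E = (\1_A x * rint B (f x))%:E.
  have dx : dom1 w' (M * w x) (f x) by move=> y; exact: df.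
  have iB := rint_integrable aB (sx x) dx.
  rewrite EFinM /rint /Rintegral fineK; last exact: integrable_fin_num iB.
  rewrite -(ie _ _ _ mB iB); apply: eq_integral => y _; rewrite /g /=; congr _%:E; ring.
have inA y : (\int[mu]_x (EFin \o g) (x, y))%E = (\1_B y * rint A (f ^~ y))%:E.
  have dy : dom1 w (M * w' y) (f ^~ y) by move=> x; rewrite mulrAC; exact: df.
  have iA := rint_integrable aA (sy y) dy.
  rewrite EFinM /rint /Rintegral fineK; last exact: integrable_fin_num iA.
  rewrite -(ie _ _ _ mA iA); apply: eq_integral => x _; rewrite /g /=; congr _%:E; ring.
under eq_integral do rewrite inB.
under [in RHS]eq_integral do rewrite inA.
move=> /(congr1 fine) H.
rewrite {1}/rint [LHS]Rintegral_mkcond {2}/rint [RHS]Rintegral_mkcond.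
rewrite /Rintegral; move: H; congr (_ = _); congr fine; apply: eq_integral => x _;
  by rewrite /patch indicE; case: (_ \in _); rewrite ?mul1r ?mul0r.
Qed.

End Fubini.

(** * Complex numbers with a real-valued modulus *)

Section ComplexModulus.
Variable R : realType.
Implicit Types z t : R[i].
Local Notation Re := complex.Re.
Local Notation Im := complex.Im.

(** The modulus as a real number; the norm of a complex number is itself
complex. *)
Definition cn z : R := Re `|z|.
Lemma cnE z : `|z| = (cn z)%:C.
Proof. by rewrite /cn normc_def. Qed.
Lemma cn_le z M : (cn z <= M) = (`|z| <= M%:C).
Proof. by rewrite cnE lecR. Qed.
Lemma cn_ge0 z : 0 <= cn z.
Proof. by rewrite -ler0c -cnE. Qed.
Lemma cnD z t : cn (z + t) <= cn z + cn t.
Proof. by rewrite -lecR rmorphD /= -!cnE ler_normD. Qed.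
Lemma cnM z t : cn (z * t) = cn z * cn t.
Proof. by apply: (@complexI R); rewrite rmorphM /= -!cnE normrM. Qed.
Lemma cnN z : cn (- z) = cn z.
Proof. by rewrite /cn normrN. Qed.
Lemma cnC z t : cn (z - t) = cn (t - z).
Proof. by rewrite -cnN opprB. Qed.
Lemma cn0 : cn 0 = 0. Proof. by rewrite /cn normr0. Qed.
Lemma cn1 : cn 1 = 1. Proof. by rewrite /cn normr1. Qed.
Lemma cn_eq0 z : cn z = 0 -> z = 0.
Proof. by move=> h; apply/eqP; rewrite -normr_eq0 cnE h. Qed.
Lemma conjE (z : R[i]) : Num.conj z = conjc z. Proof. by []. Qed.
Lemma cn_conj z : cn (conjc z) = cn z.
Proof. by rewrite /cn normcJ. Qed.
Lemma cn_real (x : R) : cn x%:C = `|x|.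
Proof. by rewrite /cn normc_def /= expr0n /= addr0 sqrtr_sqr. Qed.
Lemma cn_Re z : `|Re z| <= cn z.
Proof. by rewrite /cn normc_def /= -sqrtr_sqr ler_wsqrtr// lerDl sqr_ge0. Qed.
Lemma cn_Im z : `|Im z| <= cn z.
Proof. by rewrite /cn normc_def /= -sqrtr_sqr ler_wsqrtr// lerDr sqr_ge0. Qed.
Lemma cn_ReIm z : cn z <= `|Re z| + `|Im z|.
Proof.
have {1}-> : z = (Re z)%:C + (0 +i* 1) * (Im z)%:C by case: z => a b; simpc.
rewrite (le_trans (cnD _ _))// cnM !cn_real.
have -> : cn (0 +i* 1) = 1 by rewrite /cn normc_def /= expr0n /= add0r expr1n sqrtr1.
by rewrite mul1r.
Qed.
Lemma cn_sum (I : Type) (r : seq I) (F : I -> R[i]) :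
  cn (\sum_(i <- r) F i) <= \sum_(i <- r) cn (F i).
Proof.
elim: r => [|i r IH]; first by rewrite !big_nil cn0.
by rewrite !big_cons (le_trans (cnD _ _))// lerD2l.
Qed.
Lemma cReD z t : Re (z + t) = Re z + Re t. Proof. by case: z t => ? ? []. Qed.
Lemma cImD z t : Im (z + t) = Im z + Im t. Proof. by case: z t => ? ? []. Qed.
Lemma cReN z : Re (- z) = - Re z. Proof. by case: z. Qed.
Lemma cImN z : Im (- z) = - Im z. Proof. by case: z. Qed.
Lemma cReM z t : Re (z * t) = Re z * Re t - Im z * Im t. Proof. by case: z t => ? ? []. Qed.
Lemma cImM z t : Im (z * t) = Re z * Im t + Im z * Re t. Proof. by case: z t => ? ? []. Qed.
Lemma cReC z : Re (conjc z) = Re z. Proof. by case: z. Qed.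
Lemma cImC z : Im (conjc z) = - Im z. Proof. by case: z. Qed.
Lemma ReImP z t : Re z = Re t -> Im z = Im t -> z = t.
Proof. by case: z t => ? ? [? ?] /= -> ->. Qed.

Definition cscont (T : topologicalType) (f : T -> R[i]) :=
  scont (fun x => Re (f x)) /\ scont (fun x => Im (f x)).

Section Closure.
Variable T : topologicalType.
Implicit Types f g : T -> R[i].
Lemma cscont_ext f g : f =1 g -> cscont f -> cscont g.
Proof. by move=> /funext ->. Qed.
Lemma cscontD f g : cscont f -> cscont g -> cscont (fun x => f x + g x).
Proof.
move=> [a b] [c d]; split.
  by apply: scont_ext (scontD a c) => x; rewrite cReD.
by apply: scont_ext (scontD b d) => x; rewrite cImD.
Qed.
Lemma cscontN f : cscont f -> cscont (fun x => - f x).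
Proof.
move=> [a b]; split.
  by apply: scont_ext (scontN a) => x; rewrite cReN.
by apply: scont_ext (scontN b) => x; rewrite cImN.
Qed.
Lemma cscontB f g : cscont f -> cscont g -> cscont (fun x => f x - g x).
Proof. by move=> cf cg; apply: cscontD => //; exact: cscontN. Qed.
Lemma cscontM f g : cscont f -> cscont g -> cscont (fun x => f x * g x).
Proof.
move=> [a b] [c d]; split.
  by apply: scont_ext (scontB (scontM a c) (scontM b d)) => x; rewrite cReM.
by apply: scont_ext (scontD (scontM a d) (scontM b c)) => x; rewrite cImM.
Qed.
Lemma cscont_conj f : cscont f -> cscont (fun x => conjc (f x)).
Proof.
move=> [a b]; split; first by apply: scont_ext a => x; rewrite cReC.
by apply: scont_ext (scontN b) => x; rewrite cImC.
Qed.
Lemma cscont_cst c : cscont (fun _ : T => c).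
Proof. by split; exact: scont_cst. Qed.
Lemma cscont_real (f : T -> R) : scont f -> cscont (fun x => (f x)%:C).
Proof. by move=> sf; split => //=; exact: scont_cst. Qed.
Lemma cscont_sum (I : Type) (r : seq I) (F : I -> T -> R[i]) :
  (forall i, cscont (F i)) -> cscont (fun x => \sum_(i <- r) F i x).
Proof.
move=> sF; elim: r => [|i r IH].
  by apply: cscont_ext (cscont_cst 0) => x; rewrite big_nil.
by apply: cscont_ext (cscontD (sF i) IH) => x; rewrite big_cons.
Qed.
Lemma cscont_expi (f : T -> R) : scont f -> cscont (fun x => expi (f x)).
Proof.
move=> sf; split.
  exact: (scont_compl (continuous_scont (@continuous_cos R)) sf).
exact: (scont_compl (continuous_scont (@continuous_sin R)) sf).
Qed.
End Closure.

Lemma cn_expi (x : R) : cn (expi x) = 1.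
Proof. by rewrite /cn normc_def /= cos2Dsin2 sqrtr1. Qed.
Lemma expiD (x y : R) : expi (x + y) = expi x * expi y.
Proof. by rewrite /expi cosD sinD; simpc; congr (_ +i* _); rewrite addrC. Qed.
Lemma expi0 : expi 0 = 1 :> R[i].
Proof. by rewrite /expi cos0 sin0. Qed.
Lemma expiN (x : R) : expi (- x) = conjc (expi x).
Proof. by rewrite /expi cosN sinN. Qed.
Lemma expi_neq0 (x : R) : expi x != 0.
Proof. by apply/eqP => /(congr1 cn); rewrite cn_expi cn0 => /eqP; rewrite oner_eq0. Qed.
Lemma expi_conjM (x : R) : expi x * conjc (expi x) = 1.
Proof. by rewrite -expiN -expiD subrr expi0. Qed.
Lemma expi_sum (I : Type) (r : seq I) (F : I -> R) :
  expi (\sum_(i <- r) F i) = \prod_(i <- r) expi (F i).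
Proof.
elim: r => [|i r IH]; first by rewrite !big_nil expi0.
by rewrite !big_cons expiD IH.
Qed.
Lemma expiMn (x : R) n : expi (n%:R * x) = expi x ^+ n.
Proof.
elim: n => [|n IH]; first by rewrite mul0r expi0.
by rewrite exprS -IH -expiD; congr expi; rewrite mulrSr; ring.
Qed.
Lemma expi2pi : expi (2 * pi) = 1 :> R[i].
Proof. by rewrite /expi mulr_natl cos2pi sin2pi. Qed.
Lemma expi2piz (z : int) : expi (2 * pi * z%:~R) = 1 :> R[i].
Proof.
have H (n : nat) : expi (2 * pi * n%:R) = 1 :> R[i].
  by rewrite mulrC expiMn expi2pi expr1n.
case: z => n; first by rewrite -pmulrn H.
by rewrite NegzE mulrNz -pmulrn mulrN expiN H conjc1.
Qed.
End ComplexModulus.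

(** * Linearity and Fubini for real iterated integrals *)

Section IteratedTheory.
Variable R : realType.

Section Params.
Variables (A : set R) (w : R -> R).
Hypothesis adm : admissible A w.

Definition ok N (f : 'rV[R]_N -> R) := scont f /\ exists M, dom w M f.

Lemma rcube_bound N M (f : 'rV[R]_N -> R) : scont f -> dom w M f ->
  `|rcube A f| <= M * rint A w ^+ N.
Proof. by have [H _ _] := rcube_main adm N; exact: H. Qed.

Lemma rcube_dct N M (f_ : nat -> 'rV[R]_N -> R) f : (forall n, scont (f_ n)) -> scont f ->
  (forall n, dom w M (f_ n)) -> (forall v, f_ n v @[n --> \oo] --> f v) ->
  rcube A (f_ n) @[n --> \oo] --> rcube A f.
Proof. by have [_ H _] := rcube_main adm N; exact: H. Qed.

Lemma scont_slice (T : topologicalType) N (F : T * 'rV[R]_N -> R) t :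
  scont F -> scont (fun v => F (t, v)).
Proof.
move=> sF u v uv; apply: (sF (fun n => (t, u n)) (t, v)).
by apply: cvg_seq_pair => //; exact: cvg_cst.
Qed.

(** Dominated convergence, the dominating constant C t being allowed to vary
with the parameter: along a convergent sequence of parameters it is bounded. *)
Lemma scont_rcube (T : topologicalType) N (C : T -> R) (F : T -> 'rV[R]_N -> R) :
  scont (fun p : T * 'rV[R]_N => F p.1 p.2) -> scont C -> (forall t, dom w (C t) (F t)) ->
  scont (fun t => rcube A (F t)).
Proof.
move=> sF sC dF u t ut; have [B HB] := scont_seq_bounded sC ut.
apply: (@rcube_dct _ B) => //.
- by move=> n; exact: (@scont_slice _ _ (fun p => F p.1 p.2) (u n) sF).
- exact: (@scont_slice _ _ (fun p => F p.1 p.2) t sF).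
- by move=> n v; rewrite (le_trans (dF _ _))// ler_wpM2r ?(wprod_ge0 adm).
- move=> v; apply: (sF (fun n => (u n, v)) (t, v)).
  by apply: cvg_seq_pair => //; exact: cvg_cst.
Qed.

Lemma okZ N c (f : 'rV[R]_N -> R) : ok f -> ok (fun v => c * f v).
Proof.
move=> [sf [M df]]; split; first by apply: scontM => //; exact: scont_cst.
by exists (`|c| * M) => v; rewrite normrM -mulrA ler_wpM2l.
Qed.

Lemma ok_rcons1 N (f : 'rV[R]_N.+1 -> R) x : ok f -> ok (fun v => f (rcons1 x v)).
Proof.
move=> [sf [M df]]; split; first exact: scont_rcons1.
by exists (M * w x) => v; exact: dom_rcons1.
Qed.

Lemma ok_slice N (f : 'rV[R]_N.+1 -> R) : ok f ->
  scont (fun x => rcube A (fun v => f (rcons1 x v))) /\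
  exists M, dom1 w M (fun x => rcube A (fun v => f (rcons1 x v))).
Proof.
move=> [sf [M df]]; have [_ _ H] := rcube_main adm N.
by have [s d] := H _ _ sf df; split=> //; exists (M * rint A w ^+ N).
Qed.

Lemma rcubeD N (f g : 'rV[R]_N -> R) : ok f -> ok g ->
  rcube A (fun v => f v + g v) = rcube A f + rcube A g.
Proof.
elim: N f g => [//|N IH] f g okf okg /=.
have [sf [M df]] := ok_slice okf; have [sg [M' dg]] := ok_slice okg.
rewrite -(rintD adm sf sg df dg); congr rint; apply/funext => x.
by rewrite IH//; exact: ok_rcons1.
Qed.

Lemma rcubeZ N c (f : 'rV[R]_N -> R) : ok f -> rcube A (fun v => c * f v) = c * rcube A f.
Proof.
elim: N f => [//|N IH] f okf /=.
have [sf [M df]] := ok_slice okf.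
rewrite -(rintZ adm c sf df); congr rint; apply/funext => x.
by rewrite IH//; exact: ok_rcons1.
Qed.

Lemma rcube_ge0 N (f : 'rV[R]_N -> R) : (forall v, 0 <= f v) -> 0 <= rcube A f.
Proof.
elim: N f => [|N IH] f f0 /=; first exact: f0.
by rewrite /rint; apply: Rintegral_ge0 => x _; apply: IH => v.
Qed.

End Params.

Section Fubini.
Variables (A B : set R) (w w' : R -> R).
Hypotheses (aA : admissible A w) (aB : admissible B w').

(** Induction on the number of inner variables: each step exchanges the outer
variable with one inner variable. *)
Lemma rcube_fubini1 N M (F : R -> 'rV[R]_N -> R) :
  scont (fun p : R * 'rV[R]_N => F p.1 p.2) ->
  (forall x v, `|F x v| <= M * w x * wprod w' v) ->
  rint A (fun x => rcube B (F x)) = rcube B (fun v => rint A (fun x => F x v)).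
Proof.
elim: N M F => [//|N IH] M F sF dF /=.
have sFx (u : nat -> (R * R) * 'rV[R]_N) p : u n @[n --> \oo] --> p ->
    F (u n).1.1 (rcons1 (u n).1.2 (u n).2) @[n --> \oo] --> F p.1.1 (rcons1 p.1.2 p.2).
  move=> up; apply: (sF (fun n => ((u n).1.1, rcons1 (u n).1.2 (u n).2))
     (p.1.1, rcons1 p.1.2 p.2)).
  have u1 := cvg_seq_fst up; have u2 := cvg_seq_snd up.
  have u11 := cvg_seq_fst u1; have u12 := cvg_seq_snd u1.
  by apply: cvg_seq_pair => //; apply: cvg_rcons1.
pose G x y := rcube B (fun v => F x (rcons1 y v)).
have sG : scont (fun p : R * R => G p.1 p.2).
  apply: (scont_rcube aB (C := fun p => M * w p.1 * w' p.2)
    (F := fun (p : R * R) v => F p.1 (rcons1 p.2 v))).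
  - by move=> u p; exact: sFx.
  - apply: scontM; last exact: (scont_comp (scont_w aB) (fun p => @cvg_snd _ _ _ _ _)).
    apply: scontM; first exact: scont_cst.
    exact: (scont_comp (scont_w aA) (fun p => @cvg_fst _ _ _ _ _)).
  - by move=> p v; rewrite (le_trans (dF _ _))// wprod_rcons1 mulrA.
have -> : rint A (fun x => rint B (fun y => G x y)) = rint B (fun y => rint A (fun x => G x y)).
  apply: (rint_fubini aA aB sG (M := M * rint B w' ^+ N)) => x y.
  rewrite [leRHS](_ : _ = (M * w x * w' y) * rint B w' ^+ N); last by ring.
  apply: (rcube_bound aB).
    move=> a b ab; apply: (sFx (fun k => ((x, y), a k)) ((x, y), b)).
    by apply: cvg_seq_pair => //; exact: cvg_cst.
  by move=> v; rewrite (le_trans (dF _ _))// wprod_rcons1 mulrA.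
congr rint; apply/funext => y; apply: (IH (M * w' y)) => [u p up|x v].
  apply: (sFx (fun n => (((u n).1, y), (u n).2)) ((p.1, y), p.2)).
  have u1 := cvg_seq_fst up; have u2 := cvg_seq_snd up.
  by apply: cvg_seq_pair => //; apply: cvg_seq_pair => //; exact: cvg_cst.
by rewrite (le_trans (dF _ _))// wprod_rcons1 mulrA (mulrAC M).
Qed.

Lemma rcube_fubini K N M (F : 'rV[R]_K -> 'rV[R]_N -> R) :
  scont (fun p : 'rV[R]_K * 'rV[R]_N => F p.1 p.2) ->
  (forall x v, `|F x v| <= M * wprod w x * wprod w' v) ->
  rcube A (fun x => rcube B (F x)) = rcube B (fun v => rcube A (fun x => F x v)).
Proof.
elim: K M F => [//|K IH] M F sF dF /=.
pose G x v := rcube A (fun u => F (rcons1 x u) v).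
have sFx (u : nat -> (R * 'rV[R]_N) * 'rV[R]_K) (p : (R * 'rV[R]_N) * 'rV[R]_K) :
    u n @[n --> \oo] --> p ->
    F (rcons1 (u n).1.1 (u n).2) (u n).1.2 @[n --> \oo] --> F (rcons1 p.1.1 p.2) p.1.2.
  move=> up; apply: (sF (fun n => (rcons1 (u n).1.1 (u n).2, (u n).1.2))
     (rcons1 p.1.1 p.2, p.1.2)).
  have u1 := cvg_seq_fst up; have u2 := cvg_seq_snd up.
  have u11 := cvg_seq_fst u1; have u12 := cvg_seq_snd u1.
  by apply: cvg_seq_pair => //; apply: cvg_rcons1.
have dG x v : dom w (M * w x * wprod w' v) (fun u => F (rcons1 x u) v).
  by move=> u; rewrite (le_trans (dF _ _))// wprod_rcons1 mulrA mulrAC.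
transitivity (rint A (fun x => rcube B (G x))).
  congr rint; apply/funext => x; apply: (IH (M * w x)) => [u p up|u v].
    apply: (sFx (fun n => ((x, (u n).2), (u n).1)) ((x, p.2), p.1)).
    have u1 := cvg_seq_fst up; have u2 := cvg_seq_snd up.
    by apply: cvg_seq_pair => //; apply: cvg_seq_pair => //; exact: cvg_cst.
  by rewrite (le_trans (dF _ _))// wprod_rcons1 mulrA.
apply: (rcube_fubini1 (M := M * rint A w ^+ K)).
  apply: (scont_rcube aA (C := fun p : R * 'rV[R]_N => M * w p.1 * wprod w' p.2)
    (F := fun (p : R * 'rV[R]_N) u => F (rcons1 p.1 u) p.2)).
  - by move=> u p; exact: sFx.
  - apply: scontM; first apply: scontM; first exact: scont_cst.
      exact: (scont_comp (scont_w aA) (fun p => @cvg_fst _ _ _ _ _)).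
    apply: scont_prod => i; apply: (scont_compl (scont_w aB)) => u p up.
    by have /cvg_rowP := cvg_seq_snd up; exact.
  - by move=> p; exact: dG.
move=> x v; rewrite [leRHS](_ : _ = (M * w x * wprod w' v) * rint A w ^+ K); last by ring.
apply: (rcube_bound aA) => // u a ua.
apply: (sFx (fun n => ((x, v), u n)) ((x, v), a)).
by apply: cvg_seq_pair => //; exact: cvg_cst.
Qed.

End Fubini.

End IteratedTheory.

(** * Complex iterated integrals *)

Section ComplexIntegrals.
Variable R : realType.
Local Notation Re := complex.Re.
Local Notation Im := complex.Im.
Local Notation mu := (@lebesgue_measure R).

Definition cdom (w : R -> R) N (M : R) (f : 'rV[R]_N -> R[i]) :=
  forall v, cn (f v) <= M * wprod w v.
Definition cok (w : R -> R) N (f : 'rV[R]_N -> R[i]) := cscont f /\ exists M, cdom w M f.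

Lemma cdom_Re w N M (f : 'rV[R]_N -> R[i]) : cdom w M f -> dom w M (fun v => Re (f v)).
Proof. by move=> df v; exact: le_trans (cn_Re _) (df v). Qed.
Lemma cdom_Im w N M (f : 'rV[R]_N -> R[i]) : cdom w M f -> dom w M (fun v => Im (f v)).
Proof. by move=> df v; exact: le_trans (cn_Im _) (df v). Qed.
Lemma cok_Re w N (f : 'rV[R]_N -> R[i]) : cok w f -> ok w (fun v => Re (f v)).
Proof. by move=> [[s _] [M d]]; split=> //; exists M; exact: cdom_Re. Qed.
Lemma cok_Im w N (f : 'rV[R]_N -> R[i]) : cok w f -> ok w (fun v => Im (f v)).
Proof. by move=> [[_ s] [M d]]; split=> //; exists M; exact: cdom_Im. Qed.

Section OneWeight.
Variables (A : set R) (w : R -> R).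
Hypothesis adm : admissible A w.

Lemma cokD N (f g : 'rV[R]_N -> R[i]) : cok w f -> cok w g -> cok w (fun v => f v + g v).
Proof.
move=> [sf [M df]] [sg [M' dg]]; split; first exact: cscontD.
by exists (M + M') => v; rewrite (le_trans (cnD _ _))// mulrDl lerD.
Qed.
Lemma cokM N (B : R) (h f : 'rV[R]_N -> R[i]) : cscont h -> (forall v, cn (h v) <= B) ->
  cok w f -> cok w (fun v => h v * f v).
Proof.
move=> sh dh [sf [M df]]; split; first exact: cscontM.
by exists (B * M) => v; rewrite cnM -mulrA ler_pM ?cn_ge0.
Qed.
Lemma cokZ N c (f : 'rV[R]_N -> R[i]) : cok w f -> cok w (fun v => c * f v).
Proof. by apply: (cokM (B := cn c)) => //; exact: cscont_cst. Qed.
Lemma cok_conj N (f : 'rV[R]_N -> R[i]) : cok w f -> cok w (fun v => conjc (f v)).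
Proof.
move=> [sf [M df]]; split; first exact: cscont_conj.
by exists M => v; rewrite cn_conj.
Qed.
Lemma cok_ext N (f g : 'rV[R]_N -> R[i]) : f =1 g -> cok w f -> cok w g.
Proof. by move=> /funext ->. Qed.
Lemma cok0 N : cok w (fun _ : 'rV[R]_N => 0).
Proof. by split; [exact: cscont_cst|exists 0 => v; rewrite cn0 mul0r]. Qed.
Lemma cok_sum N (I : Type) (r : seq I) (F : I -> 'rV[R]_N -> R[i]) :
  (forall i, cok w (F i)) -> cok w (fun v => \sum_(i <- r) F i v).
Proof.
move=> okF; elim: r => [|i r IH].
  by apply: cok_ext (@cok0 N) => v; rewrite big_nil.
by apply: cok_ext (cokD (okF i) IH) => v; rewrite big_cons.
Qed.

Lemma ciD N (f g : 'rV[R]_N -> R[i]) : cok w f -> cok w g ->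
  integral_cube A (fun v => f v + g v) = integral_cube A f + integral_cube A g.
Proof.
move=> okf okg; rewrite !integral_cubeE; simpc; congr (_ +i* _).
  rewrite -(rcubeD adm (cok_Re okf) (cok_Re okg)); congr rcube.
  by apply/funext => v; rewrite cReD.
rewrite -(rcubeD adm (cok_Im okf) (cok_Im okg)); congr rcube.
by apply/funext => v; rewrite cImD.
Qed.

Lemma ciZ N c (f : 'rV[R]_N -> R[i]) : cok w f ->
  integral_cube A (fun v => c * f v) = c * integral_cube A f.
Proof.
move=> okf; have [okr oki] := (cok_Re okf, cok_Im okf).
rewrite !integral_cubeE; case: c => a b; simpc; congr (_ +i* _).
  rewrite -mulNr -!(rcubeZ adm) // -(rcubeD adm); [|exact: okZ|exact: okZ].
  by congr rcube; apply/funext => v; rewrite cReM /= mulNr.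
rewrite -!(rcubeZ adm) // -(rcubeD adm); [|exact: okZ|exact: okZ].
by congr rcube; apply/funext => v; rewrite cImM.
Qed.

Lemma ciB N (f g : 'rV[R]_N -> R[i]) : cok w f -> cok w g ->
  integral_cube A (fun v => f v - g v) = integral_cube A f - integral_cube A g.
Proof.
move=> okf okg; rewrite -mulN1r -ciZ// -ciD//; last exact: cokZ.
by congr integral_cube; apply/funext => v; rewrite mulN1r.
Qed.

Lemma ci0 N : integral_cube A (fun _ : 'rV[R]_N => 0) = 0 :> R[i].
Proof.
rewrite -[RHS](mul0r (integral_cube A (fun _ : 'rV[R]_N => 0))) -(ciZ _ (cok0 N)).
by congr integral_cube; apply/funext => v; rewrite mul0r.
Qed.

Lemma ci_sum N (I : Type) (r : seq I) (F : I -> 'rV[R]_N -> R[i]) :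
  (forall i, cok w (F i)) ->
  integral_cube A (fun v => \sum_(i <- r) F i v) = \sum_(i <- r) integral_cube A (F i).
Proof.
move=> okF; elim: r => [|i r IH].
  by rewrite big_nil -[RHS](ci0 N); congr integral_cube; apply/funext => v; rewrite big_nil.
rewrite big_cons -IH -ciD//; last exact: cok_sum.
by congr integral_cube; apply/funext => v; rewrite big_cons.
Qed.

Lemma ci_conj N (f : 'rV[R]_N -> R[i]) : cok w f ->
  integral_cube A (fun v => conjc (f v)) = conjc (integral_cube A f).
Proof.
move=> okf; rewrite !integral_cubeE; simpc; congr (_ +i* _).
  by congr rcube; apply/funext => v; rewrite cReC.
rewrite -mulN1r -(rcubeZ adm); last exact: cok_Im.
by congr rcube; apply/funext => v; rewrite cImC mulN1r.
Qed.

Lemma ci_bound N M (f : 'rV[R]_N -> R[i]) : cscont f -> cdom w M f ->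
  cn (integral_cube A f) <= 2 * (M * rint A w ^+ N).
Proof.
move=> [sr si] df; rewrite (le_trans (cn_ReIm _))// integral_cubeE /= mulrDl !mul1r.
by rewrite lerD// (rcube_bound adm)//; [exact: cdom_Re|exact: cdom_Im].
Qed.

Lemma cscont_ci (T : topologicalType) N (C : T -> R) (F : T -> 'rV[R]_N -> R[i]) :
  cscont (fun p : T * 'rV[R]_N => F p.1 p.2) -> scont C -> (forall t, cdom w (C t) (F t)) ->
  cscont (fun t => integral_cube A (F t)).
Proof.
move=> [sr si] sC dF; split.
  apply: scont_ext (scont_rcube adm sr sC _) => [t|t]; last exact: cdom_Re.
  by rewrite integral_cubeE.
apply: scont_ext (scont_rcube adm si sC _) => [t|t]; last exact: cdom_Im.
by rewrite integral_cubeE.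
Qed.

End OneWeight.

Lemma ci_fubini (A B : set R) w w' K N M (F : 'rV[R]_K -> 'rV[R]_N -> R[i]) :
  admissible A w -> admissible B w' ->
  cscont (fun p : 'rV[R]_K * 'rV[R]_N => F p.1 p.2) ->
  (forall x v, cn (F x v) <= M * wprod w x * wprod w' v) ->
  integral_cube A (fun x => integral_cube B (F x)) =
  integral_cube B (fun v => integral_cube A (fun x => F x v)).
Proof.
move=> aA aB [sr si] dF; apply: ReImP; rewrite !integral_cubeE /=.
  under [in LHS]eq_fun do rewrite integral_cubeE /=.
  under [in RHS]eq_fun do rewrite integral_cubeE /=.
  by apply: (rcube_fubini aA aB sr (M := M)) => x v; exact: le_trans (cn_Re _) (dF _ _).
under [in LHS]eq_fun do rewrite integral_cubeE /=.
under [in RHS]eq_fun do rewrite integral_cubeE /=.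
by apply: (rcube_fubini aA aB si (M := M)) => x v; exact: le_trans (cn_Im _) (dF _ _).
Qed.

Lemma cintegral1E A (g : R -> R[i]) : cintegral A g = integral_cube A (fun v : 'rV[R]_1 => g (v 0 0)).
Proof.
rewrite /=; congr cintegral; apply/funext => x; congr g.
by have := rcons1_0 x (0 : 'rV[R]_0).
Qed.

Definition w1 : R -> R := cst 1.
Definition wR : R -> R := fun x => (oneDsqr x)^-1.

Lemma wprod1 N (v : 'rV[R]_N) : wprod w1 v = 1.
Proof. by rewrite /wprod big1. Qed.

Lemma adm01 : admissible `[0, 1]%classic w1.
Proof.
split=> //; first by move=> x; exact: cvg_cst.
apply/integrableP; split; first by apply/measurable_EFinP; exact: measurable_cst.
rewrite (eq_integral (cst 1%E)); last by move=> x _ /=; rewrite /w1 normr1.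
by rewrite integral_cst//= mul1e lebesgue_measure_itv /= lte01 -EFinB ltry.
Qed.

Lemma rint01 : rint `[0, 1]%classic w1 = 1.
Proof.
have mI : measurable (`[0, 1]%classic : set R) by exact: measurable_itv.
rewrite /rint (Rintegral_cst mu mI 1) mul1r.
have := @lebesgue_measure_itv R `[0, 1]; rewrite /= lte01 -EFinB subr0 => h.
by have := congr1 fine h.
Qed.

Lemma wR_gt0 x : 0 < wR x.
Proof. by rewrite /wR /= invr_gt0 (lt_le_trans ltr01)// oneDsqr_ge1. Qed.

Lemma admR : admissible [set: R] wR.
Proof.
have c : continuous wR by exact: continuous_oneDsqrV.
have g0 x : 0 <= wR x by exact: ltW (wR_gt0 x).
split=> //.
apply/integrableP; split.
  by apply/measurable_EFinP; exact: continuous_measurable_fun.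
have -> : (\int[mu]_x `|(EFin \o wR) x| = \int[mu]_x (wR x)%:E)%E.
  by apply: eq_integral => x _ /=; rewrite ger0_norm.
rewrite ge0_symfun_integralT//; last by move=> x; rewrite /wR /oneDsqr /= sqrrN.
rewrite -set_itvcy integral0y_oneDsqr.
by rewrite -EFinM ltry.
Qed.

End ComplexIntegrals.

(** * One-dimensional integrals of periodic functions *)

Section OneDim.
Variable R : realType.
Local Notation mu := (@lebesgue_measure R).

Lemma rint_FTC (g F : R -> R) (a b : R) : a < b -> continuous g ->
  (forall x, a <= x <= b -> is_derive x 1 F (g x)) ->
  rint `[a, b]%classic g = F b - F a.
Proof.
move=> ab cg dF; have cF x : a <= x <= b -> {for x, continuous F}.
  move=> /dF [dFx _]; exact/differentiable_continuous/derivable1_diffP.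
rewrite /rint /Rintegral (@continuous_FTC2 _ g F a b ab)//.
- exact: continuous_subspaceT.
- split.
  + move=> x /[!in_itv]/= /andP[/ltW ax /ltW xb].
    have H : a <= x <= b by rewrite ax xb.
    by have [] := dF x H.
  + by apply: cvg_at_right_filter; apply: cF; rewrite lexx ltW.
  + by apply: cvg_at_left_filter; apply: cF; rewrite lexx ltW.
- move=> x /[!in_itv]/= /andP[/ltW ax /ltW xb].
  have H : a <= x <= b by rewrite ax xb.
  by rewrite derive1E; have [_ ->] := dF x H.
Qed.

Lemma primitive_exists (g : R -> R) (M : R) : continuous g ->
  exists G, forall x, - M < x -> is_derive x 1 G (g x).
Proof.
move=> cg; exists (fun x => \int[mu]_(t in `[- M, x]) g t) => x Mx.
have [] := @continuous_FTC1_closed R g (- M) x (x + 1).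
- by rewrite ltrDl.
- apply: continuous_compact_integrable; first exact: segment_compact.
  exact: continuous_subspaceT.
- exact: Mx.
- exact: cg.
by move=> d1 d2; apply: DeriveDef => //; rewrite -derive1E.
Qed.

Lemma is_derive_translate (G : R -> R) (s x d : R) : is_derive (x + s) 1 G d ->
  is_derive x 1 (fun y => G (y + s)) d.
Proof.
have shiftE : (fun h : R => h^-1 *: (((fun y => G (y + s)) \o shift x) (h *: 1) - G (x + s))) =
   (fun h => h^-1 *: ((G \o shift (x + s)) (h *: 1) - G (x + s))).
  by apply/funext => h /=; rewrite addrA.
move=> [dG <-]; apply: DeriveDef; first by rewrite /derivable shiftE.
by rewrite /derive shiftE.
Qed.

Lemma continuous_translate (g : R -> R) s : continuous g -> continuous (fun y => g (y + s)).
Proof.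
move=> cg; apply: scont_continuous; apply: (scont_compl (continuous_scont cg)) => u v uv.
by apply: cvgD => //; exact: cvg_cst.
Qed.

(** With G a primitive of g, both sides are values of G (x + 1) - G x, whose
derivative vanishes by periodicity. *)
Lemma rint_shift (g : R -> R) (s : R) : continuous g -> (forall x, g (x + 1) = g x) ->
  rint `[0, 1]%classic (fun y => g (y + s)) = rint `[0, 1]%classic g.
Proof.
move=> cg pg; have [G dG] := primitive_exists (`|s| + 1) cg.
have sM x : - `|s| <= x -> - (`|s| + 1) < x.
  by apply: lt_le_trans; rewrite opprD ltrBlDr ltrDl.
have s0 := normr_ge0 s.
have rE t : - `|s| <= t -> rint `[0, 1]%classic (fun y => g (y + t)) = G (1 + t) - G (0 + t).
  move=> st; apply: (rint_FTC (F := fun y => G (y + t)) ltr01); first exact: continuous_translate.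
  move=> x /andP[x0 _]; apply: is_derive_translate; apply: dG; apply: sM.
  by rewrite (le_trans st)// lerDr.
have -> : rint `[0, 1]%classic g = rint `[0, 1]%classic (fun y => g (y + 0)).
  by congr rint; apply/funext => y; rewrite addr0.
have sN : - `|s| <= s by rewrite lerNl -normrN ler_norm.
rewrite !rE ?oppr_le0//.
pose D x := G (1 + x) - G (0 + x).
have dD x : - `|s| <= x -> is_derive x 1 D 0.
  move=> sx; rewrite -(subrr (g x)); apply: is_deriveB.
    under eq_fun do rewrite addrC; apply: is_derive_translate; rewrite -[g x]pg.
    by apply: dG; apply: sM; rewrite (le_trans sx)// lerDl.
  by under eq_fun do rewrite add0r; apply: dG; exact: sM.
have cD x : - `|s| <= x -> {for x, continuous D}.
  by move=> /dD [dFx _]; exact/differentiable_continuous/derivable1_diffP.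
have D0 a b : - `|s| <= a -> a <= b -> D a = D b.
  move=> sa ab; have [] := @MVT_segment R D (cst 0) a b ab.
  - move=> x /[!in_itv]/= /andP[/ltW ax _]; apply: dD; exact: le_trans sa ax.
  - apply: continuous_in_subspaceT => x /[!inE]/=; rewrite in_itv/= => /andP[ax _].
    by apply: cD; exact: le_trans sa ax.
  by move=> c _ /eqP; rewrite mul0r subr_eq0 => /eqP.
rewrite -/(D s) -/(D 0); have [s0'|s0'] := leP 0 s.
  by rewrite (D0 0 s)// ?oppr_le0.
by rewrite (D0 s 0)// ltW.
Qed.

(** Symmetric intervals, cut into unit intervals: this is the form in which the
Fejer means sum an integral over R. *)
Lemma rint_itv_sum (f : R -> R) (m : nat) : continuous f ->
  rint `[- m%:R, m%:R + 1]%classic f =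
  \sum_(q < m.*2.+1) rint `[0, 1]%classic (fun y => f (y + (q%:R - m%:R))).
Proof.
move=> cf; have [G dG] := primitive_exists (m%:R + 1) cf.
have sM x : - m%:R <= x -> - (m%:R + 1) < x.
  by apply: lt_le_trans; rewrite opprD ltrBlDr ltrDl.
have -> : rint `[- m%:R, m%:R + 1]%classic f = G (m%:R + 1) - G (- m%:R).
  apply: rint_FTC => //; first by rewrite (@le_lt_trans _ _ 0)// ?oppr_le0// ltr_wpDl.
  by move=> x /andP[mx _]; apply: dG; exact: sM.
rewrite (eq_bigr (fun q : 'I_m.*2.+1 => G (q.+1%:R - m%:R) - G (q%:R - m%:R))); last first.
  move=> q _; set r := q%:R - m%:R.
  have -> : rint `[0, 1]%classic (fun y => f (y + r)) = G (1 + r) - G (0 + r).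
    apply: (@rint_FTC _ (fun y => G (y + r))) => //; first exact: continuous_translate.
    move=> x /andP[x0 _]; apply: is_derive_translate; apply: dG; apply: sM.
    by rewrite /r addrA lerDr addr_ge0.
  by rewrite add0r /r addrA -natr1 (addrC 1).
rewrite -(big_mkord xpredT (fun q => G (q.+1%:R - m%:R) - G (q%:R - m%:R))).
rewrite telescope_sumr// sub0r; congr (G _ - _).
by rewrite -addnn -addSn natrD addrK natr1.
Qed.

Lemma rint_lim (f : R -> R) M : scont f -> dom1 (@wR R) M f ->
  rint `[- m%:R, m%:R + 1]%classic f @[m --> \oo] --> rint setT f.
Proof.
move=> sf df; have mf : measurable_fun setT f.
  by apply: continuous_measurable_fun; exact: scont_continuous.
pose I (m : nat) := `[- m%:R, m%:R + 1 : R]%classic.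
have mI m : measurable (I m) by exact: measurable_itv.
have [] := @dominated_convergence _ _ _ mu setT measurableT (fun m => EFin \o (f \_ (I m)))
  (EFin \o f) (fun x => M%:E * (EFin \o @wR R) x)%E.
- move=> m; apply/measurable_EFinP; apply/(measurable_restrict _ (mI m) measurableT).
  by rewrite setTI; apply: measurable_funS mf.
- exact/measurable_EFinP.
- apply: aeW => x _ /=; apply: cvg_EFin; first exact: nearW.
  apply: cvg_near_cst; exists (Num.truncn `|x|).+1 => //= m /= xm.
  rewrite /patch mem_set// /I /= in_itv/=.
  have : `|x| <= m%:R.
    by apply: ltW; apply: lt_le_trans (truncnS_gt _) _; rewrite ler_nat.
  by rewrite ler_norml => /andP[-> xm']; rewrite (le_trans xm')// lerDl.
- exact: integrableZl (adm_int (admR R)).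
- apply: aeW => x n _ /=; rewrite lee_fin /patch; case: ifP => _; first exact: df.
  by rewrite normr0; apply: le_trans (df x).
move=> intf _ cv; apply: fine_cvg.
move: cv; rewrite /rint /Rintegral fineK; last exact: integrable_fin_num.
apply: cvg_trans; apply: near_eq_cvg; apply: nearW => m /=.
by rewrite [RHS]integral_mkcond restrict_EFin.
Qed.

Lemma rint_zero (f : R -> R) M : scont f -> dom1 (@wR R) M f -> (forall x, 0 <= f x) ->
  rint setT f = 0 -> forall x, f x = 0.
Proof.
move=> sf df f0 If x; apply/eqP; rewrite eq_le f0 andbT leNgt; apply/negP => fx.
have cf := scont_continuous sf.
have [e e0 He] : exists2 e, 0 < e & forall y, `|x - y| < e -> f x / 2 <= f y.
  have /cvgrPdist_le/(_ (f x / 2)) := cf x; rewrite divr_gt0// => /(_ isT).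
  move=> /nbhs_ballP[e /= e0 He]; exists e => // y xy.
  have := He y xy; rewrite ler_norml => /andP[_].
  by rewrite lerBlDr addrC -lerBlDr {1}(splitr (f x)) addrK.
have mf : measurable_fun setT (EFin \o f).
  by apply/measurable_EFinP; exact: continuous_measurable_fun.
pose J := `]x - e, x + e[%classic.
have mJ : measurable J by exact: measurable_itv.
have : (\int[mu]_(y in J) (f x / 2)%:E <= \int[mu]_y (f y)%:E)%E.
  apply: (@le_trans _ _ (\int[mu]_(y in J) (f y)%:E)%E).
    apply: ge0_le_integral => //.
    - by move=> y _; rewrite lee_fin divr_ge0.
    - by apply: measurable_funS mf.
    - move=> y; rewrite /J /= in_itv/= => /andP[y1 y2]; rewrite lee_fin; apply: He.
      by rewrite distrC ltr_distl y1.
  apply: ge0_subset_integral => //; by move=> y _; rewrite lee_fin.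
rewrite integral_cst//= lebesgue_measure_itv /= lte_fin ltrD2l gtrN// -EFinD -EFinM.
have -> : (\int[mu]_y (f y)%:E = 0)%E.
  rewrite -(fineK (integrable_fin_num _ (rint_integrable (admR R) sf df)))//.
  by have := If; rewrite /rint /Rintegral /= => ->.
rewrite lee_fin leNgt; apply/negP; rewrite negbK mulr_gt0 ?divr_gt0//.
by rewrite subr_gt0 ltrD2l gtrN.
Qed.

Lemma per_shift (T : Type) (p : R) (g : R -> T) (q : int) x : (forall x, g (x + p) = g x) ->
  g (x + p * q%:~R) = g x.
Proof.
move=> pg; have nstep n z : g (z + p * n%:R) = g z.
  elim: n z => [|n IH] z; first by rewrite mulr0 addr0.
  by rewrite -natr1 mulrDr mulr1 addrA pg IH.
case: q => n; first by rewrite -pmulrn nstep.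
by rewrite NegzE mulrNz -pmulrn mulrN -(nstep n.+1) subrK.
Qed.

End OneDim.

(** * Periodic functions on the unit cube *)

Section UnitCube.
Variable R : realType.
Local Notation Re := complex.Re.
Local Notation Im := complex.Im.
Local Notation I01 := (`[0, 1]%classic : set R).

Definition bounded_by (T : Type) (B : R) (f : T -> R[i]) := forall u, cn (f u) <= B.

Lemma cok01 N B (f : 'rV[R]_N -> R[i]) : cscont f -> bounded_by B f -> cok (@w1 R) f.
Proof. by move=> sf bf; split=> //; exists B => v; rewrite wprod1 mulr1. Qed.

Lemma ci01_bound N B (f : 'rV[R]_N -> R[i]) : cscont f -> bounded_by B f ->
  cn (integral_unit_cube f) <= 2 * B.
Proof.
move=> sf bf; have := @ci_bound R _ _ (adm01 R) N B f sf.
rewrite rint01 expr1n mulr1; apply.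
by move=> v; rewrite wprod1 mulr1.
Qed.

Lemma ci01_fubini K N B (F : 'rV[R]_K -> 'rV[R]_N -> R[i]) :
  cscont (fun p : 'rV[R]_K * 'rV[R]_N => F p.1 p.2) ->
  (forall x v, cn (F x v) <= B) ->
  integral_unit_cube (fun x => integral_unit_cube (F x)) =
  integral_unit_cube (fun v => integral_unit_cube (fun x => F x v)).
Proof.
move=> sF dF; apply: (ci_fubini (M := B) (adm01 R) (adm01 R) sF) => x v.
by rewrite !wprod1 !mulr1.
Qed.

Lemma cscont_rcons1l N (f : 'rV[R]_N.+1 -> R[i]) x : cscont f -> cscont (fun v => f (rcons1 x v)).
Proof. by move=> [sr si]; split; [exact: scont_rcons1 sr|exact: scont_rcons1 si]. Qed.

Lemma cscont_pair (T U : topologicalType) N (f : 'rV[R]_N -> R[i]) (g : T * U -> 'rV[R]_N) :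
  cscont f -> (forall (u : nat -> T * U) p, u n @[n --> \oo] --> p ->
     g (u n) @[n --> \oo] --> g p) -> cscont (fun p => f (g p)).
Proof. by move=> [sr si] sg; split=> u p up; [apply: sr|apply: si]; exact: sg. Qed.

Lemma ci01_cst N (c : R[i]) : integral_unit_cube (fun _ : 'rV[R]_N => c) = c.
Proof.
elim: N => [//|N IH]; rewrite /integral_unit_cube /=.
have -> : (fun x : R => integral_cube I01 (fun _ : 'rV[R]_N => c)) = (fun _ => c).
  by apply/funext => x; exact: IH.
have H (r : R) : rint I01 (fun _ => r) = r.
  rewrite -[RHS](mulr1 r) -[X in _ * X](rint01 R).
  rewrite -(rintZ (adm01 R) r (M := 1)); first by congr rint; apply/funext => x; rewrite mulr1.
    exact: scont_cst.
  by move=> x; rewrite normr1 mulr1.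
by rewrite /cintegral -/(rint _ _) -/(rint _ _) !H; case: c {IH}.
Qed.

Definition zperiodic N (f : 'rV[R]_N -> R[i]) :=
  forall (l : 'rV[int]_N) u, f (u + map_mx intr l) = f u.

Lemma rcons1D N (x y : R) (u v : 'rV[R]_N) : rcons1 x u + rcons1 y v = rcons1 (x + y) (u + v).
Proof.
apply/rowP => i; case: (unliftP ord0 i) => [j ->|->]; rewrite mxE.
  by rewrite !rcons1_S mxE.
by rewrite !rcons1_0.
Qed.

Lemma rcons1Z N (c x : R) (u : 'rV[R]_N) : c *: rcons1 x u = rcons1 (c * x) (c *: u).
Proof.
apply/rowP => i; case: (unliftP ord0 i) => [j ->|->]; rewrite mxE.
  by rewrite !rcons1_S mxE.
by rewrite !rcons1_0.
Qed.

Definition izcons N (z : int) (l : 'rV[int]_N) : 'rV[int]_N.+1 :=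
  \row_i if unlift ord0 i is Some j then l 0 j else z.

Lemma map_izcons N z (l : 'rV[int]_N) :
  map_mx intr (izcons z l) = rcons1 (z%:~R : R) (map_mx intr l).
Proof.
apply/rowP => i; rewrite [LHS]mxE [X in X%:~R]mxE; case: (unliftP ord0 i) => [j ->|->].
  by rewrite rcons1_S mxE.
by rewrite rcons1_0.
Qed.

Lemma zperiodic_rcons1 N (f : 'rV[R]_N.+1 -> R[i]) x : zperiodic f ->
  zperiodic (fun v => f (rcons1 x v)).
Proof.
move=> pf l u; rewrite -[RHS](pf (izcons 0 l)) map_izcons rcons1D.
by rewrite mulr0z addr0.
Qed.

Lemma rcons1_cvg N (u : nat -> R * 'rV[R]_N) p : u n @[n --> \oo] --> p ->
  rcons1 (u n).1 (u n).2 @[n --> \oo] --> rcons1 p.1 p.2.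
Proof. by move=> up; apply: cvg_rcons1; [exact: cvg_seq_fst up|exact: cvg_seq_snd up]. Qed.

Lemma cscont_rcons1 N (f : 'rV[R]_N.+1 -> R[i]) : cscont f ->
  cscont (fun p : R * 'rV[R]_N => f (rcons1 p.1 p.2)).
Proof. by move=> sf; apply: (cscont_pair (g := fun p => rcons1 p.1 p.2) sf) => u p; exact: rcons1_cvg. Qed.

Lemma ci01_shift N B (f : 'rV[R]_N -> R[i]) s : cscont f -> bounded_by B f -> zperiodic f ->
  integral_unit_cube (fun v => f (v + s)) = integral_unit_cube f.
Proof.
elim: N f s => [|N IH] f s sf bf pf.
  by rewrite /integral_unit_cube /= (_ : 0 + s = 0) //; apply/rowP => -[].
pose g x := integral_unit_cube (fun v : 'rV[R]_N => f (rcons1 x v)).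
have sg : cscont g.
  apply: (cscont_ci (adm01 R) (C := cst B) (F := fun x v => f (rcons1 x v))).
  - exact: cscont_rcons1.
  - exact: scont_cst.
  - by move=> t v; rewrite wprod1 mulr1; exact: bf.
have pg x : g (x + 1) = g x.
  congr integral_cube; apply/funext => v; rewrite -[RHS](pf (izcons 1 0)) map_izcons rcons1D.
  by congr (f (rcons1 _ _)); apply/rowP => i; rewrite !mxE addr0.
transitivity (cintegral I01 (fun x => g (x + s 0 ord0))).
  rewrite /integral_unit_cube /=; congr cintegral; apply/funext => x.
  rewrite /g -[RHS](IH _ (\row_i s 0 (lift ord0 i))).
  - congr integral_cube; apply/funext => v; congr f.
    by rewrite {1}(rcons1_surj s) -/(rcons1 x v) rcons1D.
  - exact: cscont_rcons1l.
  - by move=> v; exact: bf.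
  - exact: zperiodic_rcons1.
have [sr si] := sg.
rewrite /integral_unit_cube /= /cintegral -!/(rint _ _); congr (_ +i* _).
  by apply: (rint_shift (g := fun x => Re (g x))); [exact: scont_continuous|move=> x; rewrite pg].
by apply: (rint_shift (g := fun x => Im (g x))); [exact: scont_continuous|move=> x; rewrite pg].
Qed.

Lemma delta_lift N (j : 'I_N) : delta_mx 0 (lift ord0 j) = rcons1 0 (delta_mx 0 j) :> 'rV[R]_N.+1.
Proof.
apply/rowP => i; case: (unliftP ord0 i) => [k ->|->].
  by rewrite rcons1_S !mxE eqxx /= (inj_eq lift_inj).
by rewrite rcons1_0 !mxE eqxx.
Qed.

Lemma delta_0 N : delta_mx 0 ord0 = rcons1 1 0 :> 'rV[R]_N.+1.
Proof.
apply/rowP => i; case: (unliftP ord0 i) => [k ->|->].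
  by rewrite rcons1_S !mxE.
by rewrite rcons1_0 !mxE eqxx.
Qed.

Lemma growth_lift N (f : 'rV[R]_N.+1 -> R) x (v : 'rV[R]_N) (j : 'I_N) :
  (fun h : R => h^-1 *: ((f \o shift (rcons1 x v)) (h *: delta_mx 0 (lift ord0 j)) - f (rcons1 x v))) =
  (fun h => h^-1 *: (((fun v => f (rcons1 x v)) \o shift v) (h *: delta_mx 0 j) - f (rcons1 x v))).
Proof.
by apply/funext => h /=; rewrite delta_lift rcons1Z rcons1D mulr0 add0r.
Qed.

Lemma growth_0 N (f : 'rV[R]_N.+1 -> R) x (v : 'rV[R]_N) :
  (fun h : R => h^-1 *: ((f \o shift (rcons1 x v)) (h *: delta_mx 0 ord0) - f (rcons1 x v))) =
  (fun h => h^-1 *: (((fun x => f (rcons1 x v)) \o shift x) (h *: 1) - f (rcons1 x v))).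
Proof.
by apply/funext => h /=; rewrite delta_0 rcons1Z rcons1D scaler0 add0r.
Qed.

Definition cderivable N (i : 'I_N) (f : 'rV[R]_N -> R[i]) := forall u,
  derivable (fun w => Re (f w)) u (delta_mx 0 i) /\ derivable (fun w => Im (f w)) u (delta_mx 0 i).

Lemma cderivable_lift N (f : 'rV[R]_N.+1 -> R[i]) x (j : 'I_N) :
  cderivable (lift ord0 j) f -> cderivable j (fun v => f (rcons1 x v)).
Proof.
move=> df v; have [d1 d2] := df (rcons1 x v); split.
  by rewrite /derivable -(growth_lift (fun w => Re (f w))).
by rewrite /derivable -(growth_lift (fun w => Im (f w))).
Qed.

Lemma pd_lift N (f : 'rV[R]_N.+1 -> R[i]) x v (j : 'I_N) :
  pd (lift ord0 j) f (rcons1 x v) = pd j (fun v => f (rcons1 x v)) v.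
Proof.
rewrite /pd /derive; congr (_ +i* _).
  by rewrite (growth_lift (fun w => Re (f w))).
by rewrite (growth_lift (fun w => Im (f w))).
Qed.

Lemma pd_0 N (f : 'rV[R]_N.+1 -> R[i]) (x : R) (v : 'rV[R]_N) : cderivable ord0 f ->
  is_derive x 1 (fun x : R => Re (f (rcons1 x v))) (Re (pd ord0 f (rcons1 x v))) /\
  is_derive x 1 (fun x : R => Im (f (rcons1 x v))) (Im (pd ord0 f (rcons1 x v))).
Proof.
move=> df; have [d1 d2] := df (rcons1 x v); split; apply: DeriveDef.
- by rewrite /derivable -(growth_0 (fun w => Re (f w))).
- by rewrite /pd /= /derive (growth_0 (fun w => Re (f w))).
- by rewrite /derivable -(growth_0 (fun w => Im (f w))).
- by rewrite /pd /= /derive (growth_0 (fun w => Im (f w))).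
Qed.

(** After moving coordinate i to the outside by Fubini the integral is the
difference of the values at 1 and 0 of a periodic function. *)
Lemma ci01_pd N B (i : 'I_N) (f : 'rV[R]_N -> R[i]) : zperiodic f -> cderivable i f ->
  cscont (pd i f) -> bounded_by B (pd i f) -> integral_unit_cube (pd i f) = 0.
Proof.
elim: N i f => [|N IH] i f; first by case: i.
move=> pf df sf bf; case: (unliftP ord0 i) => [j|] Ei.
  rewrite Ei in df sf bf *; rewrite /integral_unit_cube /=.
  rewrite (_ : (fun x => _) = (fun x => 0)).
    have := ci01_cst 1 0; rewrite /integral_unit_cube /=; exact.
  apply/funext => x; rewrite -/(rcons1 x _).
  have E : (fun v : 'rV[R]_N => pd (lift ord0 j) f (rcons1 x v)) = pd j (fun v => f (rcons1 x v)).
    by apply/funext => v; rewrite pd_lift.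
  have H : integral_unit_cube (fun v : 'rV[R]_N => pd (lift ord0 j) f (rcons1 x v)) = 0.
    rewrite E; apply: IH.
    - exact: zperiodic_rcons1.
    - exact: cderivable_lift.
    - by rewrite -E; exact: cscont_rcons1l.
    - by rewrite -E => v; exact: bf.
  exact: H.
rewrite Ei in df sf bf *.
have -> : integral_unit_cube (pd ord0 f) =
   integral_unit_cube (fun x : 'rV[R]_1 => integral_unit_cube (fun v => pd ord0 f (rcons1 (x 0 0) v))).
  by rewrite {1}/integral_unit_cube /= cintegral1E.
rewrite (ci01_fubini (B := B)).
- rewrite -[RHS](ci01_cst N 0); congr integral_unit_cube; apply/funext => v.
  rewrite /integral_unit_cube -(cintegral1E _ (fun x => pd ord0 f (rcons1 x v))).
  have sx : cscont (fun x => pd ord0 f (rcons1 x v)).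
    have [sr si] := sf; split=> u y uy.
      by apply: sr; apply: cvg_rcons1 => //; exact: cvg_cst.
    by apply: si; apply: cvg_rcons1 => //; exact: cvg_cst.
  have E10 : f (rcons1 1 v) = f (rcons1 0 v).
    rewrite -[RHS](pf (izcons 1 0)) map_izcons rcons1D add0r.
    by congr (f (rcons1 _ _)); apply/rowP => k; rewrite !mxE addr0.
  rewrite /cintegral -!/(rint _ _).
  have -> : rint I01 (fun x => Re (pd ord0 f (rcons1 x v))) = 0.
    transitivity (Re (f (rcons1 1 v)) - Re (f (rcons1 0 v))); last by rewrite E10 subrr.
    apply: (rint_FTC (F := fun x => Re (f (rcons1 x v))) ltr01).
      exact: scont_continuous sx.1.
    by move=> x _; exact: (pd_0 x v df).1.
  have -> // : rint I01 (fun x => Im (pd ord0 f (rcons1 x v))) = 0.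
    transitivity (Im (f (rcons1 1 v)) - Im (f (rcons1 0 v))); last by rewrite E10 subrr.
    apply: (rint_FTC (F := fun x => Im (f (rcons1 x v))) ltr01).
      exact: scont_continuous sx.2.
    by move=> x _; exact: (pd_0 x v df).2.
- apply: (cscont_pair (g := fun p : 'rV[R]_1 * 'rV[R]_N => rcons1 (p.1 0 0) p.2) sf) => u p up.
  apply: cvg_rcons1; last exact: cvg_seq_snd up.
  by have /cvg_rowP := cvg_seq_fst up; exact.
- by move=> x v; exact: bf.
Qed.

End UnitCube.

(** * Characters of the torus *)

Section Characters.
Variable R : realType.
Local Notation Re := complex.Re.
Local Notation Im := complex.Im.

Lemma scont_coord N (i : 'I_N) : scont (fun v : 'rV[R]_N => v 0 i).
Proof. by apply: continuous_scont; exact: coord_continuous. Qed.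

Lemma cscont_char N (p : 'rV[int]_N) :
  cscont (fun x : 'rV[R]_N => expi (2 * pi * \sum_i (p 0 i)%:~R * x 0 i)).
Proof.
apply: cscont_expi; apply: scontM; first exact: scont_cst.
by apply: scont_sum => i; apply: scontM; [exact: scont_cst|exact: scont_coord].
Qed.

Lemma ci01_expi N (p : 'rV[int]_N) :
  integral_unit_cube (fun x : 'rV[R]_N => expi (2 * pi * \sum_i (p 0 i)%:~R * x 0 i)) =
  (p == 0)%:R.
Proof.
case: eqP => [->|/eqP p0].
  rewrite (_ : (fun x => _) = (fun _ => 1)) ?ci01_cst//; apply/funext => x.
  by rewrite big1 ?mulr0 ?expi0// => i _; rewrite mxE mul0r.
have [i pi0] : exists i, p 0 i != 0.
  apply/existsP; apply: contraNT p0; rewrite negb_exists => /forallP H.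
  by apply/eqP/rowP => j; rewrite mxE; apply/eqP; have := H j; rewrite negbK.
set f := (X in integral_unit_cube X).
pose s : 'rV[R]_N := (2 * (p 0 i)%:~R)^-1 *: delta_mx 0 i.
have bf : bounded_by 1 f by move=> v; rewrite /f cn_expi.
have pf : zperiodic f.
  move=> l u; rewrite /f.
  have -> : \sum_j (p 0 j)%:~R * (u + map_mx intr l) 0 j =
      \sum_j (p 0 j)%:~R * u 0 j + (\sum_j p 0 j * l 0 j)%:~R.
    rewrite rmorph_sum -big_split; apply: eq_bigr => j _.
    by rewrite !mxE mulrDr rmorphM.
  by rewrite mulrDr expiD expi2piz mulr1.
have := ci01_shift s (cscont_char p) bf pf.
have -> : (fun v => f (v + s)) = (fun v => -1 * f v).
  apply/funext => v; rewrite /f.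
  have -> : \sum_j (p 0 j)%:~R * (v + s) 0 j = 2^-1 + \sum_j (p 0 j)%:~R * v 0 j.
    rewrite [in RHS](bigD1 i)// [LHS](bigD1 i)//= !mxE !eqxx /= mulr1.
    rewrite (eq_bigr (fun j => (p 0 j)%:~R * v 0 j)); last first.
      by move=> j /negPf ji; rewrite !mxE eqxx ji /= mulr0 addr0.
    rewrite mulrDr addrA; congr (_ + _); rewrite addrC; congr (_ + _).
    by rewrite invfM mulrC mulfVK// intr_eq0.
  rewrite mulrDr mulrAC divff ?pnatr_eq0// mul1r expiD; congr (_ * _).
  by rewrite /expi cospi sinpi; simpc.
rewrite {1}/integral_unit_cube (ciZ (adm01 R)) -/(integral_unit_cube f); last first.
  exact: cok01 (cscont_char p) bf.
move=> H; have : 2 * integral_unit_cube f = 0 by rewrite mulr_natl mulr2n -{1}H mulN1r addNr.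
by move=> /eqP; rewrite mulf_eq0 pnatr_eq0 /= => /eqP.
Qed.

(** A quantitative form of the fact that expi (2 pi t) = 1 only for integers t:
the distance of t to the nearest integer is controlled by the distance of expi
(2 pi t) to 1. *)
Lemma expi_lower (t : R) : exists j : int, `|t - j%:~R| <= cn (expi (2 * pi * t) - 1).
Proof.
exists (Num.floor (t + 2^-1)); set j := Num.floor _.
pose r := t - j%:~R.
have -> : expi (2 * pi * t) = expi (2 * pi * r).
  by rewrite /r mulrBr expiD -mulrN -mulrNz expi2piz mulr1.
have /andP[j1 j2] := floor_itv (t + 2^-1); rewrite -/j in j1 j2.
have hr : `|r| <= 2^-1.
  rewrite ler_norml /r; apply/andP; split.
    by rewrite lerBrDr addrC lerBlDr.
  by rewrite lerBlDr; move: j2; rewrite intrD => /ltW; lra.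
rewrite -/r.
have key (s : R) : 0 <= s <= 2^-1 -> s <= cn (expi (2 * pi * s) - 1).
  move=> /andP[s0 s1]; set u := 2 * pi * s.
  have pi1 : 2 <= pi :> R by exact: pi_ge2.
  have u0 : 0 <= u by rewrite /u !mulr_ge0// pi_ge0.
  have upi : u <= pi.
    by rewrite /u mulrAC -[leRHS]mul1r ler_wpM2r ?pi_ge0//; lra.
  have [c12|c12] := leP (cos u) 2^-1.
    apply: le_trans (cn_Re _); rewrite cReD cReN /= ler0_norm; lra.
  apply: le_trans (cn_Im _); rewrite cImD cImN /= subr0.
  have [c /[!in_itv]/= /andP[c0 cu]] := @MVT_segment R sin cos 0 u u0
      (fun x _ => is_derive_sin x) (continuous_subspaceT (@continuous_sin R)).
  rewrite sin0 !subr0 => ->.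
  have cc : 2^-1 <= cos c.
    apply: (le_trans (ltW c12)).
    rewrite leNgt ltr_cos ?in_itv/= ?u0 ?upi ?c0 ?(le_trans cu upi)//.
    by rewrite -leNgt.
  rewrite ger0_norm; last by rewrite mulr_ge0//; lra.
  apply: (@le_trans _ _ (2^-1 * u)); last by rewrite ler_wpM2r.
  rewrite /u; nra.
have [r0|r0] := leP 0 r.
  by rewrite ger0_norm// key// r0 (le_trans (ler_norm _) hr).
have -> : cn (expi (2 * pi * r) - 1) = cn (expi (2 * pi * (- r)) - 1).
  rewrite mulrN expiN -cn_conj; congr cn.
  by case: (expi _) => a b; apply: ReImP => /=; ring.
rewrite ltr0_norm//.
by apply: key; rewrite oppr_ge0 (ltW r0) -normrN in hr *; rewrite (le_trans (ler_norm _) hr).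
Qed.

End Characters.

(** * Poisson summation in dimension one *)

Section Poisson1.
Variable R : realType.
Lemma cn_sum_ord n (F : 'I_n -> R[i]) C : (forall i, cn (F i) <= C) ->
  cn (\sum_(i < n) F i) <= n%:R * C.
Proof.
move=> H; rewrite (le_trans (cn_sum _ _))// (le_trans (ler_sum _ (fun i _ => H i)))//.
by rewrite sumr_const card_ord mulr_natl.
Qed.
Lemma conj_expi (x : R) : conjc (expi x) = (expi x)^-1.
Proof. by apply: (mulfI (expi_neq0 x)); rewrite divff ?expi_neq0// expi_conjM. Qed.
Lemma conj_expX (x : R) n : conjc (expi x ^+ n) = expi x ^- n.
Proof. by rewrite rmorphXn /= -exprVn -conj_expi. Qed.
Local Notation Re := complex.Re.
Local Notation Im := complex.Im.
Local Notation I01 := (`[0, 1]%classic : set R).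
Local Notation C1 := (cintegral I01).

Lemma scont_id : scont (fun x : R => x).
Proof. by move=> u v. Qed.

Lemma cscont_row1 (g : R -> R[i]) : cscont g -> cscont (fun v : 'rV[R]_1 => g (v 0 0)).
Proof.
by move=> [sr si]; split; [apply: (scont_compl sr)|apply: (scont_compl si)]; exact: scont_coord.
Qed.

Section C1.
Implicit Types f g : R -> R[i].

Lemma C1_sum (I : Type) (r : seq I) (B : I -> R) (F : I -> R -> R[i]) :
  (forall i, cscont (F i)) -> (forall i, bounded_by (B i) (F i)) ->
  C1 (fun x => \sum_(i <- r) F i x) = \sum_(i <- r) C1 (F i).
Proof.
move=> sF bF; rewrite cintegral1E (ci_sum (adm01 R) r (F := fun i (v : 'rV[R]_1) => F i (v 0 0))).
  by apply: eq_bigr => i _; rewrite cintegral1E.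
by move=> i; apply: (cok01 (B := B i)); [exact: cscont_row1|move=> v; exact: bF].
Qed.

Lemma C1Z c B f : cscont f -> bounded_by B f -> C1 (fun x => c * f x) = c * C1 f.
Proof.
move=> sf bf; rewrite !cintegral1E.
apply: (ciZ (adm01 R) c (f := fun v : 'rV[R]_1 => f (v 0 0))).
by apply: (cok01 (B := B)); [exact: cscont_row1|move=> v; exact: bf].
Qed.

Lemma C1B B B' f g : cscont f -> bounded_by B f -> cscont g -> bounded_by B' g ->
  C1 (fun x => f x - g x) = C1 f - C1 g.
Proof.
move=> sf bf sg bg; rewrite !cintegral1E.
apply: (ciB (adm01 R) (f := fun v : 'rV[R]_1 => f (v 0 0)) (g := fun v : 'rV[R]_1 => g (v 0 0))).
  by apply: (cok01 (B := B)); [exact: cscont_row1|move=> v; exact: bf].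
by apply: (cok01 (B := B')); [exact: cscont_row1|move=> v; exact: bg].
Qed.

Lemma C1_cst c : C1 (fun _ => c) = c.
Proof. by rewrite cintegral1E; exact: (@ci01_cst R 1 c). Qed.

Lemma C1_bound B f : cscont f -> (forall x, 0 <= x <= 1 -> cn (f x) <= B) -> cn (C1 f) <= 2 * B.
Proof.
move=> sf bf; pose cl (x : R) := Num.max 0 (Num.min 1 x).
have scl : scont cl.
  by apply: continuous_scont => x; apply: continuous_max; [exact: cvg_cst|
    apply: continuous_min; [exact: cvg_cst|exact: cvg_id]].
have cl01 x : 0 <= cl x <= 1 by rewrite /cl le_max lexx /= ge_max ler01 ge_min lexx.
have clE x : 0 <= x <= 1 -> cl x = x.
  by move=> /andP[x0 x1]; rewrite /cl min_r// max_r.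
have -> : C1 f = C1 (fun x => f (cl x)).
  by congr (_ +i* _); apply: eq_Rintegral => x; rewrite inE /= in_itv/= => /clE ->.
rewrite cintegral1E; apply: (ci01_bound (f := fun v : 'rV[R]_1 => f (cl (v 0 0)))).
  have [sr si] := sf; apply: (cscont_row1 (g := fun x => f (cl x))).
  by split; [exact: (scont_compl sr scl)|exact: (scont_compl si scl)].
by move=> v; exact: bf.
Qed.

Lemma C1_shift B f s : cscont f -> bounded_by B f -> (forall x, f (x + 1) = f x) ->
  C1 (fun x => f (x + s)) = C1 f.
Proof.
move=> [sr si] bf pf; rewrite /cintegral -!/(rint _ _); congr (_ +i* _).
  by apply: (rint_shift (g := fun x => Re (f x))); [exact: scont_continuous|move=> x; rewrite pf].
by apply: (rint_shift (g := fun x => Im (f x))); [exact: scont_continuous|move=> x; rewrite pf].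
Qed.

Lemma C1_real B (f : R -> R) : scont f -> (forall x, 0 <= f x <= B) ->
  C1 (fun x => (f x)%:C) = (rint I01 f)%:C.
Proof.
move=> sf bf; rewrite /cintegral -!/(rint _ _) /=; congr (_ +i* _).
by have := C1_cst 0; rewrite /cintegral => /(congr1 (@complex.Im R)).
Qed.

Lemma C1_expi (p : int) : C1 (fun x => expi (2 * pi * (p%:~R * x))) = (p == 0)%:R.
Proof.
have := ci01_expi R (const_mx p : 'rV[int]_1).
rewrite (_ : (const_mx p == 0) = (p == 0)); last first.
  apply/eqP/eqP => [/rowP /(_ 0)|->]; first by rewrite !mxE.
  by apply/rowP => i; rewrite !mxE.
move=> <-; rewrite cintegral1E; congr integral_cube; apply/funext => v.
by rewrite big_ord1 mxE.
Qed.

Lemma C1_le B f (b : R -> R) : cscont f -> scont b -> (forall x, cn (f x) <= b x) ->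
  (forall x, b x <= B) -> cn (C1 f) <= 2 * rint I01 b.
Proof.
move=> [sr si] sb fb bB.
have b0 x : 0 <= b x by apply: le_trans (fb x); exact: cn_ge0.
have db : dom1 (@w1 R) B b by move=> x; rewrite mulr1 ger0_norm.
have H (h : R -> R) : scont h -> (forall x, `|h x| <= b x) -> `|rint I01 h| <= rint I01 b.
  move=> sh hb; have dh : dom1 (@w1 R) B h by move=> x; rewrite mulr1 (le_trans (hb x)).
  rewrite ler_norml; apply/andP; split.
    rewrite -mulN1r -(rintZ (adm01 R) (-1) sb db).
    apply: (rint_le (adm01 R) _ sh _ dh (M1 := B)).
    - by apply: scontM => //; exact: scont_cst.
    - by move=> x; rewrite mulN1r normrN; exact: db.
    - by move=> x; rewrite mulN1r; have := hb x; rewrite ler_norml => /andP[].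
  by apply: (rint_le (adm01 R) sh sb dh db) => x; have := hb x; rewrite ler_norml => /andP[].
rewrite (le_trans (cn_ReIm _))// mulrDl !mul1r lerD//.
  by apply: H => // x; exact: le_trans (cn_Re _) (fb x).
by apply: H => // x; exact: le_trans (cn_Im _) (fb x).
Qed.

End C1.

(** Cesaro sums of symmetric partial sums are double sums over j - l, which
under the integral sign become squared moduli: the reason for using Fejer means.
*)
Lemma cesaro_double (a : int -> R[i]) N :
  \sum_(j < N) \sum_(l < N) a (j%:Z - l%:Z) =
  \sum_(m < N) \sum_(i < m.*2.+1) a (i%:Z - m%:Z).
Proof.
elim: N => [|N IH]; first by rewrite !big_ord0.
rewrite [RHS]big_ord_recr /= -IH big_ord_recr /=.
rewrite (eq_bigr (fun j : 'I_N => \sum_(l < N) a (j%:Z - l%:Z) + a (j%:Z - N%:Z))); last first.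
  by move=> j _; rewrite big_ord_recr.
rewrite big_split /= -addrA; congr (_ + _).
have -> : N.*2.+1 = (N + N.+1)%N by rewrite -addnn addnS.
rewrite big_split_ord /=; congr (_ + _).
rewrite (reindex_inj rev_ord_inj) /=; apply: eq_bigr => i _; congr a.
by have := ltn_ord i; rewrite subSS PoszD; lia.
Qed.

Section Poisson.
Variables (k : nat) (g : R -> R -> R[i]) (B K M : R).
Hypothesis k0 : (0 < k)%N.
Hypothesis sg : cscont (fun p : R * R => g p.1 p.2).
Hypothesis bg : forall x y, cn (g x y) <= B.
Hypothesis pg : forall x y, g (x + 1) y = g x y.
Hypothesis qg : forall x y (q : int), g x (y + q%:~R) = expi (2 * pi * (k%:R * q%:~R * x)) * g x y.
Hypothesis lg : forall x x' y, 0 <= y <= 1 -> cn (g x y - g x' y) <= K * `|x - x'|.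
Hypothesis dg : forall y, cn (C1 (fun x => g x y)) <= M * wR y.

Let kR : R := k%:R.
Let kR0 : 0 < kR. Proof. by rewrite ltr0n. Qed.
Let kV0 : 0 <= kR^-1. Proof. by rewrite invr_ge0 ltW. Qed.
Let phi y := C1 (fun x => g x y).
(** The average of g over the 1/k-translates in x. It has the same Fejer means
as g, but is 1/k-periodic, so all the peaks of the kernel see the single value
at 0. *)
Let e x y := kR^-1%:C * \sum_(j < k) g (x + kR^-1 * j%:R) y.
Let E x : R[i] := expi (2 * pi * (kR * x)).
(** The Fejer kernel in the variable k x: nonnegative, of mean 1, and
concentrated on the points of (1/k)Z. *)
Let fej N x : R := N%:R^-1 * cn (\sum_(l < N) E x ^+ l) ^+ 2.

Let sgx y : cscont (fun x => g x y).
Proof.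
have [sr si] := sg; split=> u v uv.
  by apply: (sr (fun n => (u n, y)) (v, y)); apply: cvg_seq_pair => //; exact: cvg_cst.
by apply: (si (fun n => (u n, y)) (v, y)); apply: cvg_seq_pair => //; exact: cvg_cst.
Qed.
Let sgy x : cscont (g x).
Proof.
have [sr si] := sg; split=> u v uv.
  by apply: (sr (fun n => (x, u n)) (x, v)); apply: cvg_seq_pair => //; exact: cvg_cst.
by apply: (si (fun n => (x, u n)) (x, v)); apply: cvg_seq_pair => //; exact: cvg_cst.
Qed.
Let sphi : cscont phi.
Proof.
rewrite /phi; apply: cscont_ext (cscont_ci (adm01 R) (C := cst B)
   (F := fun y (v : 'rV[R]_1) => g (v 0 0) y) _ _ _) => [y|||y v].
- by rewrite cintegral1E.
- have [sr si] := sg.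
  have H (u : nat -> R * 'rV[R]_1) (p : R * 'rV[R]_1) : u n @[n --> \oo] --> p ->
      ((u n).2 0 0, (u n).1) @[n --> \oo] --> (p.2 0 0, p.1).
    move=> up; apply: cvg_seq_pair; last exact: cvg_seq_fst up.
    by have /cvg_rowP := cvg_seq_snd up; exact.
  by split=> u p up; [exact: (sr _ _ (H _ _ up))|exact: (si _ _ (H _ _ up))].
- exact: scont_cst.
- by rewrite wprod1 mulr1.
Qed.
Let bphi y : cn (phi y) <= 2 * B.
Proof. by apply: C1_bound. Qed.

Let sE : cscont E.
Proof.
by apply: cscont_expi; apply: scontM; [exact: scont_cst|apply: scontM; [exact: scont_cst|exact: scont_id]].
Qed.

Let sshift (f : R -> R[i]) s : cscont f -> cscont (fun x => f (x + s)).
Proof.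
move=> [sr si]; have H : scont (fun x : R => x + s) by apply: scontD; [exact: scont_id|exact: scont_cst].
by split; [exact: (scont_compl sr H)|exact: (scont_compl si H)].
Qed.

Let se y : cscont (fun x => e x y).
Proof.
by apply: cscontM; [exact: cscont_cst|apply: cscont_sum => j; exact: (sshift _ (sgx y))].
Qed.

Let kinv j x : E (x + kR^-1 * j%:R) = E x.
Proof.
have -> : E (x + kR^-1 * j%:R) = expi (2 * pi * (kR * x) + 2 * pi * j%:R).
  by congr expi; rewrite -[RHS]mulrDr; congr (_ * _); rewrite mulrDr mulVKf ?gt_eqF.
rewrite expiD; have := expi2piz R j; rewrite -pmulrn => ->; exact: mulr1.
Qed.

Let Eint (q : int) x : expi (2 * pi * (kR * q%:~R * x)) = E x ^ q.
Proof.
have H (n : nat) : expi (2 * pi * (kR * n%:R * x)) = E x ^+ n.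
  by rewrite -expiMn; congr expi; ring.
case: q => n; first by rewrite -pmulrn H.
by rewrite NegzE mulrNz -pmulrn mulrN mulNr mulrN expiN H conj_expX -exprnN.
Qed.

Let fejE N x : (fej N x)%:C =
  N%:R^-1 * \sum_(j < N) \sum_(l < N) E x ^ (j%:Z - l%:Z).
Proof.
rewrite /fej rmorphM fmorphV rmorph_nat; congr (_ * _).
rewrite rmorphXn /= -cnE sqr_normc rmorph_sum big_distrl; apply: eq_bigr => j _.
rewrite big_distrr /=; apply: eq_bigr => l _.
by rewrite expfzDr ?expi_neq0// -!exprnP -exprnN -conj_expX.
Qed.

Let cn_sq (z : R[i]) : cn z ^+ 2 = Re z ^+ 2 + Im z ^+ 2.
Proof. by apply: (@complexI R); rewrite rmorphXn /= -cnE add_Re2_Im2. Qed.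

Let sEX l : cscont (fun x => E x ^+ l).
Proof.
elim: l => [|l IH]; first by apply: cscont_ext (cscont_cst _ 1) => x.
by apply: cscont_ext (cscontM sE IH) => x; rewrite exprS.
Qed.

Let sEz (q : int) : cscont (fun x => E x ^ q).
Proof.
apply: cscont_ext (fun x => Eint q x) _; apply: cscont_expi.
by do 2 (apply: scontM; first exact: scont_cst); exact: scont_id.
Qed.

Let cnEz (q : int) x : cn (E x ^ q) = 1.
Proof. by rewrite -Eint cn_expi. Qed.

Let sfej N : scont (fej N).
Proof.
apply: scontM; first exact: scont_cst.
have [sr si] := cscont_sum (index_enum 'I_N) (fun l => sEX l).
by apply: scont_ext (scontD (scontM sr sr) (scontM si si)) => x; rewrite cn_sq !expr2.
Qed.

Let fej_ge0 N x : 0 <= fej N x.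
Proof. by rewrite mulr_ge0 ?invr_ge0 ?exprn_ge0 ?cn_ge0. Qed.

Let fej_le N x : fej N x <= N%:R.
Proof.
have H : cn (\sum_(l < N) E x ^+ l) <= N%:R.
  by rewrite -[leRHS]mulr1; apply: cn_sum_ord => l; rewrite exprnP cnEz.
case: N H => [|N] H; first by rewrite /fej invr0 mul0r.
rewrite /fej mulrC ler_pdivrMr ?ltr0n// -expr2 ler_pXn2r// nnegrE ?cn_ge0//.
Qed.

Let cnfej N x : cn (fej N x)%:C <= N%:R.
Proof. by rewrite cn_real ger0_norm. Qed.

Let K_ge0 : 0 <= K.
Proof.
have := @lg 1 0 0; rewrite lexx ler01 subr0 normr1 mulr1 => /(_ isT).
by apply: le_trans; exact: cn_ge0.
Qed.

Let C1_Ez (q : int) : C1 (fun x => E x ^ q) = (q == 0)%:R.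
Proof.
have -> : (fun x => E x ^ q) = (fun x => expi (2 * pi * ((k%:Z * q)%:~R * x))).
  by apply/funext => x; rewrite -Eint intrM -pmulrn.
by rewrite C1_expi mulf_eq0 -[k%:Z == 0]/(k == 0)%N (gtn_eqF k0).
Qed.

Let fej_test N (h : R -> R[i]) C : cscont h -> bounded_by C h ->
  C1 (fun x => (fej N x)%:C * h x) =
  N%:R^-1 * \sum_(j < N) \sum_(l < N) C1 (fun x => E x ^ (j%:Z - l%:Z) * h x).
Proof.
move=> sh bh.
have sT j l : cscont (fun x => E x ^ (j%:Z - l%:Z) * h x) by exact: cscontM.
have bT j l : bounded_by C (fun x => E x ^ (j%:Z - l%:Z) * h x).
  by move=> x; rewrite cnM cnEz mul1r.
have sT' (j : nat) : cscont (fun x => \sum_(l < N) E x ^ (j%:Z - l%:Z) * h x).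
  by apply: cscont_sum => l.
have bT' (j : nat) : bounded_by (N%:R * C) (fun x => \sum_(l < N) E x ^ (j%:Z - l%:Z) * h x).
  by move=> x; apply: cn_sum_ord => l; exact: bT.
under [in RHS]eq_bigr => j _ do rewrite -(C1_sum _ (fun l : 'I_N => sT j l) (fun l => bT j l)).
rewrite -(C1_sum _ (fun j : 'I_N => sT' j) (fun j => bT' j)).
rewrite -(C1Z _ (B := N%:R * (N%:R * C))).
- congr cintegral; apply/funext => x; rewrite fejE -mulrA; congr (_ * _).
  by rewrite big_distrl /=; apply: eq_bigr => j _; rewrite big_distrl.
- by apply: cscont_sum => j.
- by move=> x; apply: cn_sum_ord => j; exact: bT'.
Qed.

Let rint_fej N : (0 < N)%N -> rint I01 (fej N) = 1.
Proof.
move=> N0; apply: (@complexI R); rewrite -(C1_real (B := N%:R))//; last first.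
  by move=> x; rewrite fej_ge0 fej_le.
have -> : (fun x => (fej N x)%:C) = (fun x => (fej N x)%:C * 1).
  by apply/funext => x; rewrite mulr1.
rewrite (fej_test _ (C := 1)); last 2 first.
- exact: cscont_cst.
- by move=> x; rewrite cn1.
rewrite (eq_bigr (fun=> 1)) ?sumr_const ?card_ord ?mulVf ?pnatr_eq0 -?lt0n//.
move=> j _; rewrite (bigD1 j)//= big1 => [|l lj].
  have -> : (fun x => E x ^ (j%:Z - j%:Z) * 1) = (fun x => E x ^ (j%:Z - j%:Z)).
    by apply/funext => x; rewrite mulr1.
  by rewrite C1_Ez subrr eqxx addr0.
have -> : (fun x => E x ^ (j%:Z - l%:Z) * 1) = (fun x => E x ^ (j%:Z - l%:Z)).
  by apply/funext => x; rewrite mulr1.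
by rewrite C1_Ez subr_eq0 eqz_nat; case: eqP => // /val_inj jl; rewrite jl eqxx in lj.
Qed.

(** Off its peaks the kernel is of order 1/N, since the geometric sum telescopes
against E x - 1. *)
Let fej_peak N x : (0 < N)%N -> fej N x * cn (E x - 1) ^+ 2 <= 4 / N%:R.
Proof.
move=> N0; rewrite /fej -mulrA mulrC ler_wpM2r ?invr_ge0// -exprMn -cnM mulrC -subrX1.
have H : cn (E x ^+ N - 1) <= 2.
  by rewrite (le_trans (cnD _ _))// cnN cn1 exprnP cnEz.
by rewrite (_ : 4 = 2 ^+ 2) ?ler_pXn2r ?nnegrE ?cn_ge0//; rewrite expr2 -natrM.
Qed.

Let be x y : cn (e x y) <= B.
Proof.
rewrite cnM cn_real (ger0_norm kV0) ler_pdivrMl//.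
by apply: cn_sum_ord => j; exact: bg.
Qed.

Let fejg N y : C1 (fun x => (fej N x)%:C * g x y) = C1 (fun x => (fej N x)%:C * e x y).
Proof.
pose f x := (fej N x)%:C * g x y.
have sf : cscont f by apply: cscontM => //; exact: cscont_real.
have bf : bounded_by (N%:R * B) f by move=> x; rewrite cnM ler_pM ?cn_ge0.
have fejp j x : fej N (x + kR^-1 * j%:R) = fej N x by rewrite /fej kinv.
have pf x : f (x + 1) = f x.
  rewrite /f pg; congr (_%:C * _); rewrite -(fejp k x); congr (fej N (_ + _)).
  by rewrite mulVf// gt_eqF.
have -> : (fun x => (fej N x)%:C * e x y) =
    (fun x => kR^-1%:C * \sum_(j < k) f (x + kR^-1 * j%:R)).
  apply/funext => x; rewrite /e mulrCA; congr (_ * _); rewrite big_distrr /=.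
  by apply: eq_bigr => j _; rewrite /f fejp.
have bs (j : 'I_k) : bounded_by (N%:R * B) (fun x => f (x + kR^-1 * j%:R)) by move=> x; exact: bf.
have ss (j : 'I_k) : cscont (fun x => f (x + kR^-1 * j%:R)) by exact: (sshift _ sf).
rewrite (C1Z _ (B := k%:R * (N%:R * B))).
- rewrite (C1_sum _ ss bs) (eq_bigr (fun=> C1 f)); last first.
    by move=> j _; exact: (C1_shift _ sf bf pf).
  rewrite sumr_const card_ord -[C1 f *+ k]mulr_natl mulrA.
  by rewrite fmorphV rmorph_nat mulVf ?mul1r// pnatr_eq0 -lt0n.
- exact: cscont_sum.
- by move=> x; apply: cn_sum_ord => j; exact: bs.
Qed.

Let eper x y (q : int) : e (x + kR^-1 * q%:~R) y = e x y.
Proof.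
have step z : e (z + kR^-1) y = e z y.
  rewrite /e; congr (_ * _).
  have H (j : nat) : g (z + kR^-1 + kR^-1 * j%:R) y = g (z + kR^-1 * j.+1%:R) y.
    by congr (g _ _); rewrite -natr1 mulrDr mulr1 -addrA (addrC kR^-1).
  rewrite (eq_bigr (fun j : 'I_k => g (z + kR^-1 * j.+1%:R) y)); last by move=> j _; exact: H.
  apply/eqP; rewrite -subr_eq0 -sumrB.
  rewrite -(big_mkord xpredT (fun j => g (z + kR^-1 * j.+1%:R) y - g (z + kR^-1 * j%:R) y)).
  rewrite telescope_sumr// mulr0 addr0.
  have -> : kR^-1 * k%:R = 1 by apply: mulVf; rewrite gt_eqF.
  by rewrite pg subrr.
exact: (@per_shift R _ kR^-1 (e^~ y) q x step).
Qed.

(** The distance of x to (1/k)Z is measured by E x - 1, so that the Lipschitz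
condition can be integrated against the kernel with the help of fej_peak. *)
Let elip x y : 0 <= y <= 1 -> cn (e x y - e 0 y) <= (K / kR) * cn (E x - 1).
Proof.
move=> y01; have [j Hj] := expi_lower (kR * x).
pose r := x - kR^-1 * j%:~R.
have -> : e x y = e r y by rewrite -(eper r y j) /r subrK.
have H : cn (e r y - e 0 y) <= K * `|r|.
  rewrite /e -mulrBr -sumrB cnM cn_real (ger0_norm kV0) ler_pdivrMl//.
  apply: cn_sum_ord => i; apply: (le_trans (lg _ _ y01)).
  by rewrite opprD addrACA subrr addr0 subr0.
apply: (le_trans H); rewrite -mulrA ler_wpM2l//.
rewrite mulrC ler_pdivlMr// mulrC -{1}(ger0_norm (ltW kR0)) -normrM.
by rewrite /r mulrBr mulVKf ?gt_eqF.
Qed.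

(** On the kernel, cn (E x - 1) is bounded by eps + cn (E x - 1)^2 / eps; the
first term has mean eps and the second one is of order 1 / (N eps). *)
Let fej_e N y eps : (0 < N)%N -> 0 < eps -> 0 <= y <= 1 ->
  cn (C1 (fun x => (fej N x)%:C * g x y) - e 0 y) <= 2 * ((K / kR) * (eps + 4 / N%:R / eps)).
Proof.
move=> N0 e0 y01; rewrite fejg.
have -> : e 0 y = C1 (fun x => e 0 y * (fej N x)%:C).
  rewrite (C1Z _ (B := N%:R)) ?(C1_real (B := N%:R)) ?rint_fej ?mulr1//.
    by move=> x; rewrite fej_ge0 fej_le.
  exact: cscont_real.
have sfc : cscont (fun x => (fej N x)%:C) by exact: cscont_real.
rewrite -(C1B (B := N%:R * B) (B' := B * N%:R)); last 4 first.
- exact: cscontM.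
- by move=> x; rewrite cnM ler_pM ?cn_ge0.
- by apply: cscontM => //; exact: cscont_cst.
- by move=> x; rewrite cnM ler_pM ?cn_ge0.
have K'0 : 0 <= K / kR by exact: divr_ge0 K_ge0 (ltW kR0).
have eps0 := ltW e0.
have c0 : 0 <= 4 / N%:R / eps by apply: divr_ge0 => //; exact: divr_ge0.
have ef0 x : 0 <= eps * fej N x by exact: mulr_ge0.
have efN x : eps * fej N x <= eps * N%:R by exact: ler_wpM2l.
pose b x := (K / kR) * (eps * fej N x + 4 / N%:R / eps).
have sb : scont b.
  apply: scontM; first exact: scont_cst.
  apply: scontD; last exact: scont_cst.
  by apply: scontM; first exact: scont_cst.
apply: (@le_trans _ _ (2 * rint I01 b)).
  apply: (C1_le (B := (K / kR) * (eps * N%:R + 4 / N%:R / eps))) => //.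
  - apply: cscontB; first exact: cscontM.
    by apply: cscontM => //; exact: cscont_cst.
  - move=> x; rewrite [X in _ - X]mulrC -mulrBr cnM cn_real ger0_norm//.
    apply: (@le_trans _ _ (fej N x * ((K / kR) * cn (E x - 1)))).
      by rewrite ler_wpM2l// elip.
    rewrite mulrCA /b ler_wpM2l//.
    have := fej_peak x N0; set a := cn _; set F := fej N x; set c := 4 / N%:R => Fa.
    have F0 : 0 <= F by exact: fej_ge0.
    have Fa' : F * a ^+ 2 / eps <= c / eps by rewrite ler_wpM2r// invr_ge0 ltW.
    apply: le_trans (lerD (lexx _) Fa').
    have -> : eps * F + F * a ^+ 2 / eps = F * (eps + a ^+ 2 / eps) by ring.
    rewrite ler_wpM2l//.
    have a0 : 0 <= a by exact: cn_ge0.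
    rewrite -(ler_pM2r e0) mulrDl divfK ?gt_eqF//; nra.
  - by move=> x; rewrite /b ler_wpM2l// lerD2r.
rewrite ler_wpM2l//.
have dfej : dom1 (@w1 R) N%:R (fej N) by move=> x; rewrite mulr1 ger0_norm.
rewrite /b (rintZ (adm01 R) _ (M := eps * N%:R + 4 / N%:R / eps)); last 2 first.
- apply: scontD; last exact: scont_cst.
  by apply: scontM; first exact: scont_cst.
- by move=> x; rewrite mulr1 ger0_norm ?addr_ge0// lerD2r.
rewrite ler_wpM2l//.
rewrite (rintD (adm01 R) (M1 := eps * N%:R) (M2 := 4 / N%:R / eps)); last 4 first.
- by apply: scontM; first exact: scont_cst.
- exact: scont_cst.
- by move=> x; rewrite mulr1 ger0_norm.
- by move=> x; rewrite mulr1 ger0_norm.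
rewrite (rintZ (adm01 R) _ (@sfej N) dfej) rint_fej// mulr1 lerD2l.
have H : rint I01 (fun=> 4 / N%:R / eps) = 4 / N%:R / eps.
  exact: (congr1 (@complex.Re R) (C1_cst (4 / N%:R / eps)%:C)).
by rewrite H.
Qed.

Let a (q : int) : R[i] := C1 (fun y => phi (y + q%:~R)).
Let T N : R[i] := N%:R^-1 * \sum_(j < N) \sum_(l < N) a (j%:Z - l%:Z).

Let sphis (q : int) : cscont (fun y : R => phi (y + q%:~R)). Proof. exact: (sshift _ sphi). Qed.

Let TE N : T N = C1 (fun y => C1 (fun x => (fej N x)%:C * g x y)).
Proof.
have phiE (q : int) y : phi (y + q%:~R) = C1 (fun x => E x ^ q * g x y).
  by rewrite /phi; congr cintegral; apply/funext => x; rewrite qg Eint.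
have -> : (fun y => C1 (fun x => (fej N x)%:C * g x y)) =
    (fun y => N%:R^-1 * \sum_(j < N) \sum_(l < N) phi (y + (j%:Z - l%:Z)%:~R)).
  apply/funext => y; rewrite (fej_test _ (sgx y) (fun x => bg x y)); congr (_ * _).
  by apply: eq_bigr => j _; apply: eq_bigr => l _; rewrite phiE.
have bT (j l : nat) : bounded_by (2 * B) (fun y : R => phi (y + (j%:Z - l%:Z)%:~R)) by move=> y; exact: bphi.
have sT' (j : nat) : cscont (fun y : R => \sum_(l < N) phi (y + (j%:Z - l%:Z)%:~R)).
  by apply: cscont_sum => l.
have bT' (j : nat) : bounded_by (N%:R * (2 * B)) (fun y => \sum_(l < N) phi (y + (j%:Z - l%:Z)%:~R)).
  by move=> y; apply: cn_sum_ord => l; exact: bT.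
rewrite (C1Z _ (B := N%:R * (N%:R * (2 * B)))); last 2 first.
- by apply: cscont_sum => j.
- by move=> y; apply: cn_sum_ord => j; exact: bT'.
rewrite (C1_sum _ (fun j : 'I_N => sT' j) (fun j => bT' j)); congr (_ * _).
apply: eq_bigr => j _.
by rewrite (C1_sum _ (fun l : 'I_N => sphis (j%:Z - l%:Z)) (fun l => bT j l)).
Qed.

Let sey x : cscont (e x).
Proof.
apply: cscontM; first exact: cscont_cst.
by apply: cscont_sum => j; exact: sgy.
Qed.

Let T_e N eps : (0 < N)%N -> 0 < eps ->
  cn (T N - C1 (e 0)) <= 4 * ((K / kR) * (eps + 4 / N%:R / eps)).
Proof.
move=> N0 e0; rewrite TE.
have sS : cscont (fun y => C1 (fun x => (fej N x)%:C * g x y)).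
  apply: cscont_ext (cscont_ci (adm01 R) (C := cst (N%:R * B))
    (F := fun y (v : 'rV[R]_1) => (fej N (v 0 0))%:C * g (v 0 0) y) _ _ _) => [y|||y v].
  - by rewrite cintegral1E.
  - have H (u : nat -> R * 'rV[R]_1) (p : R * 'rV[R]_1) : u n @[n --> \oo] --> p ->
        ((u n).2 0 0, (u n).1) @[n --> \oo] --> (p.2 0 0, p.1).
      move=> up; apply: cvg_seq_pair; last exact: cvg_seq_fst up.
      by have /cvg_rowP := cvg_seq_snd up; exact.
    apply: cscontM.
      apply: cscont_real => u p up; apply: sfej.
      exact: (cvg_seq_fst (H _ _ up)).
    have [sr si] := sg.
    by split=> u p up; [exact: (sr _ _ (H _ _ up))|exact: (si _ _ (H _ _ up))].
  - exact: scont_cst.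
  - by rewrite wprod1 mulr1 cnM ler_pM ?cn_ge0.
rewrite -(C1B (B := 2 * (N%:R * B)) (B' := B)) //; last first.
- move=> y; apply: C1_bound; first by apply: cscontM => //; exact: cscont_real.
  by move=> x _; rewrite cnM ler_pM ?cn_ge0.
rewrite [leRHS](_ : _ = 2 * (2 * ((K / kR) * (eps + 4 / N%:R / eps)))); last by ring.
apply: C1_bound; first exact: cscontB.
by move=> y y01; exact: fej_e.
Qed.

(** Stated for a real-linear projection P (the real or the imaginary part),
since the convergence theorems are about real sequences: the symmetric partial
sums converge, so their Cesaro means have the same limit, and these are the
Fejer means. *)
Let proj_lim (P : R[i] -> R) (z : R[i]) :
  (forall z t, P (z + t) = P z + P t) -> (forall z t, P (z - t) = P z - P t) ->
  (forall N z, P (N%:R^-1 * z) = N%:R^-1 * P z) ->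
  (forall z, `|P z| <= cn z) ->
  P (\sum_(i < m.*2.+1) a (i%:Z - m%:Z)) @[m --> \oo] --> P z ->
  P z = P (C1 (e 0)).
Proof.
move=> PD PB PV Pn Pz.
have P0 : P 0 = 0 by have := PB 0 0; rewrite !subrr.
have Psum n (F : nat -> R[i]) : P (\sum_(i < n) F i) = \sum_(i < n) P (F i).
  elim: n => [|n IH]; first by rewrite !big_ord0 P0.
  by rewrite !big_ord_recr /= PD IH.
have := cesaro Pz; rewrite /arithmetic_mean /= => cz.
move: cz; set v := (X in X @ \oo --> _) => cz.
suff H : v @ \oo --> P (C1 (e 0)) by rewrite -(cvg_lim _ cz)// (cvg_lim _ H).
rewrite /v {v cz}.
apply/cvgrPdist_le => eta eta0.
pose K' := 4 * (K / kR) + 1.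
have K'0 : 0 < K' by rewrite ltr_wpDl// mulr_ge0//; exact: divr_ge0 K_ge0 (ltW kR0).
pose eps := eta / (2 * K').
have e0 : 0 < eps by rewrite divr_gt0// mulr_gt0.
have d0 : 0 < eps ^+ 2 / 4 by rewrite divr_gt0// exprn_gt0.
have := @cvg_harmonic R; rewrite /harmonic => /cvgrPdist_le /(_ _ d0); apply: filterS => n.
rewrite sub0r normrN ger0_norm ?invr_ge0// => hn.
have -> : n.+1%:R^-1 * series (fun m => P (\sum_(i < m.*2.+1) a (i%:Z - m%:Z))) n.+1 = P (T n.+1).
  rewrite /T PV /series /= big_mkord cesaro_double; congr (_ * _).
  symmetry; exact: (Psum _ (fun m : nat => \sum_(i < m.*2.+1) a (i%:Z - m%:Z))).
rewrite distrC -PB (le_trans (Pn _))// (le_trans (T_e _ e0))//.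
apply: (@le_trans _ _ (4 * (K / kR) * (2 * eps))).
  rewrite -[leRHS]mulrA ler_wpM2l// ler_wpM2l//; first exact: divr_ge0 K_ge0 (ltW kR0).
  rewrite (_ : 2 * eps = eps + eps); last ring.
  rewrite lerD2l ler_pdivrMr//.
  rewrite -expr2 mulrC -ler_pdivlMr// (le_trans hn)//.
apply: (@le_trans _ _ (K' * (2 * eps))).
  have e2 : 0 <= 2 * eps by rewrite mulr_ge0// ltW.
  by apply: ler_wpM2r => //; rewrite /K' lerDl.
have -> // : K' * (2 * eps) = eta.
by rewrite /eps; field; rewrite gt_eqF.
Qed.

(** The left-hand side is the limit of the integrals of phi over [-m, m+1], that
is of the symmetric sums of its integer translates; by quasi-periodicity these
translates are the Fourier coefficients of g in k x, and their Fejer means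
converge to the average of g over the k-torsion points. *)
Lemma poisson_dim1 : cintegral setT phi = (kR^-1)%:C * \sum_(j < k) C1 (g (kR^-1 * j%:R)).
Proof.
have -> : (kR^-1)%:C * \sum_(j < k) C1 (g (kR^-1 * j%:R)) = C1 (e 0).
  rewrite -(C1_sum _ (fun j : 'I_k => sgy (kR^-1 * j%:R)) (fun j y => bg _ y)).
  rewrite -(C1Z _ (B := k%:R * B)).
  - congr cintegral; apply/funext => y; rewrite /e; congr (_ * _).
    by apply: eq_bigr => j _; rewrite add0r.
  - by apply: cscont_sum => j.
  - by move=> y; apply: cn_sum_ord.
have [sr si] := sphi.
have dr : dom1 (@wR R) M (fun y => Re (phi y)) by move=> y; exact: le_trans (cn_Re _) (dg y).
have di : dom1 (@wR R) M (fun y => Im (phi y)) by move=> y; exact: le_trans (cn_Im _) (dg y).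
apply: ReImP.
  apply: proj_lim.
  - by move=> z t; rewrite cReD.
  - by move=> z t; rewrite cReD cReN.
  - by move=> N z; rewrite -(rmorph_nat (real_complex R)) -fmorphV cReM /= mul0r subr0.
  - exact: cn_Re.
  apply: cvg_ext (rint_lim sr dr) => m; rewrite (rint_itv_sum _ (scont_continuous sr)).
  elim/big_ind2 : _ => //; first by move=> x1 x2 y1 y2 <- <-; rewrite cReD.
  by move=> i _; congr rint; apply/funext => y; rewrite intrD mulrNz -!pmulrn.
apply: proj_lim.
- by move=> z t; rewrite cImD.
- by move=> z t; rewrite cImD cImN.
- by move=> N z; rewrite -(rmorph_nat (real_complex R)) -fmorphV cImM /= mul0r addr0.
- exact: cn_Im.
apply: cvg_ext (rint_lim si di) => m; rewrite (rint_itv_sum _ (scont_continuous si)).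
elim/big_ind2 : _ => //; first by move=> x1 x2 y1 y2 <- <-; rewrite cImD.
by move=> i _; congr rint; apply/funext => y; rewrite intrD mulrNz -!pmulrn.
Qed.

End Poisson.
End Poisson1.

(** * Poisson summation in several variables *)

Section Poisson.
Variable R : realType.
Local Notation I01 := (`[0, 1]%classic : set R).
Local Notation C1 := (cintegral I01).

(** The average over the torsion points of order k, iterated in the same order
as the integrals. *)
Fixpoint cavg (k : nat) (N : nat) : ('rV[R]_N -> R[i]) -> R[i] :=
  match N with
  | 0 => fun f => f 0
  | N'.+1 => fun f => (k%:R^-1)%:C *
      \sum_(j < k) cavg k (fun v : 'rV[R]_N' => f (rcons1 (k%:R^-1 * j%:R) v))
  end.

Lemma cavgZ k N c (f : 'rV[R]_N -> R[i]) : cavg k (fun v => c * f v) = c * cavg k f.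
Proof.
elim: N f => [//|N IH] f /=; rewrite mulrCA; congr (_ * _).
by rewrite big_distrr /=; apply: eq_bigr => j _; rewrite IH.
Qed.

Lemma cavg_sum k N (I : Type) (r : seq I) (F : I -> 'rV[R]_N -> R[i]) :
  cavg k (fun v => \sum_(i <- r) F i v) = \sum_(i <- r) cavg k (F i).
Proof.
elim: N F => [//|N IH] F /=; rewrite -big_distrr /=; congr (_ * _).
by rewrite exchange_big /=; apply: eq_bigr => j _; rewrite IH.
Qed.

(** The hypotheses of Poisson summation in a form stable under integrating out
one pair of coordinates. Lipschitz continuity is only asked for y_i in [0, 1],
since quasi-periodicity makes the constant grow with y. *)
Record poisson_class k n (G : 'rV[R]_n -> 'rV[R]_n -> R[i]) (B K M : R) : Prop := PoissonClass {
  pc_cont : cscont (fun p : 'rV[R]_n * 'rV[R]_n => G p.1 p.2);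
  pc_bnd : forall x y, cn (G x y) <= B;
  pc_per : forall (l : 'rV[int]_n) (x y : 'rV[R]_n), G (x + map_mx intr l) y = G x y;
  pc_quasi : forall (l : 'rV[int]_n) (x y : 'rV[R]_n), G x (y + map_mx intr l) =
     expi (2 * pi * (k%:R * \sum_i (l 0 i)%:~R * x 0 i)) * G x y;
  pc_lip : forall (i : 'I_n) (s : R) (x y : 'rV[R]_n), 0 <= y 0 i <= 1 ->
     cn (G (x + s *: delta_mx 0 i) y - G x y) <= K * `|s|;
  pc_dec : forall y, cn (integral_unit_cube (fun x => G x y)) <= M * wprod (@wR R) y }.

Lemma ci01Z N c B (f : 'rV[R]_N -> R[i]) : cscont f -> bounded_by B f ->
  integral_unit_cube (fun v => c * f v) = c * integral_unit_cube f.
Proof. by move=> sf bf; apply: (ciZ (adm01 R)); exact: cok01 bf. Qed.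

Lemma ci01B N B B' (f g : 'rV[R]_N -> R[i]) : cscont f -> bounded_by B f ->
  cscont g -> bounded_by B' g ->
  integral_unit_cube (fun v => f v - g v) = integral_unit_cube f - integral_unit_cube g.
Proof.
by move=> sf bf sg bg; apply: (ciB (adm01 R)); [exact: cok01 bf|exact: cok01 bg].
Qed.

Lemma ci01_sum N (I : Type) (r : seq I) (B : I -> R) (F : I -> 'rV[R]_N -> R[i]) :
  (forall i, cscont (F i)) -> (forall i, bounded_by (B i) (F i)) ->
  integral_unit_cube (fun v => \sum_(i <- r) F i v) = \sum_(i <- r) integral_unit_cube (F i).
Proof. by move=> sF bF; apply: (ci_sum (adm01 R)) => i; exact: cok01 (bF i). Qed.

Lemma cscont_ci01 (T : topologicalType) N B (F : T -> 'rV[R]_N -> R[i]) :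
  cscont (fun p : T * 'rV[R]_N => F p.1 p.2) -> (forall t v, cn (F t v) <= B) ->
  cscont (fun t => integral_unit_cube (F t)).
Proof.
move=> sF bF; apply: (cscont_ci (adm01 R) (C := cst B)) => //; first exact: scont_cst.
by move=> t v; rewrite wprod1 mulr1.
Qed.

Lemma cscont_C1 (T : topologicalType) B (F : T -> R -> R[i]) :
  cscont (fun p : T * R => F p.1 p.2) -> (forall t v, cn (F t v) <= B) ->
  cscont (fun t => C1 (F t)).
Proof.
move=> sF bF; apply: cscont_ext (cscont_ci01 (F := fun t (v : 'rV[R]_1) => F t (v 0 0)) (B := B) _ _).
- by move=> t; rewrite cintegral1E.
- have H (u : nat -> T * 'rV[R]_1) (p : T * 'rV[R]_1) : u n @[n --> \oo] --> p ->
      ((u n).1, (u n).2 0 0) @[n --> \oo] --> (p.1, p.2 0 0).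
    move=> up; apply: cvg_seq_pair; first exact: cvg_seq_fst up.
    by have /cvg_rowP := cvg_seq_snd up; exact.
  have [sr si] := sF.
  by split=> u p up; [exact: (sr _ _ (H _ _ up))|exact: (si _ _ (H _ _ up))].
- by move=> t v.
Qed.

Lemma C1_ci01 N B (F : R -> 'rV[R]_N -> R[i]) :
  cscont (fun p : R * 'rV[R]_N => F p.1 p.2) -> (forall x v, cn (F x v) <= B) ->
  C1 (fun x => integral_unit_cube (F x)) = integral_unit_cube (fun v => C1 (fun x => F x v)).
Proof.
move=> sF bF; rewrite cintegral1E.
under [in RHS]eq_fun do rewrite cintegral1E.
apply: (ci01_fubini (B := B) (F := fun (x : 'rV[R]_1) v => F (x 0 0) v)); last by move=> x v.
have H (u : nat -> 'rV[R]_1 * 'rV[R]_N) (p : 'rV[R]_1 * 'rV[R]_N) : u n @[n --> \oo] --> p ->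
    ((u n).1 0 0, (u n).2) @[n --> \oo] --> (p.1 0 0, p.2).
  move=> up; apply: cvg_seq_pair; last exact: cvg_seq_snd up.
  by have /cvg_rowP := cvg_seq_fst up; exact.
have [sr si] := sF.
by split=> u p up; [exact: (sr _ _ (H _ _ up))|exact: (si _ _ (H _ _ up))].
Qed.

Lemma delta_S_shift n (x : R) (v : 'rV[R]_n) s (i : 'I_n) :
  rcons1 x (v + s *: delta_mx 0 i) = rcons1 x v + s *: delta_mx 0 (lift ord0 i).
Proof. by rewrite delta_lift rcons1Z rcons1D mulr0 addr0. Qed.

Lemma cvg_seq_entry N (u : nat -> 'rV[R]_N) (v : 'rV[R]_N) i :
  u n @[n --> \oo] --> v -> u n 0 i @[n --> \oo] --> v 0 i.
Proof. by move=> /cvg_rowP. Qed.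

Lemma cscont_seq (T U : topologicalType) (f : U -> R[i]) (g : T -> U) : cscont f ->
  (forall (u : nat -> T) p, u n @[n --> \oo] --> p -> g (u n) @[n --> \oo] --> g p) ->
  cscont (fun p => f (g p)).
Proof. by move=> [sr si] sg; split=> u p up; [apply: sr|apply: si]; exact: sg. Qed.

(** Closes the convergence goals left when a continuous function is precomposed
with a rearrangement of coordinates. *)
Ltac seq_cvg := let u := fresh "u" in let p := fresh "p" in let up := fresh "up" in
  move=> u p up /=;
  repeat first [exact: up | exact: cvg_cst | apply: cvg_seq_pair | apply: cvg_rcons1 |
    apply: cvg_seq_fst | apply: cvg_seq_snd | apply: cvg_seq_entry].

(** Poisson summation in Zak form. The integral over y_1 in R and x_1 in [0, 1]
is replaced by a torsion average in x_1 and an integral over y_1 in [0, 1]; the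
resulting function G' of the other variables is again in the class, with other
constants. *)
Lemma poisson_sum k n (G : 'rV[R]_n -> 'rV[R]_n -> R[i]) B K M : (0 < k)%N ->
  poisson_class k G B K M ->
  integral_Rn (fun y => integral_unit_cube (fun x => G x y)) =
  cavg k (fun x => integral_unit_cube (fun y => G x y)).
Proof.
move=> k0; elim: n G B K M => [//|n IH] G B K M pc.
have kn0 : k%:R != 0 :> R by rewrite pnatr_eq0 -lt0n.
pose G4 (q : (R * R) * ('rV[R]_n * 'rV[R]_n)) := G (rcons1 q.1.1 q.2.1) (rcons1 q.1.2 q.2.2).
have sG4 : cscont G4.
  by apply: (cscont_seq (g := fun q : (R * R) * ('rV[R]_n * 'rV[R]_n) =>
     (rcons1 q.1.1 q.2.1, rcons1 q.1.2 q.2.2)) (pc_cont pc)); seq_cvg.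
have bG4 q : cn (G4 q) <= B by exact: pc_bnd pc _ _.
pose g (y' : 'rV[R]_n) (x1 y1 : R) := integral_unit_cube (fun x' : 'rV[R]_n => G4 ((x1, y1), (x', y'))).
pose G' (x' y' : 'rV[R]_n) := (k%:R^-1)%:C *
  \sum_(j < k) C1 (fun y1 => G4 ((k%:R^-1 * j%:R, y1), (x', y'))).
have scst (T U : topologicalType) (c : U) (u : nat -> T) (p : T) : u n @[n --> \oo] --> p ->
  (fun=> c) (u n) @[n --> \oo] --> c by move=> _; exact: cvg_cst.
have P1 y' : cintegral setT (fun y1 => C1 (fun x1 => g y' x1 y1)) =
    (k%:R^-1)%:C * \sum_(j < k) C1 (g y' (k%:R^-1 * j%:R)).
  apply: (@poisson_dim1 R k (g y') (2 * B) (2 * K) (M * wprod (@wR R) y')) => //.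
  - apply: (cscont_ci01 (B := B) (F := fun (p : R * R) x' => G4 (p, (x', y')))); last by move=> *.
    by apply: (cscont_seq sG4); seq_cvg.
  - move=> x y; apply: ci01_bound => //.
    by apply: (cscont_seq sG4); seq_cvg.
  - move=> x y; congr integral_cube; apply/funext => x'.
    rewrite /G4 /= -[RHS](pc_per pc (izcons 1 0)) map_izcons rcons1D.
    by congr (G (rcons1 _ _) _); apply/rowP => i; rewrite !mxE addr0.
  - move=> x y q; rewrite /g -(ci01Z _ (B := B)); last 2 first.
    + by apply: (cscont_seq sG4); seq_cvg.
    + by move=> x'.
    congr integral_unit_cube; apply/funext => x'.
    have := pc_quasi pc (izcons q 0) (rcons1 x x') (rcons1 y y').
    rewrite map_izcons rcons1D /G4 /=.
    have -> : y' + map_mx intr (0 : 'rV[int]_n) = y' by apply/rowP => i; rewrite !mxE addr0.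
    move=> ->; congr (expi (_ * _) * _); rewrite big_ord_recl big1 => [|i _].
      by rewrite addr0 rcons1_0 mxE unlift_none mulrA.
    by rewrite mxE liftK mxE mul0r.
  - move=> x x2 y y01; rewrite /g -(ci01B (B := B) (B' := B)) //; last 2 first.
    + by apply: (cscont_seq sG4); seq_cvg.
    + by apply: (cscont_seq sG4); seq_cvg.
    rewrite -mulrA; apply: ci01_bound.
      apply: cscontB.
        by apply: (cscont_seq sG4); seq_cvg.
      by apply: (cscont_seq sG4); seq_cvg.
    move=> x'; have := @pc_lip _ _ _ _ _ _ pc ord0 (x - x2) (rcons1 x2 x') (rcons1 y y').
    rewrite rcons1_0 delta_0 rcons1Z rcons1D scaler0 addr0.
    by rewrite (_ : x2 + (x - x2) * 1 = x); [apply|ring].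
  - move=> y; rewrite -[leRHS]mulrA (mulrC (wprod _ _)) -wprod_rcons1.
    exact: pc_dec pc (rcons1 y y').
have E1 : (fun y' => cintegral setT (fun y1 => C1 (fun x1 => g y' x1 y1))) =
    (fun y' => integral_unit_cube (fun x' => G' x' y')).
  apply/funext => y'; rewrite P1 /G'.
  have sj (j : nat) : cscont (fun q : R * 'rV[R]_n => G4 ((k%:R^-1 * j%:R, q.1), (q.2, y'))).
    by apply: (cscont_seq sG4); seq_cvg.
  have sj' (j : nat) : cscont (fun x' => C1 (fun y1 => G4 ((k%:R^-1 * j%:R, y1), (x', y')))).
    apply: (cscont_C1 (F := fun x' y1 => G4 ((k%:R^-1 * j%:R, y1), (x', y'))) (B := B)) => //.
    by apply: (cscont_seq sG4); seq_cvg.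
  have bj' (j : nat) : bounded_by (2 * B) (fun x' => C1 (fun y1 => G4 ((k%:R^-1 * j%:R, y1), (x', y')))).
    move=> x'; apply: C1_bound => //.
    by apply: (cscont_seq sG4); seq_cvg.
  rewrite (ci01Z _ (B := k%:R * (2 * B))); last 2 first.
  - by apply: cscont_sum => j.
  - by move=> x'; apply: cn_sum_ord => j; exact: bj'.
  rewrite (ci01_sum _ (fun j : 'I_k => sj' j) (fun j => bj' j)); congr (_ * _).
  apply: eq_bigr => j _; rewrite /g (C1_ci01 (B := B) (F := fun y1 x' => G4 ((k%:R^-1 * j%:R, y1), (x', y')))) //.
have sGxy : cscont (fun p : 'rV[R]_n * ('rV[R]_n * R) => \sum_(j < k) G4 ((k%:R^-1 * j%:R, p.2.2), (p.1, p.2.1))).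
  apply: cscont_sum => j.
  by apply: (cscont_seq sG4); seq_cvg.
have sC1 (j : nat) : cscont (fun p : 'rV[R]_n * 'rV[R]_n => C1 (fun y1 => G4 ((k%:R^-1 * j%:R, y1), p))).
  apply: (cscont_C1 (F := fun p y1 => G4 ((k%:R^-1 * j%:R, y1), p)) (B := B)) => //.
  by apply: (cscont_seq sG4); seq_cvg.
have sy1 x1 x' y' : cscont (fun y1 => G4 ((x1, y1), (x', y'))).
  by apply: (cscont_seq sG4); seq_cvg.
have kmean (F : 'I_k -> R[i]) C : (forall j, cn (F j) <= C) -> cn ((k%:R^-1)%:C * \sum_j F j) <= C.
  move=> FC; rewrite cnM cn_real ger0_norm ?invr_ge0// ler_pdivrMl ?ltr0n//.
  exact: cn_sum_ord.
have pc' : poisson_class k G' (2 * B) (2 * K) (2 * (M * rint setT (@wR R))).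
  split.
  - by apply: cscontM; [exact: cscont_cst|apply: cscont_sum => j; exact: (sC1 j)].
  - by move=> x y; apply: kmean => j; apply: C1_bound.
  - move=> l x y; rewrite /G'; congr (_ * _); apply: eq_bigr => j _; congr cintegral; apply/funext => y1.
    by rewrite /G4 /= -[RHS](pc_per pc (izcons 0 l)) map_izcons rcons1D mulr0z addr0.
  - move=> l x y; rewrite /G' mulrCA; congr (_ * _); rewrite big_distrr /=; apply: eq_bigr => j _.
    rewrite -(C1Z _ (B := B)) //; congr cintegral; apply/funext => y1.
    have := pc_quasi pc (izcons 0 l) (rcons1 (k%:R^-1 * j%:R) x) (rcons1 y1 y).
    rewrite map_izcons rcons1D mulr0z addr0 /G4 /= => ->.
    congr (expi (_ * (_ * _)) * _); rewrite big_ord_recl mxE unlift_none mul0r add0r.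
    by apply: eq_bigr => i _; rewrite mxE liftK rcons1_S.
  - move=> i s x y y01; rewrite /G' -mulrBr -sumrB; apply: kmean => j.
    rewrite -(C1B (B := B) (B' := B)) // -mulrA; apply: C1_bound; first exact: cscontB.
    move=> y1 _; rewrite /G4 /= delta_S_shift.
    by apply: (pc_lip pc); rewrite rcons1_S.
  - move=> y; have := congr1 (fun f => f y) E1 => /= <-.
    rewrite cintegral1E.
    have sphi : cscont (fun v : 'rV[R]_1 => C1 (fun x1 => g y x1 (v 0 0))).
      apply: (cscont_C1 (F := fun (v : 'rV[R]_1) x1 => g y x1 (v 0 0)) (B := 2 * B)).
        apply: (cscont_ci01 (B := B) (F := fun (p : 'rV[R]_1 * R) x' => G4 ((p.2, p.1 0 0), (x', y)))) => //.
        by apply: (cscont_seq sG4); seq_cvg.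
      move=> v x1; apply: ci01_bound; last by move=> x'; exact: bG4.
      by apply: (cscont_seq sG4); seq_cvg.
    have := ci_bound (admR R) (M := M * wprod (@wR R) y) sphi.
    rewrite expr1 => H; apply: (le_trans (H _)).
      move=> v; rewrite /wprod big_ord1 -mulrA (mulrC (\prod_i _)) -/(wprod _ y) -wprod_rcons1.
      exact: pc_dec pc (rcons1 (v 0 0) y).
    by rewrite [leLHS](_ : _ = 2 * (M * rint setT (@wR R)) * wprod (@wR R) y)//; ring.
transitivity (integral_Rn (fun y' => integral_unit_cube (fun x' => G' x' y'))).
  rewrite -E1 /integral_Rn.
  have H : integral_cube setT (fun y : 'rV[R]_n.+1 => integral_unit_cube (fun x => G x y)) =
     integral_cube setT (fun y1 : 'rV[R]_1 => integral_cube setT (fun y' : 'rV[R]_n => C1 (fun x1 => g y' x1 (y1 0 0)))).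
    transitivity (cintegral setT (fun y1 => integral_cube setT (fun y' : 'rV[R]_n => C1 (fun x1 => g y' x1 y1)))); first exact: erefl.
    exact: cintegral1E.
  rewrite H; under [in RHS]eq_fun do rewrite cintegral1E.
  apply: (ci_fubini (M := M) (admR R) (admR R)
    (F := fun (y1 : 'rV[R]_1) y' => C1 (fun x1 => g y' x1 (y1 0 0)))).
    apply: (cscont_C1 (F := fun (p : 'rV[R]_1 * 'rV[R]_n) x1 => g p.2 x1 (p.1 0 0)) (B := 2 * B)).
      apply: (cscont_ci01 (B := B) (F := fun (p : ('rV[R]_1 * 'rV[R]_n) * R) x' => G4 ((p.2, p.1.1 0 0), (x', p.1.2)))); last by move=> *; exact: bG4.
      by apply: (cscont_seq sG4); seq_cvg.
    move=> v x1; apply: ci01_bound; last by move=> x'; exact: bG4.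
    by apply: (cscont_seq sG4); seq_cvg.
  move=> y1 y'; rewrite /(wprod _ y1) big_ord1 -mulrA -wprod_rcons1.
  exact: pc_dec pc (rcons1 (y1 0 0) y').
rewrite (IH _ _ _ _ pc') /= -cavg_sum -cavgZ; congr cavg; apply/funext => x'.
have sxy (j : nat) : cscont (fun p : 'rV[R]_n * R => G4 ((k%:R^-1 * j%:R, p.2), (x', p.1))).
  by apply: (cscont_seq sG4); seq_cvg.
have sC (j : nat) : cscont (fun y' => C1 (fun y1 => G4 ((k%:R^-1 * j%:R, y1), (x', y')))).
  by apply: (cscont_C1 (F := fun y' y1 => G4 ((k%:R^-1 * j%:R, y1), (x', y'))) (B := B) (sxy j)).
have bC (j : nat) : bounded_by (2 * B) (fun y' => C1 (fun y1 => G4 ((k%:R^-1 * j%:R, y1), (x', y')))).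
  by move=> y'; apply: C1_bound.
rewrite /G' (ci01Z _ (B := k%:R * (2 * B))); last 2 first.
- by apply: cscont_sum => j.
- by move=> y'; apply: cn_sum_ord => j; exact: bC.
rewrite (ci01_sum _ (fun j : 'I_k => sC j) (fun j => bC j)); congr (_ * _).
apply: eq_bigr => j _.
rewrite -(C1_ci01 (B := B) (F := fun y1 y' => G4 ((k%:R^-1 * j%:R, y1), (x', y')))) //.
by apply: (cscont_seq sG4); seq_cvg.
Qed.

End Poisson.

(** * Calculus of smooth functions *)

Section SmoothCalculus.
Variable R : realType.
Local Notation Re := complex.Re.
Local Notation Im := complex.Im.

Lemma smooth_coind N (P : ('rV[R]_N -> R[i]) -> Prop) :
  (forall f, P f -> forall u, cdifferentiable f u) ->
  (forall f i, P f -> P (pd i f)) -> forall f, P f -> smooth f.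
Proof.
move=> Pd Ppd f Pf s u; apply: Pd; elim: s => [//|i s IH]; exact: Ppd.
Qed.

Lemma cdiff_continuous N (f : 'rV[R]_N -> R[i]) : (forall u, cdifferentiable f u) -> cscont f.
Proof.
move=> df; split; apply: continuous_scont => u; have [d1 d2] := df u;
  exact: differentiable_continuous.
Qed.

Lemma smooth_cscont N (f : 'rV[R]_N -> R[i]) : smooth f -> cscont f.
Proof. by move=> sf; apply: cdiff_continuous => u; exact: (sf [::]). Qed.

Lemma smooth_cderivable N (f : 'rV[R]_N -> R[i]) i : smooth f -> cderivable i f.
Proof. by move=> sf u; have [d1 d2] := sf [::] u; split; exact: diff_derivable. Qed.

Lemma smooth0 N : smooth (fun _ : 'rV[R]_N => 0).
Proof. exact: smooth_cst. Qed.

Lemma smooth_sum N (I : Type) (r : seq I) (F : I -> 'rV[R]_N -> R[i]) :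
  (forall i, smooth (F i)) -> smooth (fun v => \sum_(i <- r) F i v).
Proof.
move=> sF; elim: r => [|i r IH].
  by rewrite (_ : (fun v => _) = (fun=> 0)); [exact: smooth0|apply/funext => v; rewrite big_nil].
rewrite (_ : (fun v => _) = F i + (fun v => \sum_(j <- r) F j v)); first exact: smoothD.
by apply/funext => v; rewrite big_cons.
Qed.

Lemma smooth_prod N (I : Type) (r : seq I) (F : I -> 'rV[R]_N -> R[i]) :
  (forall i, smooth (F i)) -> smooth (fun v => \prod_(i <- r) F i v).
Proof.
move=> sF; elim: r => [|i r IH].
  by rewrite (_ : (fun v => _) = (fun=> 1)); [exact: smooth_cst|apply/funext => v; rewrite big_nil].
rewrite (_ : (fun v => _) = F i * (fun v => \prod_(j <- r) F j v)); first exact: smoothM.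
by apply/funext => v; rewrite big_cons.
Qed.

Lemma derive_coord N (i j : 'I_N) (u : 'rV[R]_N) :
  'D_(delta_mx 0 i) (fun w : 'rV[R]_N => w 0 j) u = (j == i)%:R.
Proof.
rewrite /derive (_ : (fun h : R => _) = fun h => h^-1 * (h * (j == i)%:R)); last first.
  by apply/funext => h /=; rewrite !mxE eqxx /= addrK.
apply/cvg_lim => //; apply: cvg_near_cst; near=> h.
by rewrite mulKf//; near: h; exact: nbhs_dnbhs_neq.
Unshelve. all: by end_near. Qed.

Lemma smooth_coord N (j : 'I_N) : smooth (fun w : 'rV[R]_N => (w 0 j)%:C).
Proof.
apply: smooth_by_pd => [u|i].
  by split; [exact: differentiable_coord|exact: differentiable_cst].
rewrite (_ : pd i _ = cst ((j == i)%:R)%:C); first exact: smooth_cst.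
by apply/funext => u; rewrite /pd /= derive_coord derive_cst.
Qed.

Lemma derive_comp1 N (g : R -> R) (q : 'rV[R]_N -> R) d u : differentiable q u ->
  derivable g (q u) 1 -> 'D_d (fun w => g (q w)) u = 'D_d q u * 'D_1 g (q u).
Proof.
move=> dq dg; have dg' : differentiable g (q u) by exact/derivable1_diffP.
have dc : differentiable (g \o q) u by exact: differentiable_comp.
rewrite (deriveE d dc) diff_comp//= !deriveE// -[in LHS](mulr1 ('d q u d)).
exact: (linearZZ ('d g (q u)) ('d q u d) 1).
Qed.

Lemma pd_expi N (q : 'rV[R]_N -> R) i u : differentiable q u ->
  pd i (fun w => expi (q w)) u = (0 +i* 'D_(delta_mx 0 i) q u) * expi (q u).
Proof.
move=> dq; rewrite /pd /=.
rewrite (derive_comp1 (g := cos) _ dq); last exact: derivable_cos.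
rewrite (derive_comp1 (g := sin) _ dq); last exact: derivable_sin.
by rewrite !derive_val /expi; simpc; congr (_ +i* _); ring.
Qed.

Lemma cdiff_expi N (q : 'rV[R]_N -> R) u : differentiable q u ->
  cdifferentiable (fun w => expi (q w)) u.
Proof.
move=> dq; split; apply: (differentiable_comp dq); apply/derivable1_diffP.
- exact: derivable_cos.
- exact: derivable_sin.
Qed.

Lemma smooth_expi N (q : 'rV[R]_N -> R) : smooth (fun w => (q w)%:C) ->
  smooth (fun w => expi (q w)).
Proof.
move=> sq; have dq u : differentiable q u by have [] := sq [::] u.
pose P (f : 'rV[R]_N -> R[i]) := exists2 g, smooth g & f = g * (fun w => expi (q w)).
apply: (@smooth_coind N P).
- move=> f [g sg ->] u; apply: cdifferentiableM; [exact: (sg [::])|exact: cdiff_expi].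
- move=> f i [g sg ->]; exists (pd i g + g * (cst (0 +i* 1) * pd i (fun w => (q w)%:C))).
    apply: smoothD; first exact: smooth_pd.
    by apply: smoothM => //; apply: smoothM; [exact: smooth_cst|exact: smooth_pd].
  apply/funext => u; rewrite pdM; [|exact: (sg [::])|exact: cdiff_expi].
  rewrite pd_expi// !fctE mulrDl; congr (_ + _); rewrite -mulrA; congr (_ * (_ * _)).
  by rewrite /pd /= derive_cst; simpc.
- exists (cst 1); first exact: smooth_cst.
  by apply/funext => u; rewrite !fctE mul1r.
Qed.

Section Affine.
Variables (N M : nat) (L : 'M[R]_(N, M)) (b : 'rV[R]_M).
Let A (u : 'rV[R]_N) := u *m L + b.

Lemma affine_differentiable u : differentiable A u.
Proof.
have -> : A = \sum_(j < M) (fun u => A u 0 j *: delta_mx 0 j).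
  apply/funext => v; rewrite fct_sumE.
  by rewrite [LHS]row_sum_delta.
apply: differentiable_sum => j; apply: differentiableZl.
have -> : (fun u => A u 0 j) = (\sum_(k < N) (fun u : 'rV[R]_N => u 0 k * L k j)) + cst (b 0 j).
  by apply/funext => v; rewrite /A !fctE fct_sumE !mxE.
apply: differentiableD => //; apply: differentiable_sum => k.
by apply: differentiableM; [exact: differentiable_coord|exact: differentiable_cst].
Qed.

Lemma affine_step u h i : A (u + h *: delta_mx 0 i) = A u + h *: row i L.
Proof. by rewrite /A mulmxDl -scalemxAl rowE addrAC. Qed.

Lemma cdiff_affine f u : cdifferentiable f (A u) -> cdifferentiable (fun w => f (A w)) u.
Proof.
move=> [fr fi]; split.
  exact: (differentiable_comp (g := fun w => Re (f w)) (affine_differentiable u) fr).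
exact: (differentiable_comp (g := fun w => Im (f w)) (affine_differentiable u) fi).
Qed.

Let growthA (f : 'rV[R]_M -> R) u i d : row i L = d ->
  (fun h : R => h^-1 *: (((fun w => f (A w)) \o shift u) (h *: delta_mx 0 i) - f (A u))) =
  (fun h => h^-1 *: ((f \o shift (A u)) (h *: d) - f (A u))).
Proof. by move=> <-; apply/funext => h /=; rewrite (addrC (h *: _) u) affine_step (addrC (A u)). Qed.

Lemma pd_affine f u i j : row i L = delta_mx 0 j -> pd i (fun w => f (A w)) u = pd j f (A u).
Proof.
move=> Lij; rewrite /pd /derive; congr (_ +i* _).
  by rewrite (growthA (fun w => Re (f w)) _ Lij).
by rewrite (growthA (fun w => Im (f w)) _ Lij).
Qed.

Lemma pd_affine0 f u i : row i L = 0 -> pd i (fun w => f (A w)) u = 0.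
Proof.
move=> Li; rewrite /pd /derive.
rewrite (growthA (fun w => Re (f w)) _ Li) (growthA (fun w => Im (f w)) _ Li).
by congr (_ +i* _); exact: derive0.
Qed.

(** Only affine maps sending each coordinate direction to a coordinate direction
or to 0 are needed (slices, translations, projections): partial derivatives are
then partial derivatives, without a chain rule. *)
Lemma smooth_affine f : (forall i, row i L = 0 \/ exists j, row i L = delta_mx 0 j) ->
  smooth f -> smooth (fun w => f (A w)).
Proof.
move=> HL sf.
pose P (g : 'rV[R]_N -> R[i]) := exists2 f, smooth f & g = (fun w => f (A w)).
apply: (@smooth_coind N P).
- by move=> g [f' sf' ->] u; apply: cdiff_affine; exact: (sf' [::]).
- move=> g i [f' sf' ->]; case: (HL i) => [L0|[j Lj]].
    by exists (cst 0); [exact: smooth_cst|apply/funext => u; rewrite pd_affine0].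
  by exists (pd j f'); [exact: smooth_pd|apply/funext => u; rewrite (pd_affine _ _ Lj)].
- by exists f.
Qed.
End Affine.

Lemma near_differentiable N (f g : 'rV[R]_N -> R) u : (\near u, f u = g u) ->
  differentiable g u -> differentiable f u.
Proof.
move=> fg dg; have dl := diff_locally dg; have dc := diff_continuous dg.
have fu : f u = g u := nbhs_singleton fg.
have key : f \o shift u = cst (f u) + 'd g u +o_ 0 id.
  apply/eqaddoP => e e0; move/eqaddoP : dl => /(_ e e0) H.
  have fg0 : \forall h \near (0 : 'rV[R]_N), f (h + u) = g (h + u).
    by have := fg; rewrite (near_shift 0) subr0.
  near=> h.
  have E : (f \o shift u - (cst (f u) + 'd g u)) h = (g \o shift u - (cst (g u) + 'd g u)) h.
    by rewrite !fctE /= fu; congr (_ - _); near: h.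
  by rewrite E; near: h.
apply/diff_locallyP; have -> := diff_unique dc key; split=> //.
Unshelve. all: by end_near. Qed.

Lemma smooth_local N (f : 'rV[R]_N -> R[i]) :
  (forall u : 'rV[R]_N, exists2 g, smooth g & \forall w \near u, f w = g w) -> smooth f.
Proof.
pose P (f : 'rV[R]_N -> R[i]) := forall u : 'rV[R]_N, exists2 g, smooth g & \forall w \near u, f w = g w.
apply: (@smooth_coind N P).
- move=> h Ph u; have [g sg hg] := Ph u; have [gr gi] := sg [::] u; split.
    by apply: near_differentiable gr; apply: filterS hg => w ->.
  by apply: near_differentiable gi; apply: filterS hg => w ->.
- move=> h i Ph u; have [g sg hg] := Ph u; exists (pd i g); first exact: smooth_pd.
  have := near_join hg; apply: filterS => v hv; rewrite /pd; congr (_ +i* _).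
    by apply: near_eq_derive; apply: filterS hv => w ->.
  by apply: near_eq_derive; apply: filterS hv => w ->.
Qed.

End SmoothCalculus.

(** * Symmetry of mixed derivatives and Lipschitz bounds *)

Section Schwarz.
Variable R : realType.
Local Notation Re := complex.Re.
Local Notation Im := complex.Im.

Lemma line_derive N (g : 'rV[R]_N -> R) d (u : 'rV[R]_N) (s : R) :
  derivable g (u + s *: d) d -> is_derive s 1 (fun t : R => g (u + t *: d)) ('D_d g (u + s *: d)).
Proof.
have E : (fun h : R => h^-1 *: (((fun t : R => g (u + t *: d)) \o shift s) (h *: 1) - g (u + s *: d)))
  = (fun h => h^-1 *: ((g \o shift (u + s *: d)) (h *: d) - g (u + s *: d))).
  apply/funext => h /=; congr (_ *: (g _ - _)).
  by rewrite [h *: 1]mulr1 scalerDl addrCA addrA addrC addrA.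
by move=> dg; apply: DeriveDef; [rewrite /derivable E|rewrite /derive E].
Qed.

Lemma line_MVT N (g : 'rV[R]_N -> R) d (u : 'rV[R]_N) (h : R) : 0 <= h ->
  (forall v, derivable g v d) ->
  exists2 s, 0 <= s <= h & g (u + h *: d) - g u = h * 'D_d g (u + s *: d).
Proof.
move=> h0 dg.
have dl (s : R) : is_derive s 1 (fun t : R => g (u + t *: d)) ('D_d g (u + s *: d)).
  exact: line_derive.
have cl : continuous (fun t : R => g (u + t *: d)).
  by move=> s; have [ds _] := dl s; exact/differentiable_continuous/derivable1_diffP.
have [s /[!in_itv]/= s0h] := MVT_segment h0 (fun s _ => dl s) (continuous_subspaceT cl).
by rewrite scale0r addr0 subr0 => E; exists s => //; rewrite E mulrC.
Qed.

(** The second difference of g along d and e is, by two applications of the mean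
value theorem, a value of either mixed derivative near u; sequential continuity
identifies the two limits. *)
Lemma derive_schwarz N (g : 'rV[R]_N -> R) (d e : 'rV[R]_N) u :
  (forall v, derivable g v d) -> (forall v, derivable g v e) ->
  (forall v, derivable ('D_d g) v e) -> (forall v, derivable ('D_e g) v d) ->
  scont ('D_e ('D_d g)) -> scont ('D_d ('D_e g)) ->
  'D_e ('D_d g) u = 'D_d ('D_e g) u.
Proof.
have shD (f : 'rV[R]_N -> R) a b v : 'D_a (fun w => f (w + b)) v = 'D_a f (v + b).
  rewrite /derive; set F := (X in X @ _); set G := (X in _ = lim (X @ _)).
  suff -> : F = G by [].
  by apply/funext => h; rewrite /F /G /= addrA.
have shd (f : 'rV[R]_N -> R) a b v : derivable f (v + b) a -> derivable (fun w => f (w + b)) v a.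
  rewrite /derivable; set F := (X in cvg (X @ _) -> _); set G := (X in _ -> cvg (X @ _)).
  suff -> : F = G by [].
  by apply/funext => h; rewrite /F /G /= addrA.
have half (a b : 'rV[R]_N) (h : R) : 0 <= h -> (forall v, derivable g v a) ->
    (forall v, derivable ('D_a g) v b) ->
    exists p : R * R, [/\ 0 <= p.1 <= h, 0 <= p.2 <= h &
    g (u + h *: a + h *: b) - g (u + h *: a) - (g (u + h *: b) - g u) =
    h * (h * 'D_b ('D_a g) (u + p.1 *: a + p.2 *: b))].
  move=> h0 da dba; pose phi v := g (v + h *: b) - g v.
  have dphi v : derivable phi v a by apply: derivableB; [apply: shd|]; exact: da.
  have [s s0 Es] := line_MVT u h0 dphi.
  have [t t0 Et] := line_MVT (u + s *: a) h0 dba.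
  exists (s, t); split=> //=.
  have -> : g (u + h *: a + h *: b) - g (u + h *: a) - (g (u + h *: b) - g u)
     = phi (u + h *: a) - phi u by [].
  rewrite Es -Et; congr (_ * _).
  rewrite /phi deriveB; [|apply: shd; exact: da|exact: da].
  by rewrite (shD g).
move=> dgd dge dde ded sde sed.
pose h n : R := n.+1%:R^-1.
have h0 n : 0 <= h n by rewrite invr_ge0.
have hn0 n : h n != 0 by rewrite invr_eq0.
have [p Hp] := choice (fun n => half d e (h n) (h0 n) dgd dde).
have [q Hq] := choice (fun n => half e d (h n) (h0 n) dge ded).
have hcv : h n @[n --> \oo] --> 0 by exact: cvg_harmonic.
have small (r : nat -> R) : (forall n, 0 <= r n <= h n) -> r n @[n --> \oo] --> 0.
  by move=> Hr; apply: (@squeeze_cvgr _ _ _ _ (fun=> 0) h) => //; [exact: nearW|exact: cvg_cst].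
have lim (a b : 'rV[R]_N) (r : nat -> R * R) : (forall n, 0 <= (r n).1 <= h n) ->
   (forall n, 0 <= (r n).2 <= h n) -> u + (r n).1 *: a + (r n).2 *: b @[n --> \oo] --> u.
  move=> H1 H2; rewrite -[X in _ --> X]addr0 -(scale0r b) -[X in X + _]addr0 -(scale0r a).
  apply: cvgD; last by apply: cvgZr_tmp; exact: small H2.
  by apply: cvgD; [exact: cvg_cst|apply: cvgZr_tmp; exact: small H1].
have Lp : 'D_e ('D_d g) (u + (p n).1 *: d + (p n).2 *: e) @[n --> \oo] --> ('D_e ('D_d g) u : R).
  by apply: sde; apply: lim => n; have [] := Hp n.
have Lq : 'D_d ('D_e g) (u + (q n).1 *: e + (q n).2 *: d) @[n --> \oo] --> ('D_d ('D_e g) u : R).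
  by apply: sed; apply: lim => n; have [] := Hq n.
have E : (fun n => 'D_e ('D_d g) (u + (p n).1 *: d + (p n).2 *: e)) =
    (fun n => 'D_d ('D_e g) (u + (q n).1 *: e + (q n).2 *: d)).
  apply/funext => n; have [_ _ Ep] := Hp n; have [_ _ Eq] := Hq n.
  have H : g (u + h n *: d + h n *: e) - g (u + h n *: d) - (g (u + h n *: e) - g u) =
      g (u + h n *: e + h n *: d) - g (u + h n *: e) - (g (u + h n *: d) - g u).
    rewrite (addrAC u (h n *: e)); move: (g _) (g _) (g _) (g _) => a1 a2 a3 a4; ring.
  by move: H; rewrite Ep Eq => /(mulfI (hn0 n)) /(mulfI (hn0 n)).
have hR : hausdorff_space R by exact: norm_hausdorff.
rewrite E in Lp.
by rewrite -(cvg_lim hR Lp) (cvg_lim hR Lq).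
Qed.

Lemma pd_comm N (f : 'rV[R]_N -> R[i]) i j : smooth f -> pd i (pd j f) = pd j (pd i f).
Proof.
move=> sf; apply/funext => u.
have sfj := smooth_pd j sf; have sfi := smooth_pd i sf.
have [c1 c2] := smooth_cscont (smooth_pd i sfj).
have [c3 c4] := smooth_cscont (smooth_pd j sfi).
have D i0 v : derivable (fun w => Re (f w)) v (delta_mx 0 i0) /\
    derivable (fun w => Im (f w)) v (delta_mx 0 i0) := smooth_cderivable i0 sf v.
have Dj v : derivable (fun w => Re (pd j f w)) v (delta_mx 0 i) /\
    derivable (fun w => Im (pd j f w)) v (delta_mx 0 i) := smooth_cderivable i sfj v.
have Di v : derivable (fun w => Re (pd i f w)) v (delta_mx 0 j) /\
    derivable (fun w => Im (pd i f w)) v (delta_mx 0 j) := smooth_cderivable j sfi v.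
apply: ReImP.
  exact: (@derive_schwarz N (fun w => Re (f w)) (delta_mx 0 j) (delta_mx 0 i) u
    (fun v => (D j v).1) (fun v => (D i v).1) (fun v => (Dj v).1) (fun v => (Di v).1) c1 c3).
exact: (@derive_schwarz N (fun w => Im (f w)) (delta_mx 0 j) (delta_mx 0 i) u
    (fun v => (D j v).2) (fun v => (D i v).2) (fun v => (Dj v).2) (fun v => (Di v).2) c2 c4).
Qed.

(** The mean value theorem applied to the real and imaginary parts, whence the
factor 2. *)
Lemma pd_lip N (f : 'rV[R]_N -> R[i]) i (u : 'rV[R]_N) C (s : R) : smooth f ->
  (forall t, cn (pd i f (u + t *: delta_mx 0 i)) <= C) ->
  cn (f (u + s *: delta_mx 0 i) - f u) <= 2 * C * `|s|.
Proof.
move=> sf.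
have pos (v : 'rV[R]_N) (h : R) : 0 <= h -> (forall t, cn (pd i f (v + t *: delta_mx 0 i)) <= C) ->
    cn (f (v + h *: delta_mx 0 i) - f v) <= 2 * C * h.
  move=> h0 HC.
  have dr w : derivable (fun w => Re (f w)) w (delta_mx 0 i) by have [] := smooth_cderivable i sf w.
  have di w : derivable (fun w => Im (f w)) w (delta_mx 0 i) by have [] := smooth_cderivable i sf w.
  have [s1 _ E1] := line_MVT v h0 dr.
  have [s2 _ E2] := line_MVT v h0 di.
  rewrite (le_trans (cn_ReIm _))// cReD cReN cImD cImN E1 E2 !normrM (ger0_norm h0).
  rewrite -mulrDr mulrC ler_wpM2r// mulrDl mul1r lerD//.
    exact: le_trans (cn_Re (pd i f _)) (HC _).
  exact: le_trans (cn_Im (pd i f _)) (HC _).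
move=> HC; have [s0|s0] := leP 0 s; first by rewrite ger0_norm//; exact: pos.
rewrite ltr0_norm// cnC; set v := u + s *: _.
have -> : u = v + (- s) *: delta_mx 0 i by rewrite /v scaleNr addrK.
apply: pos; first by rewrite oppr_ge0 ltW.
by move=> t; rewrite /v -addrA -scalerDl.
Qed.

Lemma zperiodic_bounded N (f : 'rV[R]_N -> R[i]) : (forall u, cdifferentiable f u) ->
  zperiodic f -> exists B, bounded_by B f.
Proof.
move=> df pf.
pose A := [set v : 'rV[R]_N | forall i, `[0, 1]%classic (v ord0 i)].
have cA : compact A by apply: (@rV_compact R N (fun=> `[0, 1]%classic)) => i; exact: segment_compact.
have A0 : A !=set0 by exists 0 => i /=; rewrite mxE in_itv/= lexx ler01.
have bnd (g : 'rV[R]_N -> R) : continuous g -> exists C, forall v, A v -> `|g v| <= C.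
  move=> cg; have cn : continuous (fun v => `|g v|).
    by move=> v; apply: (@continuous_comp _ _ _ g (fun x : R => `|x|)); [exact: cg|exact: norm_continuous].
  have [c _ Hc] := EVT_max_rV A0 cA (continuous_subspaceT cn).
  by exists `|g c| => v Av; apply: Hc; rewrite inE.
have [C1 H1] : exists C, forall v, A v -> `|Re (f v)| <= C.
  by apply: bnd => u; apply: differentiable_continuous; have [] := df u.
have [C2 H2] : exists C, forall v, A v -> `|Im (f v)| <= C.
  by apply: bnd => u; apply: differentiable_continuous; have [] := df u.
exists (C1 + C2) => u.
pose l : 'rV[int]_N := \row_i (- Num.floor (u 0 i)).
rewrite -(pf l).
have Al : A (u + map_mx intr l).
  move=> i /=; rewrite !mxE in_itv/= intrN subr_ge0 lerBlDr.
  have /andP[-> h2] := floor_itv (u 0 i); apply: ltW.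
  by move: h2; rewrite intrD addrC.
by rewrite (le_trans (cn_ReIm _))// lerD ?H1 ?H2.
Qed.

End Schwarz.

(** * A smooth bump function *)

Section Bump.
Variable R : realType.

(** The flat functions P(1/t) exp(-1/t), extended by 0: the class is stable
under differentiation, which is how smoothness at 0 is proved. *)
Definition eflat (P : {poly R}) (t : R) : R := if 0 < t then P.[t^-1] * expR (- t^-1) else 0.

Lemma poly_bound (P : {poly R}) x : 1 <= x -> `|P.[x]| <= (\sum_(i < size P) `|P`_i|) * x ^+ size P.
Proof.
move=> x1; rewrite horner_coef (le_trans (ler_norm_sum _ _ _))// big_distrl /=.
apply: ler_sum => i _; rewrite normrM normrX (ger0_norm (le_trans ler01 x1)).
by rewrite ler_wpM2l// ler_weXn2l// ltnW.
Qed.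

Lemma eflat_bound (P : {poly R}) : exists C, forall t, 0 < t <= 1 -> `|eflat P t| <= C * t ^+ 2.
Proof.
set S := \sum_(i < size P) `|P`_i|; exists (S * (size P).+2`!%:R) => t /andP[t0 t1].
rewrite /eflat t0; set x := t^-1.
have x0 : 0 < x by rewrite invr_gt0.
have x1 : 1 <= x by rewrite invf_ge1.
have S0 : 0 <= S by apply: sumr_ge0.
rewrite normrM (ger0_norm (expR_ge0 _)).
have ex : expR (- x) <= (size P).+2`!%:R / x ^+ (size P).+2.
  rewrite expRN -[leRHS]invrK lef_pV2 ?posrE ?expR_gt0//; last first.
    by rewrite invr_gt0 divr_gt0 ?exprn_gt0// ltr0n fact_gt0.
  rewrite invf_div; apply: le_trans (expR_ge1Dxn (size P).+1 (ltW x0)).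
  by rewrite lerDr.
apply: (@le_trans _ _ ((S * x ^+ size P) * ((size P).+2`!%:R / x ^+ (size P).+2))).
  by rewrite ler_pM// ?expR_ge0// poly_bound.
rewrite le_eqVlt; apply/orP; left; apply/eqP.
have -> : x ^+ (size P).+2 = x ^+ size P * x ^+ 2 by rewrite -addn2 exprD.
have xn : x ^+ size P != 0 by rewrite expf_neq0// gt_eqF.
have -> : t ^+ 2 = (x ^+ 2)^-1 by rewrite /x exprVn invrK.
have x2 : x ^+ 2 != 0 by rewrite expf_neq0// gt_eqF.
by field; rewrite xn gt_eqF.
Qed.

Definition eflat' (P : {poly R}) : {poly R} := 'X^2 * (P - P^`()).

Lemma is_derive_eflat (P : {poly R}) (t : R) : is_derive t 1 (eflat P) (eflat (eflat' P) t).
Proof.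
have [t0|t0|<-] := ltgtP 0 t.
- have E : \forall s \near t, P.[s^-1] * expR (- s^-1) = eflat P s.
    near=> s; rewrite /eflat; suff -> : 0 < s by [].
    by near: s; exact: lt_nbhsr.
  apply: (near_eq_is_derive E).
  have dV : is_derive t 1 (fun s : R => s^-1) (- t^-2).
    have t0' : (id t : R) != 0 by rewrite gt_eqF.
    apply: DeriveDef; first by apply: derivableV => //; exact: derivable_id.
    rewrite (@deriveV R R id t 1 t0'); last exact: derivable_id.
    by rewrite derive_id; exact: mulr1.
  have dP : is_derive t 1 (fun s : R => P.[s^-1]) (P^`().[t^-1] * - t^-2).
    exact: (@is_derive1_comp R (horner P) (fun s : R => s^-1) t _ _ (is_derive_poly P t^-1) dV).
  have dE : is_derive t 1 (fun s : R => expR (- s^-1)) (expR (- t^-1) * t^-2).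
    have dN : is_derive t 1 (fun s : R => - s^-1) (t^-2).
      by have := is_deriveN dV; rewrite opprK.
    exact: (@is_derive1_comp R expR (fun s : R => - s^-1) t _ _ (is_derive_expR (- t^-1)) dN).
  apply: (is_derive_eq (is_deriveM dP dE)).
  rewrite /eflat t0 /eflat' !hornerE /GRing.scale /= exprVn; ring.
- have E : \forall s \near t, 0 = eflat P s.
    near=> s; rewrite /eflat; suff -> : 0 < s = false by [].
    by apply/negbTE; rewrite -leNgt ltW//; near: s; exact: lt_nbhsl.
  apply: (near_eq_is_derive E); rewrite /eflat ltNge (ltW t0) /=.
  exact: is_derive_cst.
- have [C HC] := eflat_bound P.
  have e0 Q : eflat Q 0 = 0 by rewrite /eflat ltxx.
  have H : (fun h : R => h^-1 *: ((eflat P \o shift 0) (h *: 1) - eflat P 0)) @ 0^' --> 0.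
    apply/cvgrPdist_le => e epos.
    have C0 : 0 <= C.
      by have := HC 1; rewrite ltr01 lexx expr1n mulr1 => /(_ isT); apply: le_trans.
    near=> h; rewrite sub0r normrN e0 subr0 /= addr0 [h *: 1]mulr1 normrM normfV.
    have h0 : h != 0 by near: h; exact: nbhs_dnbhs_neq.
    have hs : `|h| <= Num.min 1 (e / (C + 1)).
      near: h; apply: dnbhs0_le.
      by rewrite lt_min ltr01 divr_gt0// ltr_wpDl.
    rewrite le_min in hs; case/andP: hs => h1 he.
    rewrite mulrC ler_pdivrMr ?normr_gt0//.
    have [hp|hn] := ltP 0 h; last first.
      by rewrite /eflat ltNge hn /= normr0 mulr_ge0// ltW.
    rewrite (gtr0_norm hp) in h1 he *; rewrite (le_trans (HC h _)) ?hp ?h1//.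
    rewrite expr2 mulrA ler_wpM2r// ?(ltW hp)//.
    apply: (@le_trans _ _ (C * (e / (C + 1)))); first by rewrite ler_wpM2l.
    by rewrite mulrCA ler_piMr ?(ltW epos)// ler_pdivrMr ?mul1r ?lerDl ?ltr_wpDl.
  rewrite e0; apply: DeriveDef; first by apply/cvg_ex; exists 0.
  exact: cvg_lim H.
Unshelve. all: by end_near. Qed.

Lemma smooth_eflat N (i : 'I_N) (c b : R) (P : {poly R}) :
  smooth (fun y : 'rV[R]_N => (eflat P (c * y 0 i + b))%:C).
Proof.
pose l (y : 'rV[R]_N) : R := c * y 0 i + b.
have dl u : differentiable l u.
  apply: differentiableD => //; apply: differentiableM => //; exact: differentiable_coord.
have dle j u : 'D_(delta_mx 0 j) l u = c * (i == j)%:R.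
  have dc : derivable (fun y : 'rV[R]_N => y 0 i) u (delta_mx 0 j).
    by apply: diff_derivable; exact: differentiable_coord.
  rewrite /l deriveD ?derive_cst ?addr0//; last first.
    by apply: diff_derivable; apply: differentiableM => //; exact: differentiable_coord.
  by rewrite (deriveZ c dc) derive_coord.
have de Q x : derivable (eflat Q) x 1 by have [] := is_derive_eflat Q x.
pose S (f : 'rV[R]_N -> R[i]) := exists k Q, f = (fun y => (k * eflat Q (l y))%:C).
apply: (@smooth_coind R N S).
- move=> f [k [Q ->]] u; split => /=; last exact: differentiable_cst.
  apply: differentiableM => //.
  by apply: (differentiable_comp (dl u)); exact/derivable1_diffP.
- move=> f j [k [Q ->]]; exists (k * (c * (i == j)%:R)), (eflat' Q).
  apply/funext => u; rewrite /pd /= derive_cst; congr (_ +i* _).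
  have dc : derivable (fun y => eflat Q (l y)) u (delta_mx 0 j).
    by apply: diff_derivable; apply: (differentiable_comp (dl u)); exact/derivable1_diffP.
  rewrite (deriveZ k dc) (derive_comp1 _ (dl u)) ?dle //.
  have [_ ->] := is_derive_eflat Q (l u).
  by rewrite -mulrA.
- by exists 1, P; apply/funext => y; rewrite mul1r.
Qed.

(** A product of flat functions of 1 + y_i and 1 - y_i, normalized by exp(1) so
that its value at 0 is 1. *)
Definition bumpfun N (y : 'rV[R]_N) : R[i] :=
  \prod_i ((eflat (expR 1)%:P (1 * y 0 i + 1))%:C * (eflat (expR 1)%:P (-1 * y 0 i + 1))%:C).

Lemma bumpfun_test N : test_function (@bumpfun N).
Proof.
split.
  apply: smooth_prod => i.
  rewrite (_ : (fun v => _) = (fun y : 'rV[R]_N => (eflat (expR 1)%:P (1 * y 0 i + 1))%:C) *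
    (fun y : 'rV[R]_N => (eflat (expR 1)%:P (-1 * y 0 i + 1))%:C)) //.
  by apply: smoothM; exact: smooth_eflat.
exists 1 => y y1; have [i Hi] : exists i, 1 < `|y 0 i|.
  apply: contrapT => /forallNP H; have : `|y| <= 1.
    rewrite [leLHS]/Num.Def.normr/= mx_normrE; apply/bigmax_leP; split=> // -[a i] _ /=.
    by rewrite (ord1 a) leNgt; apply/negP; exact: H.
  by rewrite leNgt y1.
rewrite /bumpfun (bigD1 i)//= /eflat.
have [h|h] := leP (y 0 i) 0.
  rewrite ler0_norm// in Hi.
  by rewrite mul1r (_ : 0 < y 0 i + 1 = false) ?mul0r//; apply/negbTE; rewrite -leNgt; lra.
rewrite gtr0_norm// in Hi.
by rewrite mulN1r (_ : 0 < - y 0 i + 1 = false) ?mulr0 ?mul0r//; apply/negbTE; rewrite -leNgt; lra.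
Qed.

Lemma bumpfun0 N : @bumpfun N 0 = 1.
Proof.
rewrite /bumpfun big1// => i _; rewrite mxE !mulr0 add0r /eflat ltr01 hornerC invr1 -expRD subrr expR0.
by rewrite mulr1.
Qed.

Lemma bumpfun_real N (y : 'rV[R]_N) : exists2 r, 0 <= r & bumpfun y = r%:C.
Proof.
have e0 t : 0 <= eflat (expR 1)%:P t.
  by rewrite /eflat; case: ifP => // _; rewrite hornerC mulr_ge0// expR_ge0.
exists (\prod_i (eflat (expR 1)%:P (1 * y 0 i + 1) * eflat (expR 1)%:P (-1 * y 0 i + 1))).
  by apply: prodr_ge0 => i _; rewrite mulr_ge0.
by rewrite rmorph_prod; apply: eq_bigr => i _; rewrite rmorphM.
Qed.

End Bump.

(** * The trapezoid rule for smooth periodic functions *)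

Section Trapezoid.
Variable R : realType.
Local Notation Re := complex.Re.
Local Notation Im := complex.Im.
Local Notation I01 := (`[0, 1]%classic : set R).

Lemma per_reduce (p : R) (x y : R) : 0 < p -> exists q : int, y <= x + p * q%:~R <= y + p.
Proof.
move=> p0; exists (- Num.floor ((x - y) / p)).
have /andP[h1 h2] := floor_itv ((x - y) / p).
rewrite ler_pdivlMr// in h1; rewrite ltr_pdivrMr// intrD mulrDl mul1r in h2.
rewrite mulrNz; apply/andP; split; lra.
Qed.

Lemma is_derive_continuous (g dg : R -> R) : (forall x : R, is_derive x 1 g (dg x)) -> continuous g.
Proof. by move=> d x; have [dx _] := d x; exact/differentiable_continuous/derivable1_diffP. Qed.

(** Any two points are at distance at most p modulo the period. *)
Lemma per_osc (p : R) (g dg : R -> R) D : 0 < p -> (forall x : R, is_derive x 1 g (dg x)) ->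
  (forall x, g (x + p) = g x) -> (forall x, `|dg x| <= D) -> forall x y, `|g x - g y| <= p * D.
Proof.
move=> p0 d pg bd x y; have [q /andP[q1 q2]] := per_reduce x y p0.
rewrite -(per_shift q x pg); set z := x + _ in q1 q2 *.
have [c _ ->] := MVT_segment q1 (fun t _ => d t) (continuous_subspaceT (is_derive_continuous d)).
rewrite normrM mulrC; apply: ler_pM => //.
by rewrite ger0_norm ?subr_ge0// lerBlDl.
Qed.

(** Rolle's theorem over one period. *)
Lemma per_zero (p : R) (g dg : R -> R) : 0 < p -> (forall x : R, is_derive x 1 g (dg x)) ->
  (forall x, g (x + p) = g x) -> exists c, dg c = 0.
Proof.
move=> p0 d pg; have [] := @Rolle R g 0 p p0.
- by move=> x _; have [] := d x.
- exact: continuous_subspaceT (is_derive_continuous d).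
- by rewrite -[in LHS](pg 0) add0r.
by move=> c _ [_ Hc]; exists c; have [_ <-] := d c.
Qed.

(** Each derivative of a periodic function vanishes somewhere, so its size is at
most p times that of the next one. *)
Lemma per_chain (p : R) (psi : nat -> R -> R) r D : 0 < p ->
  (forall q (x : R), is_derive x 1 (psi q) (psi q.+1 x)) ->
  (forall q x, psi q (x + p) = psi q x) ->
  (forall x, `|psi r.+1 x| <= D) -> forall x y, `|psi 0%N x - psi 0%N y| <= p ^+ r.+1 * D.
Proof.
move=> p0 d pp bD; elim: r psi D d pp bD => [|r IH] psi D d pp bD x y.
  by rewrite expr1; exact: (per_osc p0 (d 0%N) (pp 0%N)).
have H : forall x, `|psi r.+1 x| <= p * D.
  have [c Hc] := per_zero p0 (d r) (pp r) => z.
  rewrite -[psi r.+1 z]subr0 -Hc.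
  exact: (per_osc p0 (d r.+1) (pp r.+1)).
by rewrite exprSr -mulrA; exact: IH.
Qed.

Lemma rint01_sum (I : Type) (s : seq I) (B : R) (F : I -> R -> R) :
  (forall i, scont (F i)) -> (forall i x, `|F i x| <= B) ->
  rint I01 (fun x => \sum_(i <- s) F i x) = \sum_(i <- s) rint I01 (F i).
Proof.
move=> cF bF; have dF i : dom1 (@w1 R) B (F i) by move=> x; rewrite mulr1.
have bs t : forall x, `|\sum_(i <- t) F i x| <= \sum_(i <- t) B.
  by move=> x; apply: le_trans (ler_norm_sum _ _ _) _; apply: ler_sum => i _.
elim: s => [|i s IH].
  rewrite big_nil /rint /Rintegral; under eq_integral do rewrite big_nil.
  by rewrite integral0.
rewrite big_cons -IH -(rintD (adm01 R) (M1 := B) (M2 := \sum_(i <- s) B)) //.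
- by congr rint; apply/funext => x; rewrite big_cons.
- exact: scont_sum.
- by move=> x; rewrite mulr1.
Qed.

(** The average e of the k translates is 1/k-periodic and its derivatives are
bounded like those of psi; the error is the difference between a value of e and
its mean, so it is bounded by the oscillation of e. *)
Lemma trapezoid1 k (psi : nat -> R -> R) r D : (0 < k)%N ->
  (forall q (x : R), is_derive x 1 (psi q) (psi q.+1 x)) ->
  (forall q x, psi q (x + 1) = psi q x) ->
  (forall x, `|psi r.+1 x| <= D) ->
  `|k%:R^-1 * (\sum_(j < k) psi 0%N (k%:R^-1 * j%:R)) - rint I01 (psi 0%N)| <= k%:R^-1 ^+ r.+1 * D.
Proof.
move=> k0 d pp bD; set p : R := k%:R^-1.
have kR0 : 0 < k%:R :> R by rewrite ltr0n.
have p0 : 0 < p by rewrite invr_gt0.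
pose e q x := p * \sum_(j < k) psi q (x + p * j%:R).
have de q (x : R) : is_derive x 1 (e q) (e q.+1 x).
  rewrite /e; apply: (@is_deriveZ _ _ _ (fun x => \sum_(j < k) psi q (x + p * j%:R)) p x 1).
  have -> : (fun x => \sum_(j < k) psi q (x + p * j%:R)) = \sum_(j < k) (fun x => psi q (x + p * j%:R)).
    by apply/funext => y; rewrite fct_sumE.
  by apply: is_derive_sum => j; exact: is_derive_translate.
have pe q x : e q (x + p) = e q x.
  rewrite /e; congr (_ * _).
  rewrite (eq_bigr (fun j : 'I_k => psi q (x + p * j.+1%:R))); last first.
    by move=> j _; rewrite -natr1 mulrDr mulr1 -addrA (addrC p).
  apply/eqP; rewrite -subr_eq0 -sumrB.
  rewrite -(big_mkord xpredT (fun j => psi q (x + p * j.+1%:R) - psi q (x + p * j%:R))).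
  rewrite telescope_sumr// mulr0 addr0.
  have -> : p * k%:R = 1 by rewrite mulVf// gt_eqF.
  by rewrite pp subrr.
have be x : `|e r.+1 x| <= D.
  rewrite /e normrM (gtr0_norm p0) ler_pdivrMl//.
  rewrite (le_trans (ler_norm_sum _ _ _))//.
  by rewrite (le_trans (ler_sum _ (fun j _ => bD _)))// sumr_const card_ord mulr_natl.
have ce q := is_derive_continuous (de q).
have cpsi q := is_derive_continuous (d q).
have osc x y := per_chain p0 de pe be x y.
have cs q (t : R) : scont (fun x : R => psi q (x + t)).
  by apply: continuous_scont; exact: continuous_translate.
have bpsi x : `|psi 0%N x| <= `|psi 0%N 0| + D.
  rewrite -[psi 0%N x](subrK (psi 0%N 0)) addrC (le_trans (ler_normD _ _))// lerD2l.
  by have := per_chain ltr01 d pp bD x 0; rewrite expr1n mul1r.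
have E : rint I01 (psi 0%N) = rint I01 (e 0%N).
  rewrite /e (rintZ (adm01 R) (M := k%:R * (`|psi 0%N 0| + D))); last 2 first.
  - by apply: scont_sum => j.
  - move=> x; rewrite mulr1 (le_trans (ler_norm_sum _ _ _))//.
    by rewrite (le_trans (ler_sum _ (fun j _ => bpsi _)))// sumr_const card_ord mulr_natl.
  rewrite (@rint01_sum _ _ (`|psi 0%N 0| + D)) //.
  rewrite (eq_bigr (fun=> rint I01 (psi 0%N))) => [|j _]; last exact: rint_shift.
  by rewrite sumr_const card_ord -mulr_natl mulrA mulVf ?mul1r// gt_eqF.
rewrite E; set c := p * _.
have -> : c = e 0%N 0 by rewrite /c /e; under [in RHS]eq_bigr do rewrite add0r.
have [cc ce0] : scont (fun _ : R => e 0%N 0) /\ scont (e 0%N).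
  by split; [exact: scont_cst|exact/continuous_scont/ce].
have be0 x : `|e 0%N x| <= `|e 0%N 0| + p ^+ r.+1 * D.
  rewrite -[e 0%N x](subrK (e 0%N 0)) addrC (le_trans (ler_normD _ _))// lerD2l.
  exact: osc.
have H : e 0%N 0 - rint I01 (e 0%N) = rint I01 (fun x => e 0%N 0 + (-1) * e 0%N x).
  rewrite (rintD (adm01 R) (M1 := `|e 0%N 0|) (M2 := `|e 0%N 0| + p ^+ r.+1 * D)) //; last 3 first.
  - by apply: scontM => //; exact: scont_cst.
  - by move=> x; rewrite mulr1.
  - by move=> x; rewrite mulr1 mulN1r normrN.
  rewrite (rintZ (adm01 R) (-1) (f := e 0%N) (M := `|e 0%N 0| + p ^+ r.+1 * D)) // ?mulN1r.
    congr (_ - _); transitivity (rint I01 (fun x => e 0%N 0 * @w1 R x)).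
      rewrite (rintZ (adm01 R) (M := 1)) ?rint01 ?mulr1//; first exact: scont_cst.
      by move=> x; rewrite mulr1 normr1.
    by congr rint; apply/funext => x; rewrite mulr1.
  by move=> x; rewrite mulr1.
rewrite H -[leRHS]mulr1 -[X in _ <= _ * X](rint01 R); apply: (rint_bound (adm01 R)).
  by apply: scontD => //; apply: scontM => //; exact: scont_cst.
by move=> x; rewrite mulr1 mulN1r; exact: osc.
Qed.
Lemma smooth_slice N (f : 'rV[R]_N.+1 -> R[i]) x : smooth f -> smooth (fun v => f (rcons1 x v)).
Proof.
move=> sf; pose L : 'M[R]_(N, 1 + N) := row_mx 0 1%:M.
have -> : (fun v => f (rcons1 x v)) = (fun v => f (v *m L + row_mx x%:M 0)).
  apply/funext => v; rewrite /L mul_mx_row mulmx0 mulmx1.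
  by congr f; rewrite -[row_mx 0 v]/(row_mx _ _) add_row_mx add0r addr0.
apply: smooth_affine => // i; right; exists (lift ord0 i).
by rewrite delta_lift /L row_row_mx row0 row1 /rcons1 -scalemx1 scale0r.
Qed.

Lemma iter_pd_lift q N (f : 'rV[R]_N.+1 -> R[i]) x (j : 'I_N) (v : 'rV[R]_N) :
  iter q (pd j) (fun v => f (rcons1 x v)) v = iter q (pd (lift ord0 j)) f (rcons1 x v).
Proof.
elim: q v => [//|q IH] v; rewrite [iter q.+1 (pd (lift _ _)) f]iterS pd_lift.
by congr (pd j _ v); apply/funext => w; exact: IH.
Qed.

Lemma smooth_iter_pd q N (i : 'I_N) (f : 'rV[R]_N -> R[i]) : smooth f -> smooth (iter q (pd i) f).
Proof. by move=> sf; elim: q => [//|q IH]; exact: smooth_pd. Qed.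

Lemma zperiodic_pd N (i : 'I_N) (f : 'rV[R]_N -> R[i]) : zperiodic f -> zperiodic (pd i f).
Proof.
move=> pf l u; rewrite -[LHS](congr1 (@^~ u) (pd_shift i f (map_mx intr l))).
by congr (pd i _ u); apply/funext => w; exact: pf.
Qed.

Lemma zperiodic_iter_pd q N (i : 'I_N) (f : 'rV[R]_N -> R[i]) :
  zperiodic f -> zperiodic (iter q (pd i) f).
Proof. by move=> pf; elim: q => [//|q IH]; exact: zperiodic_pd. Qed.

Lemma zperiodic_0 N (f : 'rV[R]_N.+1 -> R[i]) x v : zperiodic f ->
  f (rcons1 (x + 1) v) = f (rcons1 x v).
Proof.
move=> pf; rewrite -[RHS](pf (izcons 1 0)) map_izcons rcons1D.
by congr (f (rcons1 _ _)); apply/rowP => i; rewrite !mxE addr0.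
Qed.

(** One coordinate at a time: the one-dimensional error in the first coordinate
is integrated over the others, and the induction hypothesis applies to each
slice. *)
Lemma trapezoid k N (f : 'rV[R]_N -> R[i]) r D : (0 < k)%N -> smooth f -> zperiodic f ->
  (forall i, bounded_by D (iter r.+1 (pd i) f)) ->
  cn (cavg k f - integral_unit_cube f) <= 4 * N%:R * D * k%:R^-1 ^+ r.+1.
Proof.
move=> k0; elim: N f => [|N IH] f sf pf bf.
  by rewrite /= /integral_unit_cube /= subrr cn0 mulr0 !mul0r.
have kR0 : 0 < k%:R :> R by rewrite ltr0n.
set p : R := k%:R^-1.
have p0 : 0 < p by rewrite invr_gt0.
have [B bB] : exists B, bounded_by B f by apply: zperiodic_bounded => // u; exact: (sf [::]).
have cf := cscont_rcons1 (smooth_cscont sf).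
pose I (x : R) := integral_unit_cube (fun v : 'rV[R]_N => f (rcons1 x v)).
pose E (v : 'rV[R]_N) := p%:C * \sum_(j < k) f (rcons1 (p * j%:R) v) - cintegral I01 (fun x => f (rcons1 x v)).
have cs x : cscont (fun v : 'rV[R]_N => f (rcons1 x v)) by apply: cscont_rcons1l; exact: smooth_cscont.
have cA : cscont (fun v : 'rV[R]_N => p%:C * \sum_(j < k) f (rcons1 (p * j%:R) v)).
  by apply: cscontM; [exact: cscont_cst|exact: cscont_sum].
have bA : bounded_by B (fun v : 'rV[R]_N => p%:C * \sum_(j < k) f (rcons1 (p * j%:R) v)).
  move=> v; rewrite cnM cn_real (gtr0_norm p0) ler_pdivrMl//.
  by apply: cn_sum_ord => j; exact: bB.
have cC : cscont (fun v : 'rV[R]_N => cintegral I01 (fun x => f (rcons1 x v))).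
  apply: (cscont_C1 (F := fun v x => f (rcons1 x v)) (B := B)); last by move=> *; exact: bB.
  apply: (cscont_seq (g := fun q : 'rV[R]_N * R => (q.2, q.1)) cf) => u q uq.
  by apply: cvg_seq_pair; [exact: cvg_seq_snd uq|exact: cvg_seq_fst uq].
have bC : bounded_by (2 * B) (fun v : 'rV[R]_N => cintegral I01 (fun x => f (rcons1 x v))).
  move=> v; apply: C1_bound; last by move=> *; exact: bB.
  apply: (cscont_seq (g := fun x : R => (x, v)) cf) => u q uq.
  by apply: cvg_seq_pair; [exact: uq|exact: cvg_cst].
have EI : integral_unit_cube E = p%:C * \sum_(j < k) I (p * j%:R) - integral_unit_cube f.
  rewrite /E (ci01B cA bA cC bC) (ci01Z _ (B := k%:R * B)); last 2 first.
  - exact: cscont_sum.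
  - by move=> v; apply: cn_sum_ord => j; exact: bB.
  rewrite (ci01_sum _ (B := fun=> B) (F := fun (j : 'I_k) v => f (rcons1 (p * j%:R) v))) //; last first.
    by move=> j v; exact: bB.
  by congr (_ - _); rewrite -(C1_ci01 (B := B) cf).
have bE : bounded_by (2 * (p ^+ r.+1 * D)) E.
  move=> v.
  have s0 q : cderivable ord0 (iter q (pd ord0) f).
    by apply: smooth_cderivable; exact: smooth_iter_pd.
  have dR q x := (pd_0 x v (s0 q)).1; have dI q x := (pd_0 x v (s0 q)).2.
  have pq q x : iter q (pd ord0) f (rcons1 (x + 1) v) = iter q (pd ord0) f (rcons1 x v).
    by apply: zperiodic_0; exact: zperiodic_iter_pd.
  have := trapezoid1 k0 dR _ (r := r) (D := D); have := trapezoid1 k0 dI _ (r := r) (D := D).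
  move=> HI HR; rewrite (le_trans (cn_ReIm _))// mulr_natl mulr2n lerD//.
  - rewrite /E cReD cReN cReM mul0r subr0 (big_morph (@complex.Re R) (@cReD R) (erefl _)).
    apply: HR; first by move=> q x; rewrite pq.
    by move=> x; apply: le_trans (cn_Re _) _; exact: bf.
  - rewrite /E cImD cImN cImM mul0r addr0 (big_morph (@complex.Im R) (@cImD R) (erefl _)).
    apply: HI; first by move=> q x; rewrite pq.
    by move=> x; apply: le_trans (cn_Im _) _; exact: bf.
have cE : cscont E by exact: cscontB.
rewrite [X in cn X](_ : _ = p%:C * (\sum_(j < k) (cavg k (fun v => f (rcons1 (p * j%:R) v)) - I (p * j%:R))) +
    integral_unit_cube E); last by rewrite EI sumrB mulrBr addrA subrK.
apply: le_trans (cnD _ _) _.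
have -> : 4 * N.+1%:R * D * p ^+ r.+1 = 4 * N%:R * D * p ^+ r.+1 + 2 * (2 * (p ^+ r.+1 * D)).
  by rewrite -natr1; ring.
apply: lerD; last exact: ci01_bound.
rewrite cnM cn_real (gtr0_norm p0) ler_pdivrMl//.
apply: cn_sum_ord => j; apply: IH.
- exact: smooth_slice.
- exact: zperiodic_rcons1.
- by move=> i v; rewrite iter_pd_lift; exact: bf.
Qed.

End Trapezoid.

(** * Averages over torsion points *)

Section Averages.
Variable R : realType.

Lemma cavgE k N (F : 'rV[R]_N -> R[i]) : cavg k F =
  (k%:R^-1)%:C ^+ N * \sum_(m : {ffun 'I_N -> 'I_k}) F (k%:R^-1 *: \row_i (m i)%:R).
Proof.
elim: N F => [|N IH] F.
  rewrite expr0 mul1r (big_pred1 (ffun0 (card_ord 0))).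
    by rewrite /=; congr F; apply/rowP => -[].
  by move=> m; apply/esym/eqP/ffunP => -[].
rewrite /= exprS -mulrA; congr (_ * _).
under eq_bigr do rewrite IH; rewrite -big_distrr pair_big /=; congr (_ * _).
pose h (p : 'I_k * {ffun 'I_N -> 'I_k}) : {ffun 'I_N.+1 -> 'I_k} :=
  [ffun i => if unlift ord0 i is Some i' then p.2 i' else p.1].
pose h' (m : {ffun 'I_N.+1 -> 'I_k}) := (m ord0, [ffun i => m (lift ord0 i)]).
have hK : cancel h h'.
  case=> j m; rewrite /h' /h /=; congr pair; first by rewrite ffunE unlift_none.
  by apply/ffunP => i; rewrite !ffunE liftK.
have h'K : cancel h' h.
  by move=> m; apply/ffunP => i; rewrite ffunE; case: unliftP => [i' ->|->]; rewrite ?ffunE.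
rewrite (reindex h) /=; last by exists h' => m _.
apply: eq_bigr => -[j m] _ /=; congr F.
rewrite [RHS]rcons1_surj; congr rcons1.
  by rewrite !mxE ffunE unlift_none.
by apply/rowP => i; rewrite !mxE ffunE liftK.
Qed.

Lemma row_mx_rcons1 N N' x (u : 'rV[R]_N) (v : 'rV[R]_N') :
  row_mx (rcons1 x u) v = rcons1 x (row_mx u v).
Proof.
have El (i : 'I_(N + N').+1) (j : 'I_N.+1) : i = lshift N' j ->
    (row_mx (rcons1 x u) v : 'rV[R]_(N + N').+1) 0 i = rcons1 x u 0 j.
  by move=> ->; exact: row_mxEl.
have Er (i : 'I_(N + N').+1) (j : 'I_N') : i = rshift N.+1 j ->
    (row_mx (rcons1 x u) v : 'rV[R]_(N + N').+1) 0 i = v 0 j.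
  by move=> ->; exact: row_mxEr.
rewrite [LHS]rcons1_surj; congr rcons1.
  by rewrite (El _ ord0) ?rcons1_0//; exact: val_inj.
apply/rowP => i; rewrite mxE; case: (split_ordP i) => j ->.
  by rewrite (El _ (lift ord0 j)) ?rcons1_S ?row_mxEl//; exact: val_inj.
by rewrite (Er _ j) ?row_mxEr//; exact: val_inj.
Qed.

Lemma cavg_row_mx k N N' (f : 'rV[R]_(N + N') -> R[i]) :
  cavg k f = cavg k (fun x : 'rV[R]_N => cavg k (fun y : 'rV[R]_N' => f (row_mx x y))).
Proof.
elim: N f => [|N IH] f /=.
  congr cavg; apply/funext => y; congr f; apply/rowP => i.
  by rewrite (_ : i = rshift 0 i) ?row_mxEr//; [congr (y 0 _)|]; exact: val_inj.
congr (_ * _); apply: eq_bigr => j _; rewrite IH; congr cavg; apply/funext => x.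
by congr cavg; apply/funext => y; rewrite row_mx_rcons1.
Qed.

End Averages.

(** * Functions on the torus and the star product *)

Section TorusFunctions.
Variables (R : realType) (n : nat).
Implicit Types f g : CinfX R n.

Lemma CinfX_smooth f : smooth f.
Proof. by have /asboolP[] := CinfXP f. Qed.

Lemma CinfX_zperiodic f : zperiodic f.
Proof. by have /asboolP[_ pf] := CinfXP f; exact: pf. Qed.

Lemma CinfX_bounded f : exists B, bounded_by B f.
Proof. by apply: zperiodic_bounded (CinfX_zperiodic f) => u; exact: (CinfX_smooth f [::]). Qed.

Lemma CinfX_cscont f : cscont f.
Proof. exact/smooth_cscont/CinfX_smooth. Qed.

Lemma CinfX_eq f g : f =1 g -> f = g.
Proof. by move=> fg; apply: val_inj; apply/funext => u; exact: fg. Qed.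

Lemma integral_XD f g : integral_X (f + g) = integral_X f + integral_X g.
Proof.
have [[B bB] [B' bB']] := (CinfX_bounded f, CinfX_bounded g).
by apply: (ciD (adm01 R)); apply: cok01; [exact: CinfX_cscont|exact: bB|exact: CinfX_cscont|exact: bB'].
Qed.

Lemma integral_XZ (c : R[i]) f : integral_X (c *: f) = c * integral_X f.
Proof. by have [B bB] := CinfX_bounded f; apply: ci01Z bB; exact: CinfX_cscont. Qed.

Lemma integral_X0 : integral_X (0 : CinfX R n) = 0.
Proof. by rewrite -(scale0r (0 : CinfX R n)) integral_XZ mul0r. Qed.

Lemma integral_X_sum (I : Type) (r : seq I) (P : pred I) (F : I -> CinfX R n) :
  integral_X (\sum_(i <- r | P i) F i) = \sum_(i <- r | P i) integral_X (F i).
Proof. exact: (big_morph _ integral_XD integral_X0). Qed.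

Lemma integral_X_pd i f : integral_X (CinfX_pd i f) = 0.
Proof.
have [B bB] := CinfX_bounded (CinfX_pd i f).
apply: ci01_pd bB; first exact: CinfX_zperiodic.
  exact/smooth_cderivable/CinfX_smooth.
exact: (CinfX_cscont (CinfX_pd i f)).
Qed.

Lemma CinfX_pdM i f g : CinfX_pd i (f * g) = CinfX_pd i f * g + f * CinfX_pd i g.
Proof. by apply: CinfX_eq => u; apply: pdM; exact: (CinfX_smooth _ [::]). Qed.

Lemma CinfX_pdC i j f : CinfX_pd i (CinfX_pd j f) = CinfX_pd j (CinfX_pd i f).
Proof. by apply: val_inj; apply: pd_comm; exact: CinfX_smooth. Qed.

Definition CinfX_pds (s : seq 'I_(n + n)) f : CinfX R n := foldr (@CinfX_pd R n) f s.

Lemma CinfX_pds_pd s i f : CinfX_pds s (CinfX_pd i f) = CinfX_pd i (CinfX_pds s f).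
Proof. by elim: s => //= j s ->; exact: CinfX_pdC. Qed.

Lemma CinfX_pdsC s s' f : CinfX_pds s (CinfX_pds s' f) = CinfX_pds s' (CinfX_pds s f).
Proof. by elim: s' => //= j s' <-; exact: CinfX_pds_pd. Qed.

Lemma integral_X_ibp s f g :
  integral_X (CinfX_pds s f * g) = (-1) ^+ size s * integral_X (f * CinfX_pds s g).
Proof.
elim: s f g => [|i s IH] f g; first by rewrite mul1r.
have := integral_X_pd i (CinfX_pds s f * g).
rewrite CinfX_pdM integral_XD IH CinfX_pds_pd /= exprS mulN1r mulNr.
by move/eqP; rewrite addr_eq0 => /eqP.
Qed.

Lemma iter_pdE (e : 'I_n -> 'I_(n + n)) I f : iter_pd e I f =
  CinfX_pds (flatten [seq nseq (I i) (e i) | i <- enum 'I_n]) f.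
Proof.
rewrite /iter_pd; elim: (enum 'I_n) => //= i s ->; rewrite /CinfX_pds foldr_cat.
by elim: (I i) => //= q ->.
Qed.

(** Moving all the y-derivatives off the first factor and then all the
x-derivatives off the second one produces the same sign twice, because there are
as many of either kind. *)
Lemma integral_X_iter_pd (I : 'I_n -> nat) f g :
  integral_X (iter_pd (@ycoord n) I f * iter_pd (@xcoord n) I g) =
  integral_X (iter_pd (@ycoord n) I g * iter_pd (@xcoord n) I f).
Proof.
rewrite !iter_pdE; set s := flatten _; set s' := flatten _.
have ss : size s = size s' by rewrite !size_flatten /shape -!map_comp; congr sumn;
  apply: eq_map => i /=; rewrite !size_nseq.
rewrite integral_X_ibp CinfX_pdsC mulrC.
rewrite [RHS](congr1 (@integral_X R n) (mulrC _ _)) integral_X_ibp ss.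
by rewrite mulrC.
Qed.

Lemma star_coef_trace j f g : integral_X (star_coef j f g) = integral_X (star_coef j g f).
Proof.
rewrite !integral_XZ !integral_X_sum; congr (_ * _); apply: eq_bigr => I _.
by rewrite !integral_XZ integral_X_iter_pd.
Qed.

End TorusFunctions.

(** * Sections in a gauge periodic along x *)

Section Twist.
Variables (R : realType) (n k : nat).
Implicit Types (t : GammaL R n k) (f : CinfX R n).

Lemma expi_piz (z : int) : expi (pi * z%:~R) = (-1) ^ z :> R[i].
Proof.
have e1 : expi pi = -1 :> R[i] by rewrite /expi cospi sinpi; apply: ReImP; rewrite /= ?oppr0.
have en m : expi (pi * m%:R) = (-1) ^+ m :> R[i] by rewrite mulrC expiMn e1.
case: z => m; first by rewrite -pmulrn en.
rewrite NegzE mulrNz -pmulrn mulrN expiN en -conjE rmorphXn rmorphN1 -invr_sign.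
exact: erefl.
Qed.

Lemma dot_lattice (x y : 'rV[R]_n) : \sum_(i < n) (row_mx x y) 0 (xcoord i) * (row_mx x y) 0 (ycoord i) =
  \sum_i x 0 i * y 0 i.
Proof. by apply: eq_bigr => i _; rewrite row_mxEl row_mxEr. Qed.

Lemma lattice_row_mx (a b : 'rV[int]_n) : lattice R (row_mx a b) = row_mx (map_mx intr a) (map_mx intr b).
Proof. by rewrite /lattice map_row_mx. Qed.

Lemma dot_int (a b : 'rV[int]_n) :
  (\sum_i a 0 i * b 0 i)%:~R = \sum_i (a 0 i)%:~R * (b 0 i)%:~R :> R.
Proof. by rewrite (big_morph intr (@intrD R) (erefl _)); apply: eq_bigr => i _; rewrite intrM. Qed.

Definition wbphase (x y : 'rV[R]_n) : R := k%:R * pi * \sum_i x 0 i * y 0 i.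

(** Multiplying by exp(k pi i x.y) makes the symmetric cocycle of the bundle
trivial in the x-directions; the sign alpha(lambda)^k absorbs the half-integral
phase k pi a.b. *)
Lemma multiplier_phase (a b : 'rV[int]_n) (x y : 'rV[R]_n) :
  expi (wbphase (x + map_mx intr a) (y + map_mx intr b)) * multiplier k (row_mx a b) (row_mx x y) =
  expi (2 * pi * (k%:R * \sum_i (b 0 i)%:~R * x 0 i)) * expi (wbphase x y).
Proof.
rewrite /multiplier /alpha -expi_piz -expiMn lattice_row_mx.
set z : int := \sum_i _.
have zE : z = \sum_i a 0 i * b 0 i by apply: eq_bigr => i _; rewrite row_mxEl row_mxEr.
rewrite -!expiD -[RHS]mul1r -(expi2piz R (k%:Z * z)) -expiD; congr expi.
rewrite /omega /wbphase intrM zE dot_int -pmulrn.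
rewrite (eq_bigr (fun i => x 0 i * y 0 i + (b 0 i)%:~R * x 0 i +
   ((a 0 i)%:~R * y 0 i + (a 0 i)%:~R * (b 0 i)%:~R))); last by move=> i _; rewrite !mxE; ring.
rewrite [X in - (_ * X)](eq_bigr (fun i => (a 0 i)%:~R * y 0 i - (b 0 i)%:~R * x 0 i)); last first.
  by move=> i _; rewrite !row_mxEl !row_mxEr !mxE; ring.
rewrite sumrB !big_split /=.
move: (\sum_i x 0 i * y 0 i) (\sum_i (b 0 i)%:~R * x 0 i) (\sum_i _ * y 0 i) (\sum_i _ * _).
by move=> A B C D; move: (pi : R) => p; ring.
Qed.

Lemma twistE t x y : twist t (row_mx x y) = expi (wbphase x y) * t (row_mx x y).
Proof. by rewrite /twist dot_lattice. Qed.

Lemma twist_lattice t (a b : 'rV[int]_n) (x y : 'rV[R]_n) :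
  twist t (row_mx (x + map_mx intr a) (y + map_mx intr b)) =
  expi (2 * pi * (k%:R * \sum_i (b 0 i)%:~R * x 0 i)) * twist t (row_mx x y).
Proof.
have /asboolP[_ tp] := GammaLP t.
rewrite !twistE -add_row_mx -lattice_row_mx tp mulrA multiplier_phase.
by rewrite mulrA.
Qed.

Lemma smooth_dot : smooth (fun u : 'rV[R]_(n + n) =>
  (k%:R * pi * \sum_(i < n) u 0 (xcoord i) * u 0 (ycoord i))%:C).
Proof.
have -> : (fun u : 'rV[R]_(n + n) => (k%:R * pi * \sum_(i < n) u 0 (xcoord i) * u 0 (ycoord i))%:C) =
   (k%:R * pi)%:C *: (fun u : 'rV[R]_(n + n) => \sum_(i < n) (u 0 (xcoord i))%:C * (u 0 (ycoord i))%:C).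
  apply/funext => u; rewrite fctE /GRing.scale /= rmorphM; congr (_ * _).
  by rewrite rmorph_sum; apply: eq_bigr => i _; rewrite rmorphM.
apply: smoothZ; apply: smooth_sum => i; apply: (@smoothM R _ (fun u => (u 0 (xcoord i))%:C)).
  exact: smooth_coord.
exact: smooth_coord.
Qed.

Lemma GammaL_smooth t : smooth t.
Proof. by have /asboolP[] := GammaLP t. Qed.

Lemma smooth_twist t : smooth (twist t).
Proof. by apply: smoothM (GammaL_smooth t); apply: smooth_expi; exact: smooth_dot. Qed.

Lemma cn_twist t u : cn (twist t u) = cn (t u).
Proof. by rewrite /twist cnM cn_expi mul1r. Qed.

Lemma cn_lattice t (l : 'rV[int]_(n + n)) u : cn (t (u + lattice R l)) = cn (t u).
Proof.
have /asboolP[_ ->] := GammaLP t.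
by rewrite cnM /multiplier /alpha -expi_piz -expiMn cnM !cn_expi !mul1r.
Qed.

(** The modulus of a section is periodic, and its square is smooth. *)
Lemma GammaL_bounded t : exists2 B, 0 <= B & bounded_by B t.
Proof.
pose f u := t u * conjc (t u).
have sf : smooth f by apply: smoothM; [exact: GammaL_smooth|apply: smooth_conj; exact: GammaL_smooth].
have pf : zperiodic f.
  move=> l u; rewrite /f; have := cn_lattice t l u.
  have H z : z * conjc z = (cn z ^+ 2)%:C by rewrite rmorphXn /= -cnE -normCK.
  by rewrite !H => ->.
have [B bB] := @zperiodic_bounded R _ f (sf [::]) pf.
exists (1 + B) => [|u].
  by rewrite addr_ge0// (le_trans _ (bB 0))// cn_ge0.
have := bB u; rewrite /f cnM cn_conj => h.
have := cn_ge0 (t u) => h0.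
have : 0 <= (cn (t u) - 1) ^+ 2 by exact: sqr_ge0.
nra.
Qed.

Lemma twist_bounded t : exists2 B, 0 <= B & bounded_by B (twist t).
Proof. by have [B B0 bB] := GammaL_bounded t; exists B => // u; rewrite cn_twist. Qed.

End Twist.

(** * The Weil-Brezin transform of a smooth section *)

Section WeilBrezin.
Variables (R : realType) (n k : nat).
Hypothesis k_gt0 : (0 < k)%N.
Implicit Types (t : GammaL R n k) (f : CinfX R n) (c : Zkn n k).

Let kn0 : k%:R != 0 :> R. Proof. by rewrite pnatr_eq0 -lt0n. Qed.

Lemma expi_map_int (p l : 'rV[int]_n) (x : 'rV[R]_n) :
  expi (2 * pi * \sum_i (p 0 i)%:~R * (x + map_mx intr l) 0 i) =
  expi (2 * pi * \sum_i (p 0 i)%:~R * x 0 i) :> R[i].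
Proof.
rewrite (eq_bigr (fun i => (p 0 i)%:~R * x 0 i + (p 0 i)%:~R * (l 0 i)%:~R)); last first.
  by move=> i _; rewrite !mxE mulrDr.
by rewrite big_split /= -dot_int (mulrDr (2 * pi)) expiD expi2piz mulr1.
Qed.

Lemma smooth_linear (a : R) (p : 'rV[R]_n) : smooth (fun x : 'rV[R]_n => (a * \sum_i p 0 i * x 0 i)%:C).
Proof.
have -> : (fun x : 'rV[R]_n => (a * \sum_i p 0 i * x 0 i)%:C) =
   (fun x : 'rV[R]_n => \sum_i (a * p 0 i)%:C * (x 0 i)%:C).
  apply/funext => x; rewrite big_distrr rmorph_sum; apply: eq_bigr => i _.
  by rewrite /= mulrA rmorphM.
apply: smooth_sum => i; apply: smoothM; first exact: smooth_cst.
exact: smooth_coord.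
Qed.

Lemma derive_linear (a : R) (p : 'rV[R]_n) i (x : 'rV[R]_n) :
  'D_(delta_mx 0 i) (fun x : 'rV[R]_n => a * \sum_i p 0 i * x 0 i) x = a * p 0 i.
Proof.
have -> : (fun x : 'rV[R]_n => a * \sum_i p 0 i * x 0 i) =
    \sum_j (a * p 0 j) *: (fun x : 'rV[R]_n => x 0 j).
  apply/funext => y; rewrite fct_sumE big_distrr; apply: eq_bigr => j _.
  by rewrite fctE /GRing.scale /= mulrA.
rewrite derive_sum; last by move=> j; apply: derivableZ; exact/diff_derivable/differentiable_coord.
rewrite (bigD1 i) //= big1 ?addr0 => [|j ji].
  rewrite deriveZ; last exact/diff_derivable/differentiable_coord.
  by rewrite derive_coord eqxx [LHS]mulr1.
rewrite deriveZ; last exact/diff_derivable/differentiable_coord.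
by rewrite derive_coord (negbTE ji) [LHS]mulr0.
Qed.

Lemma pd_xslice (f : 'rV[R]_(n + n) -> R[i]) i (x y : 'rV[R]_n) :
  pd i (fun x => f (row_mx x y)) x = pd (xcoord i) f (row_mx x y).
Proof.
pose L : 'M[R]_(n, n + n) := row_mx 1%:M 0.
have E (z : 'rV[R]_n) : row_mx z y = z *m L + row_mx 0 y.
  by rewrite /L mul_mx_row mulmx0 mulmx1 add_row_mx addr0 add0r.
under eq_fun do rewrite E.
rewrite E; apply: pd_affine; rewrite /L row_row_mx row1 row0.
apply/rowP => j; case: (split_ordP j) => j' ->.
  by rewrite row_mxEl !mxE eqxx /= (inj_eq (@lshift_inj _ _)).
by rewrite row_mxEr !mxE eqxx /= /xcoord eq_rlshift.
Qed.

Lemma smooth_xslice (f : 'rV[R]_(n + n) -> R[i]) (y : 'rV[R]_n) : smooth f ->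
  smooth (fun x => f (row_mx x y)).
Proof.
move=> sf; pose L : 'M[R]_(n, n + n) := row_mx 1%:M 0.
have -> : (fun x => f (row_mx x y)) = (fun x => f (x *m L + row_mx 0 y)).
  by apply/funext => z; rewrite /L mul_mx_row mulmx0 mulmx1 add_row_mx addr0 add0r.
apply: smooth_affine => // i; right; exists (xcoord i).
rewrite /L row_row_mx row1 row0.
apply/rowP => j; case: (split_ordP j) => j' ->.
  by rewrite row_mxEl !mxE eqxx /= (inj_eq (@lshift_inj _ _)).
by rewrite row_mxEr !mxE eqxx /= /xcoord eq_rlshift.
Qed.

Lemma smooth_yslice (f : 'rV[R]_(n + n) -> R[i]) (x s : 'rV[R]_n) : smooth f ->
  smooth (fun y => f (row_mx x (y + s))).
Proof.
move=> sf; pose L : 'M[R]_(n, n + n) := row_mx 0 1%:M.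
have -> : (fun y => f (row_mx x (y + s))) = (fun y => f (y *m L + row_mx x s)).
  by apply/funext => z; rewrite /L mul_mx_row mulmx0 mulmx1 add_row_mx add0r.
apply: smooth_affine => // i; right; exists (ycoord i).
rewrite /L row_row_mx row1 row0.
apply/rowP => j; case: (split_ordP j) => j' ->.
  by rewrite row_mxEl !mxE eqxx /= /ycoord eq_lrshift.
by rewrite row_mxEr !mxE eqxx /= (inj_eq (@rshift_inj _ _)).
Qed.

Lemma cscont_row_mx (T : topologicalType) (f : 'rV[R]_(n + n) -> R[i]) (p q : T -> 'rV[R]_n) :
  cscont f ->
  (forall (u : nat -> T) v, u m @[m --> \oo] --> v -> p (u m) @[m --> \oo] --> p v) ->
  (forall (u : nat -> T) v, u m @[m --> \oo] --> v -> q (u m) @[m --> \oo] --> q v) ->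
  cscont (fun v => f (row_mx (p v) (q v))).
Proof.
move=> cf cp cq; apply: (cscont_seq (g := fun v => row_mx (p v) (q v)) cf) => u v uv.
apply/cvg_rowP => i; case: (split_ordP i) => j ->.
  rewrite row_mxEl; under eq_cvg do rewrite row_mxEl.
  by have /cvg_rowP := cp _ _ uv; exact.
rewrite row_mxEr; under eq_cvg do rewrite row_mxEr.
by have /cvg_rowP := cq _ _ uv; exact.
Qed.

Definition zrow c : 'rV[int]_n := \row_i (c i : nat)%:Z.

Lemma Zkn_rowE c : Zkn_row R c = map_mx intr (zrow c).
Proof. by apply/rowP => i; rewrite !mxE -pmulrn. Qed.

Definition yshift c : 'rV[R]_n := hbar R k *: Zkn_row R c.

Definition wb_char c (x : 'rV[R]_n) : R[i] := expi (- (2 * pi * \sum_(i < n) Zkn_row R c 0 i * x 0 i)).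

Definition wb_integrand t c (y x : 'rV[R]_n) : R[i] :=
  twist t (row_mx x (y + yshift c)) * wb_char c x.

Lemma weil_brezinE t c y : weil_brezin t c y = integral_unit_cube (wb_integrand t c y).
Proof. by []. Qed.

Lemma wb_char_periodic c : zperiodic (wb_char c).
Proof.
move=> l x; rewrite /wb_char !expiN; congr conjc.
have E (z : 'rV[R]_n) : \sum_(i < n) Zkn_row R c 0 i * z 0 i = \sum_i (zrow c 0 i)%:~R * z 0 i.
  by apply: eq_bigr => i _; rewrite Zkn_rowE mxE.
by rewrite !E expi_map_int.
Qed.

Lemma smooth_wb_char c : smooth (wb_char c).
Proof.
have -> : wb_char c = (fun x => expi (- (2 * pi) * \sum_(i < n) Zkn_row R c 0 i * x 0 i)).
  by apply/funext => x; rewrite mulNr.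
by apply: smooth_expi; exact: smooth_linear.
Qed.

Lemma wb_integrand_zperiodic t c y : zperiodic (wb_integrand t c y).
Proof.
move=> l x; rewrite /wb_integrand wb_char_periodic; congr (_ * _).
have -> : y + yshift c = (y + yshift c) + map_mx intr (0 : 'rV[int]_n).
  by apply/rowP => i; rewrite !mxE addr0.
rewrite twist_lattice big1 => [|i _]; last by rewrite mxE mul0r.
by rewrite mulr0 mulr0 expi0 mul1r; congr twist; congr row_mx; apply/rowP => i; rewrite !mxE addr0.
Qed.

Lemma smooth_wb_integrand t c y : smooth (wb_integrand t c y).
Proof.
by apply: smoothM (smooth_wb_char c); apply: smooth_xslice; exact: smooth_twist.
Qed.

Lemma wb_integrand_bounded t c : exists2 B, 0 <= B & forall y, bounded_by B (wb_integrand t c y).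
Proof.
have [B B0 bB] := twist_bounded t; exists B => // y x.
by rewrite /wb_integrand cnM cn_expi mulr1.
Qed.

Lemma weil_brezinD t t' a c y :
  weil_brezin (a *: t + t') c y = a * weil_brezin t c y + weil_brezin t' c y.
Proof.
have [[B _ bB] [B' _ bB']] := (wb_integrand_bounded t c, wb_integrand_bounded t' c).
have [st st'] := (smooth_cscont (smooth_wb_integrand t c y), smooth_cscont (smooth_wb_integrand t' c y)).
rewrite !weil_brezinE -(ci01Z _ st (bB y)) -(ciD (adm01 R)).
- congr integral_cube; apply/funext => x; rewrite /wb_integrand /twist.
  set e := expi _; set e' := wb_char _ _; set u := row_mx _ _.
  have -> : (a *: t + t') u = a * t u + t' u by [].
  ring.
- apply: (@cok01 R _ (cn a * B)); first by apply: cscontM => //; exact: cscont_cst.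
  by move=> x; rewrite cnM; apply: ler_pM (cn_ge0 _) (cn_ge0 _) (lexx _) (bB y x).
- exact: cok01 (bB' y).
Qed.

(** The ordinary x-derivative of the integrand differs from the covariant one by
2 pi i k times the y-coordinate, the character accounting for the shift of y by
c/k. *)
Lemma pd_wb_integrand t c i y x : pd i (wb_integrand t c y) x =
  (0 +i* (2 * pi * (k%:R * y 0 i))) * wb_integrand t c y x + wb_integrand (nabla (xcoord i) t) c y x.
Proof.
have st := smooth_twist t.
have sx := smooth_xslice (y + yshift c) st.
rewrite /wb_integrand (@pdM R n i (fun x => twist t (row_mx x (y + yshift c))) (wb_char c) x
  (sx [::] x) (smooth_wb_char c [::] x)).
rewrite pd_xslice.
have dl : differentiable (fun x : 'rV[R]_n => - (2 * pi) * \sum_(i < n) Zkn_row R c 0 i * x 0 i) x.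
  by have [] := smooth_linear (- (2 * pi)) (Zkn_row R c) [::] x.
have -> : pd i (wb_char c) x = (0 +i* (- (2 * pi) * Zkn_row R c 0 i)) * wb_char c x.
  have -> : wb_char c = (fun x => expi (- (2 * pi) * \sum_(i < n) Zkn_row R c 0 i * x 0 i)).
    by apply/funext => z; rewrite mulNr.
  by rewrite (pd_expi i dl) derive_linear.
set u := row_mx x _.
pose q (u : 'rV[R]_(n + n)) := k%:R * pi * \sum_(i < n) u 0 (xcoord i) * u 0 (ycoord i).
have dq : differentiable q u by have [] := @smooth_dot R n k [::] u.
have Dq : 'D_(delta_mx 0 (xcoord i)) q u = k%:R * pi * u 0 (ycoord i).
  have := congr1 (@complex.Re R) (pd_xslice (fun u => (q u)%:C) i x (y + yshift c)) => /= <-.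
  have -> : (fun w : 'rV[R]_n => q (row_mx w (y + yshift c))) =
      (fun w => (k%:R * pi) * \sum_j (y + yshift c) 0 j * w 0 j).
    apply/funext => w; congr (_ * _); apply: eq_bigr => j _.
    by rewrite row_mxEl row_mxEr mulrC.
  by rewrite derive_linear row_mxEr.
have -> : pd (xcoord i) (twist t) u = (0 +i* (k%:R * pi * u 0 (ycoord i))) * twist t u + expi (q u) * pd (xcoord i) t u.
  rewrite /twist (@pdM R _ _ (fun u => expi (q u)) t u (cdiff_expi dq) (GammaL_smooth t [::] u)).
  by rewrite (pd_expi _ dq) Dq mulrA.
have -> : twist (nabla (xcoord i) t) u = expi (q u) * (pd (xcoord i) t u - (0 +i* (k%:R * pi * u 0 (ycoord i))) * t u).
  rewrite /twist /=; congr (_ * (_ - _ * _)); congr (_ +i* (_ * _)).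
  rewrite /omega (bigD1 i) //= big1 => [|j ji].
    by rewrite !mxE !eqxx /= eq_rlshift mulr1 mulr0 subr0 addr0.
  by rewrite !mxE /= (inj_eq (@lshift_inj _ _)) (negbTE ji) eq_rlshift !mulr0 subrr.
have uy : u 0 (ycoord i) = y 0 i + k%:R^-1 * Zkn_row R c 0 i by rewrite row_mxEr !mxE.
have -> : twist t u = expi (q u) * t u by [].
rewrite uy; set z := Zkn_row R c 0 i; set e := expi _; set e' := wb_char c x.
have -> : 0 +i* (k%:R * pi * (y 0 i + k%:R^-1 * z)) =
   0 +i* (k%:R * pi * y 0 i) + 0 +i* (pi * z) :> R[i].
  by simpc; congr (_ +i* _); rewrite mulrDr; congr (_ + _); field.
have -> : 0 +i* (- (2 * pi) * z) = - (2 * (0 +i* (pi * z))) :> R[i].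
  by simpc; congr (_ +i* _); ring.
have -> : 0 +i* (2 * pi * (k%:R * y 0 i)) = 2 * (0 +i* (k%:R * pi * y 0 i)) :> R[i].
  by simpc; congr (_ +i* _); ring.
move: (0 +i* _) (0 +i* _) => A B; ring.
Qed.

(** The integral of the x-derivative of a periodic function vanishes, so
covariant differentiation along x becomes multiplication by - 2 pi i k y. *)
Lemma weil_brezin_nabla t c i y : weil_brezin (nabla (xcoord i) t) c y =
  - (0 +i* (2 * pi * (k%:R * y 0 i))) * weil_brezin t c y.
Proof.
set a := 0 +i* _; set t' := nabla _ t.
have [[B _ bB] [B' _ bB']] := (wb_integrand_bounded t c, wb_integrand_bounded t' c).
have st := smooth_cscont (smooth_wb_integrand t c y).
have st' := smooth_cscont (smooth_wb_integrand t' c y).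
have E : pd i (wb_integrand t c y) = (fun x => a * wb_integrand t c y x + wb_integrand t' c y x).
  by apply/funext => x; exact: pd_wb_integrand.
have baB : bounded_by (cn a * B) (fun x => a * wb_integrand t c y x).
  by move=> x; rewrite cnM; apply: ler_pM (cn_ge0 _) (cn_ge0 _) (lexx _) (bB y x).
have sa : cscont (fun x => a * wb_integrand t c y x) by apply: cscontM => //; exact: cscont_cst.
have : integral_unit_cube (pd i (wb_integrand t c y)) = 0.
  apply: (@ci01_pd R n (cn a * B + B')).
  - exact: wb_integrand_zperiodic.
  - exact/smooth_cderivable/smooth_wb_integrand.
  - exact/smooth_cscont/smooth_pd/smooth_wb_integrand.
  - by move=> x; rewrite E; apply: le_trans (cnD _ _) (lerD (baB x) (bB' y x)).
have H : integral_unit_cube (fun x => a * wb_integrand t c y x + wb_integrand t' c y x) =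
    a * weil_brezin t c y + weil_brezin t' c y.
  apply: etrans (ciD (adm01 R) (cok01 sa baB) (cok01 st' (bB' y))) _.
  by congr (_ + _); apply: ci01Z (bB y).
by rewrite E H mulNr => /eqP; rewrite addrC addr_eq0 => /eqP.
Qed.

Lemma weil_brezin_bounded t c : exists2 B, 0 <= B & bounded_by B (weil_brezin t c).
Proof.
have [B B0 bB] := wb_integrand_bounded t c; exists (2 * B) => [|y]; first by rewrite mulr_ge0.
by apply: ci01_bound (bB y); exact/smooth_cscont/smooth_wb_integrand.
Qed.

(** The operator 1 - (nabla_i / 2 pi k)^2, which multiplies Weil-Brezin
coefficients by 1 + y_i^2. *)
Definition elliptic i t : GammaL R n k :=
  (- ((2 * pi * k%:R) ^- 2)%:C) *: nabla (xcoord i) (nabla (xcoord i) t) + t.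

Lemma weil_brezin_elliptic i t c y :
  weil_brezin (elliptic i t) c y = (oneDsqr (y 0 i))%:C * weil_brezin t c y.
Proof.
rewrite /elliptic weil_brezinD !weil_brezin_nabla.
set W := weil_brezin t c y; rewrite !mulrA -[X in _ + X]mul1r -mulrDl; congr (_ * _).
have p0 : (2 * pi * k%:R) != 0 :> R by rewrite !mulf_neq0// gt_eqF// pi_gt0.
have pp : pi != 0 :> R by rewrite gt_eqF// pi_gt0.
move: (pi : R) pp => p pp.
by apply: ReImP; rewrite /oneDsqr /=; field; rewrite ?pp ?kn0.
Qed.

(** Applying the operators elliptic i for all i multiplies the coefficient by
the inverse of the weight, and the result is still the coefficient of a smooth
section, hence bounded. *)
Lemma weil_brezin_decay t c : exists2 M, 0 <= M &
  forall y, cn (weil_brezin t c y) <= M * wprod (@wR R) y.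
Proof.
pose Et := foldr elliptic t (enum 'I_n).
have EE y : weil_brezin Et c y = (\prod_i oneDsqr (y 0 i))%:C * weil_brezin t c y.
  rewrite -big_enum /=; rewrite /Et; elim: (enum 'I_n) => [|i s IH]; first by rewrite big_nil mul1r.
  by rewrite big_cons /= weil_brezin_elliptic IH rmorphM mulrA.
have [M M0 bM] := weil_brezin_bounded Et c; exists M => // y.
have P0 : 0 < \prod_i oneDsqr (y 0 i).
  by apply: prodr_gt0 => i _; rewrite /oneDsqr ltr_wpDr// sqr_ge0.
rewrite /wprod /wR prodfV ler_pdivlMr//.
by have := bM y; rewrite EE cnM cn_real (gtr0_norm P0) mulrC.
Qed.

End WeilBrezin.

(** * Polarized sections and Poisson summation for coefficients *)

Section Polarized.
Variables (R : realType) (n k : nat).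
Hypothesis k_gt0 : (0 < k)%N.
Implicit Types (t : GammaL R n k) (f : CinfX R n) (c m : Zkn n k).

Let kn0 : k%:R != 0 :> R. Proof. by rewrite pnatr_eq0 -lt0n. Qed.

Definition basis_scale : R := 2 `^ (n%:R / 4) * k%:R `^ (n%:R / 2).
Definition theta_scale : R := (2 * k%:R) `^ (- (n%:R / 2)).
Definition check_scale : R := 2 `^ (- (n%:R / 2)).

Lemma sigmaE m t : sigma m t = (basis_scale * theta_scale)%:C * conjc (weil_brezin t m 0).
Proof.
have -> : sigma m t = basis_scale%:C * theta m t by [].
have -> : (basis_scale * theta_scale)%:C = basis_scale%:C * theta_scale%:C by exact: rmorphM.
rewrite -mulrA; congr (_ * _); rewrite /theta /of_weil_brezin.
by rewrite (bigD1 m) //= eqxx big1 ?addr0 // => m' /negbTE ->.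
Qed.

Lemma yshift01 c i : 0 <= yshift R c 0 i <= 1.
Proof.
rewrite !mxE mulr_ge0 ?invr_ge0//= ler_pdivrMl ?ltr0n// mulr1 ler_nat.
exact: ltnW.
Qed.

(** At y = 0 only the points (x, c/k) matter, and they can be brought into the
unit cube by translating x alone; this is what makes sigma continuous for
seminorms on the cube. *)
Lemma wb_integrand0_bound t m M :
  (forall u, unit_cube u -> `|t u| <= M%:C) -> bounded_by M (wb_integrand t m 0).
Proof.
move=> bt x; rewrite /wb_integrand cnM cn_expi mulr1 cn_twist add0r.
pose a : 'rV[int]_n := \row_i Num.floor (x 0 i).
pose x' : 'rV[R]_n := x - map_mx intr a.
have -> : row_mx x (yshift R m) = row_mx x' (yshift R m) + lattice R (row_mx a 0).
  rewrite lattice_row_mx add_row_mx subrK; congr row_mx.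
  by apply/rowP => i; rewrite !mxE addr0.
rewrite cn_lattice cn_le; apply: bt => j; case: (split_ordP j) => i ->.
  rewrite row_mxEl !mxE subr_ge0 floor_le_tmp /= lerBlDl.
  by have := ltW (floorD1_gt (x 0 i)); rewrite intrD addrC.
by rewrite row_mxEr; exact: yshift01.
Qed.

Lemma sigma_distributional m : distributional (@sigma R n k m).
Proof.
split=> [c t t'|].
  rewrite !sigmaE weil_brezinD; move: (_ * theta_scale)%:C => K.
  by rewrite -!conjE rmorphD rmorphM mulrDr; congr (_ + _); exact: mulrCA.
exists (`|basis_scale * theta_scale| * 2), 0%N => t M bM.
rewrite -cn_le sigmaE cnM cn_real cn_conj -[leRHS]mulrA.
apply: ler_pM (normr_ge0 _) (cn_ge0 _) (lexx _) _.
apply: ci01_bound; first exact/smooth_cscont/smooth_wb_integrand.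
by apply: wb_integrand0_bound => u; exact: (bM [::]).
Qed.

(** Covariant differentiation along x multiplies the coefficients by a multiple
of y_i, and sigma only sees their values at y = 0. *)
Lemma sigma_polarized m : polarized (@sigma R n k m).
Proof.
split=> [|xi]; first exact: sigma_distributional.
apply: big1 => i _; apply/funext => t; rewrite /dmul /dnabla sigmaE weil_brezin_nabla//.
by rewrite mxE !mulr0 oppr0 mul0r -conjE rmorph0 mulr0 oppr0.
Qed.

Lemma cscont_wb_pair t c : cscont (fun p : 'rV[R]_n * 'rV[R]_n => wb_integrand t c p.2 p.1).
Proof.
have H : cscont (fun p : 'rV[R]_n * 'rV[R]_n => twist t (row_mx p.1 (p.2 + yshift R c))).
  apply: cscont_row_mx; first exact/smooth_cscont/smooth_twist.
  - by move=> u v uv; exact: cvg_seq_fst uv.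
  - by move=> u v uv; apply: cvgD; [exact: cvg_seq_snd uv|exact: cvg_cst].
have H' : cscont (fun p : 'rV[R]_n * 'rV[R]_n => wb_char c p.1).
  apply: (cscont_seq (g := fun p : 'rV[R]_n * 'rV[R]_n => p.1) (smooth_cscont (smooth_wb_char c))).
  by move=> u v uv; exact: cvg_seq_fst uv.
exact: cscontM H H'.
Qed.

(** The x-derivative of the integrand grows linearly in y, which is harmless for
y_i in [0, 1]. *)
Lemma wb_integrand_lip t c : exists2 K, 0 <= K & forall i (s : R) (x y : 'rV[R]_n), 0 <= y 0 i <= 1 ->
  cn (wb_integrand t c y (x + s *: delta_mx 0 i) - wb_integrand t c y x) <= K * `|s|.
Proof.
have [B B0 bB] := wb_integrand_bounded t c.
have H i : exists2 B', 0 <= B' & forall y, bounded_by B' (wb_integrand (nabla (xcoord i) t) c y).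
  exact: wb_integrand_bounded.
pose B' i := projT1 (cid2 (H i)).
have B'0 i : 0 <= B' i by rewrite /B'; case: cid2.
have bB' i y : bounded_by (B' i) (wb_integrand (nabla (xcoord i) t) c y).
  by rewrite /B'; case: cid2 => /= b _ H2; exact: H2.
have p0 : 0 <= 2 * pi * k%:R :> R by rewrite !mulr_ge0// pi_ge0.
exists (2 * (2 * pi * k%:R * B + \sum_i B' i)).
  by rewrite mulr_ge0// addr_ge0 ?sumr_ge0// mulr_ge0.
move=> i s x y /andP[y0 y1]; apply: pd_lip; first exact: smooth_wb_integrand.
move=> r; rewrite pd_wb_integrand//; apply: le_trans (cnD _ _) _; apply: lerD.
  rewrite cnM; apply: ler_pM; [exact: cn_ge0|exact: cn_ge0| |exact: bB].
  apply: le_trans (cn_ReIm _) _; rewrite /= normr0 add0r mulrA normrM (ger0_norm p0).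
  by rewrite ger0_norm// ler_piMr.
apply: (le_trans (bB' i y _)); rewrite (bigD1 i) //= lerDl.
by apply: sumr_ge0.
Qed.

Lemma poisson_weil_brezin (a : 'rV[R]_n -> R[i]) t c : smooth a -> zperiodic a ->
  integral_Rn (fun y => a y * weil_brezin t c y) =
  cavg k (fun x => wb_char c x *
    integral_unit_cube (fun y => a y * twist t (row_mx x (y + yshift R c)))).
Proof.
move=> sa pa; have [A bA] := zperiodic_bounded (sa [::]) pa.
have A0 : 0 <= A by exact: le_trans (cn_ge0 _) (bA 0).
have ca := smooth_cscont sa.
have [B B0 bB] := wb_integrand_bounded t c.
have [K K0 lK] := wb_integrand_lip t c.
have [M M0 bM] := weil_brezin_decay k_gt0 t c.
have cw y := smooth_cscont (smooth_wb_integrand t c y).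
have Gx y : integral_unit_cube (fun x => a y * wb_integrand t c y x) = a y * weil_brezin t c y.
  exact: ci01Z (cw y) (bB y).
transitivity (integral_Rn (fun y => integral_unit_cube (fun x => a y * wb_integrand t c y x))).
  by congr integral_Rn; apply/funext => y; rewrite Gx.
rewrite (@poisson_sum R k n (fun x y => a y * wb_integrand t c y x) (A * B) (A * K) (A * M)) //; last first.
  split.
  - apply: cscontM; last exact: cscont_wb_pair.
    by apply: (cscont_seq (g := fun p : 'rV[R]_n * 'rV[R]_n => p.2) ca) => u v uv; exact: cvg_seq_snd uv.
  - by move=> x y; rewrite cnM; apply: ler_pM (cn_ge0 _) (cn_ge0 _) (bA y) (bB y x).
  - by move=> l x y; rewrite wb_integrand_zperiodic.
  - move=> l x y; rewrite pa /wb_integrand.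
    have -> : twist t (row_mx x (y + map_mx intr l + yshift R c)) =
      twist t (row_mx (x + map_mx intr (0 : 'rV[int]_n)) ((y + yshift R c) + map_mx intr l)).
      congr twist; congr row_mx; first by apply/rowP => i; rewrite !mxE addr0.
      by rewrite addrAC.
    by rewrite twist_lattice -!mulrA mulrCA.
  - move=> i s x y y01; rewrite -mulrBr cnM -mulrA.
    exact: ler_pM (cn_ge0 _) (cn_ge0 _) (bA y) (lK _ _ _ _ y01).
  - move=> y; rewrite Gx cnM -mulrA.
    exact: ler_pM (cn_ge0 _) (cn_ge0 _) (bA y) (bM y).
congr cavg; apply/funext => x.
have [B' _ bB'] := twist_bounded t.
rewrite -(ci01Z _ (B := A * B')); last 2 first.
- apply: cscontM => //; apply: cscont_row_mx.
  + exact/smooth_cscont/smooth_twist.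
  + by move=> u v uv; exact: cvg_cst.
  + by move=> u v uv; apply: cvgD => //; exact: cvg_cst.
- by move=> y; rewrite cnM; apply: ler_pM (cn_ge0 _) (cn_ge0 _) (bA y) (bB' _).
congr integral_unit_cube; apply/funext => y.
by rewrite /wb_integrand mulrA mulrC.
Qed.

End Polarized.

(** * Test functions *)

Section TestFunctions.
Variable R : realType.
Local Notation Re := complex.Re.
Local Notation Im := complex.Im.

Lemma test_mul N (g phi : 'rV[R]_N -> R[i]) : smooth g -> test_function phi -> test_function (g * phi).
Proof.
move=> sg [sp [r Hr]]; split; first exact: smoothM.
by exists r => y yr; rewrite fctE Hr// mulr0.
Qed.

Lemma test_conj N (phi : 'rV[R]_N -> R[i]) : test_function phi -> test_function (fun y => conjc (phi y)).
Proof.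
move=> [sp [r Hr]]; split; first exact: smooth_conj.
by exists r => y yr; rewrite Hr// -conjE rmorph0.
Qed.

Lemma test_pd N (phi : 'rV[R]_N -> R[i]) i : test_function phi -> test_function (pd i phi).
Proof.
move=> [sp [r Hr]]; split; first exact: smooth_pd.
exists r => y yr.
have n0 : \near y, phi y = 0.
  have oy : nbhs `|y| [set x : R | r < x] by apply: open_nbhs_nbhs; split; [exact: open_gt|].
  have ny : nbhs y [set z : 'rV[R]_N | r < `|z|] := @norm_continuous R 'rV[R]_N y _ oy.
  by apply: filterS ny => z; exact: Hr.
rewrite /pd; have H (g : R[i] -> R) : g 0 = 0 -> 'D_(delta_mx 0 i) (fun w => g (phi w)) y = 0.
  move=> g0; rewrite (@near_eq_derive _ _ _ _ (cst 0)) ?derive_cst//.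
  by apply: filterS n0 => z ->.
by rewrite !H.
Qed.

Lemma test_bounded N (phi : 'rV[R]_N -> R[i]) : test_function phi -> exists2 B, 0 <= B & bounded_by B phi.
Proof.
move=> [sp [r Hr]].
pose A := [set v : 'rV[R]_N | forall i, `[- (1 + `|r|), 1 + `|r|]%classic (v ord0 i)].
have cA : compact A by apply: (@rV_compact R N (fun=> `[- (1 + `|r|), 1 + `|r|]%classic)) => i; exact: segment_compact.
have A0 : A !=set0 by exists 0 => i /=; rewrite mxE in_itv/= oppr_le0 andbb addr_ge0.
have bnd (g : 'rV[R]_N -> R) : continuous g -> exists C, forall v, A v -> `|g v| <= C.
  move=> cg; have cn : continuous (fun v => `|g v|).
    by move=> v; apply: (@continuous_comp _ _ _ g (fun x : R => `|x|)); [exact: cg|exact: norm_continuous].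
  have [c _ Hc] := EVT_max_rV A0 cA (continuous_subspaceT cn).
  by exists `|g c| => v Av; apply: Hc; rewrite inE.
have [C1 H1] : exists C, forall v, A v -> `|Re (phi v)| <= C.
  by apply: bnd => u; apply: differentiable_continuous; have [] := sp [::] u.
have [C2 H2] : exists C, forall v, A v -> `|Im (phi v)| <= C.
  by apply: bnd => u; apply: differentiable_continuous; have [] := sp [::] u.
have [z Az] := A0.
have C0 : 0 <= C1 + C2.
  by apply: addr_ge0; [exact: le_trans (normr_ge0 _) (H1 z Az)|exact: le_trans (normr_ge0 _) (H2 z Az)].
exists (C1 + C2) => // u.
have [Au|nAu] := pselect (A u); first by rewrite (le_trans (cn_ReIm _))// lerD ?H1 ?H2.
rewrite Hr ?cn0// ltNge; apply/negP => ur; apply: nAu => i /=.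
have : `|u 0 i| <= 1 + `|r|.
  rewrite (@le_trans _ _ `|u|)//.
    rewrite [leRHS]/Num.Def.normr/= mx_normrE.
    exact: (le_bigmax _ (fun ij => `|u ij.1 ij.2|) (0, i)).
  by rewrite (le_trans ur)// (le_trans (ler_norm r))// lerDr.
by rewrite in_itv /= -ler_norml.
Qed.

Lemma smooth_weight N : smooth (fun y : 'rV[R]_N => (\prod_i oneDsqr (y 0 i))%:C).
Proof.
have -> : (fun y : 'rV[R]_N => (\prod_i oneDsqr (y 0 i))%:C) =
   (fun y => \prod_i (cst 1 + (fun y : 'rV[R]_N => (y 0 i)%:C) * (fun y : 'rV[R]_N => (y 0 i)%:C)) y).
  apply/funext => y; rewrite rmorph_prod; apply: eq_bigr => i _.
  by rewrite !fctE /oneDsqr expr2 rmorphD rmorphM.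
apply: smooth_prod => i; apply: smoothD; first exact: smooth_cst.
by apply: smoothM; exact: smooth_coord.
Qed.

Lemma weight_gt0 N (y : 'rV[R]_N) : 0 < \prod_i oneDsqr (y 0 i).
Proof. by apply: prodr_gt0 => i _; rewrite /oneDsqr ltr_wpDr// sqr_ge0. Qed.

Lemma test_decay N (phi : 'rV[R]_N -> R[i]) : test_function phi ->
  exists2 M, 0 <= M & cdom (@wR R) M phi.
Proof.
move=> /(test_mul (@smooth_weight N))/test_bounded[M M0 bM]; exists M => // y.
rewrite /wprod /wR prodfV ler_pdivlMr ?weight_gt0//.
by have := bM y; rewrite fctE cnM cn_real (gtr0_norm (weight_gt0 _)) mulrC.
Qed.

Lemma test_cok N (phi : 'rV[R]_N -> R[i]) : test_function phi -> cok (@wR R) phi.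
Proof.
move=> tp; split; first by apply: smooth_cscont; have [] := tp.
by have [M _ dM] := test_decay tp; exists M.
Qed.

Lemma test_schwartz N (phi : 'rV[R]_N -> R[i]) : test_function phi -> schwartz phi.
Proof.
move=> tp; split=> [|a b]; first by have [] := tp.
have tb : test_function (pds b phi) by elim: b => //= i b; exact: test_pd.
have sa : smooth (fun y : 'rV[R]_N => (\prod_(i <- a) y 0 i)%:C).
  have -> : (fun y : 'rV[R]_N => (\prod_(i <- a) y 0 i)%:C) = (fun y => \prod_(i <- a) (y 0 i)%:C).
    by apply/funext => y; rewrite rmorph_prod.
  by apply: smooth_prod => i; exact: smooth_coord.
by have [M _ bM] := test_bounded (test_mul sa tb); exists M => y; rewrite -cn_le; exact: bM.
Qed.

Lemma rcube_zero N M (f : 'rV[R]_N -> R) : scont f -> dom (@wR R) M f -> (forall x, 0 <= f x) ->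
  rcube setT f = 0 -> forall x, f x = 0.
Proof.
elim: N M f => [|N IH] M f sf df f0 If x.
  by rewrite -[RHS]If /=; congr f; apply/rowP => -[].
have okf : ok (@wR R) f by split=> //; exists M.
have [s1 [M1 d1]] := ok_slice (admR R) okf.
have g0 (z : R) : 0 <= rcube setT (fun v : 'rV[R]_N => f (rcons1 z v)) by apply: rcube_ge0 => v; exact: f0.
have gz := rint_zero s1 d1 g0 If.
rewrite (rcons1_surj x); apply: (IH (M * @wR R (x 0 ord0)) (fun v => f (rcons1 (x 0 ord0) v))).
- exact: scont_rcons1.
- exact: dom_rcons1.
- by move=> v; exact: f0.
- exact: gz.
Qed.

(** Test the difference d of the two functions against conj(d) times a bump
function: the integrand is nonnegative, and its value at 0 is the squared
modulus of d(0). *)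
Lemma represented_eq0 N (h h' : 'rV[R]_N -> R[i]) : smooth h -> smooth h' ->
  (forall phi, test_function phi -> distribution_of h phi = distribution_of h' phi) -> h 0 = h' 0.
Proof.
move=> sh sh' H; pose d := h - h'.
have sd : smooth d by rewrite /d -[- h']scaleN1r; apply: smoothD => //; exact: smoothZ.
pose phi := (fun y => conjc (d y)) * @bumpfun R N.
have tp : test_function phi by apply: test_mul; [exact: smooth_conj|exact: bumpfun_test].
pose q y := Re (d y * phi y).
have qE y : d y * phi y = (q y)%:C /\ 0 <= q y.
  have [r r0 E] := bumpfun_real y.
  have -> : d y * phi y = (cn (d y) ^+ 2 * r)%:C.
    rewrite /phi fctE mulrA E rmorphM; congr (_ * _).
    by rewrite rmorphXn /= -cnE -normCK.
  have -> : q y = cn (d y) ^+ 2 * r.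
    rewrite /q /phi fctE mulrA E.
    have -> : d y * conjc (d y) = (cn (d y) ^+ 2)%:C by rewrite rmorphXn /= -cnE -normCK.
    by rewrite -rmorphM.
  by split=> //; rewrite mulr_ge0// sqr_ge0.
have okd : cok (@wR R) (d * phi) by apply/test_cok/test_mul.
have I0 : integral_Rn (d * phi) = 0.
  have -> : d * phi = (fun y => (h * phi) y - (h' * phi) y).
    by apply/funext => y; rewrite /d !fctE mulrBl.
  apply: etrans (ciB (admR R) (test_cok (test_mul sh tp)) (test_cok (test_mul sh' tp))) _.
  by apply/eqP; rewrite subr_eq0; apply/eqP; exact: H.
have [sq [M dq]] := cok_Re okd.
have qz : forall y, q y = 0.
  apply: (@rcube_zero N M) => //; first by move=> y; have [] := qE y.
  by have := congr1 (@complex.Re R) I0; rewrite /integral_Rn integral_cubeE.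
have := qE 0; rewrite qz => -[E _]; apply/eqP; rewrite -subr_eq0; apply/eqP.
have : d 0 * conjc (d 0) = 0 by move: E; rewrite /phi fctE bumpfun0 mulr1.
have -> : d 0 * conjc (d 0) = (cn (d 0) ^+ 2)%:C by rewrite rmorphXn /= -cnE -normCK.
by move/(congr1 (@complex.Re R)) => /= /eqP; rewrite sqrf_eq0 => /eqP/cn_eq0.
Qed.

End TestFunctions.

(** * Sections with a prescribed coefficient *)

Section InverseWeilBrezin.
Variables (R : realType) (n k : nat).
Hypothesis k_gt0 : (0 < k)%N.
Implicit Types (c : Zkn n k) (q : 'rV[int]_n) (phi : 'rV[R]_n -> R[i]).

Definition sec_freq c q : 'rV[int]_n := \row_i ((c i : nat)%:Z + k%:Z * q 0 i).

(** The q-th term of the section: in the gauge periodic along x it has frequency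
c + k q, and it is the translate by q of the given function. *)
Definition sec_term c phi (x y : 'rV[R]_n) q : R[i] :=
  phi (y - yshift R c - map_mx intr q) *
  expi (2 * pi * \sum_i (sec_freq c q 0 i)%:~R * x 0 i).

Definition sec_sum c phi (x y : 'rV[R]_n) : R[i] :=
  \sum_(q \in [set: 'rV[int]_n]) sec_term c phi x y q.

Definition box (N : nat) : seq 'rV[int]_n :=
  [seq (\row_i ((j i : nat)%:Z - N%:Z)) | j : {ffun 'I_n -> 'I_(N.*2.+1)} <- enum {: {ffun 'I_n -> 'I_(N.*2.+1)}}].

Lemma box_uniq N : uniq (box N).
Proof.
rewrite map_inj_uniq ?enum_uniq// => f g /rowP fg; apply/ffunP => i.
by have := fg i; rewrite !mxE => /addIr[] /val_inj.
Qed.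

Lemma box_mem N q : (forall i, `|q 0 i| <= N%:Z) -> q \in box N.
Proof.
move=> qN; apply/mapP.
have b i : (absz (q 0 i + N%:Z)%R < N.*2.+1)%N by have := qN i; lia.
exists [ffun i => Ordinal (b i)]; first by rewrite mem_enum.
by apply/rowP => i; rewrite mxE ffunE /=; have := qN i; lia.
Qed.

Lemma row_norm_ge N (v : 'rV[R]_N) i : `|v 0 i| <= `|v|.
Proof.
rewrite [leRHS]/Num.Def.normr/= mx_normrE.
exact: (le_bigmax _ (fun ij => `|v ij.1 ij.2|) (0, i)).
Qed.

(** Near a given y only finitely many translates meet the compact support, so
that the series is locally a finite sum over a fixed box of frequencies. *)
Lemma sec_sum_box c phi r rho N (x y : 'rV[R]_n) : (forall y, r < `|y| -> phi y = 0) ->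
  `|y| <= rho -> rho + 1 + r <= N%:R ->
  sec_sum c phi x y = \sum_(q <- box N) sec_term c phi x y q.
Proof.
move=> Hr yr rN; rewrite /sec_sum (fsbigE (box N)) ?box_uniq//.
  by apply: eq_bigl => q; rewrite in_setT.
move=> q _ qN; rewrite /sec_term Hr ?mul0r//.
have [i Hi] : exists i, N%:Z < `|q 0 i|.
  apply: contrapT => /forallNP H; move/negP: qN; apply; apply: box_mem => i.
  by rewrite leNgt; apply/negP; exact: H.
apply: lt_le_trans (row_norm_ge _ i); rewrite !mxE.
have qi : N%:R + 1 <= `|(q 0 i)%:~R| :> R.
  rewrite -intr_norm -[N%:R + 1]/(_) natr1 pmulrn ler_int; lia.
have yi := le_trans (row_norm_ge y i) yr.
have /andP[s0 s1] := yshift01 R k_gt0 c i; rewrite !mxE in s0 s1.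
set s := hbar R k * _ in s0 s1 *; set z := (q 0 i)%:~R in qi *.
have := ler_normD (z - y 0 i + s) (y 0 i - s).
rewrite [X in `|X| <= _](_ : _ = z) => [h1|]; last by ring.
have h2 : `|y 0 i - s| <= rho + 1.
  by rewrite (le_trans (ler_normB _ _))// lerD// ger0_norm.
have -> : y 0 i - s - z = - (z - y 0 i + s) by ring.
rewrite normrN; lra.
Qed.

(** Translating y by b shifts the summation index by b, and thus the frequency
by k b. *)
Lemma sec_sum_lattice c phi (a b : 'rV[int]_n) (x y : 'rV[R]_n) :
  sec_sum c phi (x + map_mx intr a) (y + map_mx intr b) =
  expi (2 * pi * (k%:R * \sum_i (b 0 i)%:~R * x 0 i)) * sec_sum c phi x y.
Proof.
rewrite /sec_sum (reindex_fsbigT (fun q => q + b)) /=; last first.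
  by exists (fun q => q - b) => q; rewrite ?addrK ?subrK.
rewrite mulr_fsumr; apply: eq_fsbigr => q _; rewrite /sec_term expi_map_int.
rewrite mulrCA; congr (_ * _).
  congr phi; apply/rowP => i; rewrite !mxE intrD; ring.
rewrite -expiD -[X in _ = expi X]mulrDr; congr (expi (_ * _)).
rewrite big_distrr -big_split /=; apply: eq_bigr => i _.
have -> : sec_freq c (q + b) 0 i = k%:Z * b 0 i + sec_freq c q 0 i.
  by rewrite /sec_freq !mxE; ring.
by rewrite intrD intrM -pmulrn; ring.
Qed.

Definition sec_fun c phi (u : 'rV[R]_(n + n)) : R[i] :=
  expi (- wbphase k (lsubmx u) (rsubmx u)) * sec_sum c phi (lsubmx u) (rsubmx u).

Lemma sec_fun_row_mx c phi x y : sec_fun c phi (row_mx x y) =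
  expi (- wbphase k x y) * sec_sum c phi x y.
Proof. by rewrite /sec_fun row_mxKl row_mxKr. Qed.

Lemma sec_fun_lattice c phi l u :
  sec_fun c phi (u + lattice R l) = multiplier k l u * sec_fun c phi u.
Proof.
rewrite -(hsubmxK u) -(hsubmxK l); move: (lsubmx u) (rsubmx u) (lsubmx l) (rsubmx l) => x y a b.
rewrite lattice_row_mx add_row_mx !sec_fun_row_mx sec_sum_lattice.
have := multiplier_phase k a b x y.
set e := expi (wbphase k _ _); set m := multiplier _ _ _; set f := expi (2 * pi * _).
set w := expi (wbphase k x y) => E.
have ne : expi (- wbphase k (x + map_mx intr a) (y + map_mx intr b)) = e^-1.
  by apply: (mulfI (expi_neq0 (wbphase k (x + map_mx intr a) (y + map_mx intr b))));
    rewrite -expiD subrr expi0 divff// expi_neq0.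
have nw : expi (- wbphase k x y) = w^-1.
  by apply: (mulfI (expi_neq0 (wbphase k x y))); rewrite -expiD subrr expi0 divff// expi_neq0.
have e0 : e != 0 by exact: expi_neq0.
have w0 : w != 0 by exact: expi_neq0.
rewrite ne nw !mulrA; congr (_ * _).
have -> : f = e * m / w by rewrite E mulfK.
by rewrite !mulrA mulVf// mul1r.
Qed.

Lemma smooth_sec_term c phi q : smooth phi ->
  smooth (fun u : 'rV[R]_(n + n) => sec_term c phi (lsubmx u) (rsubmx u) q).
Proof.
move=> sp; pose L : 'M[R]_(n + n, n) := col_mx 0 1%:M.
have H1 : smooth (fun u : 'rV[R]_(n + n) => phi (rsubmx u - yshift R c - map_mx intr q)).
  have -> : (fun u : 'rV[R]_(n + n) => phi (rsubmx u - yshift R c - map_mx intr q)) =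
     (fun u => phi (u *m L + (- yshift R c - map_mx intr q))).
    apply/funext => u; rewrite -[in RHS](hsubmxK u) mul_row_col mulmx0 mulmx1 add0r.
    by rewrite addrA.
  apply: smooth_affine => // i; case: (split_ordP i) => j ->.
    by left; rewrite /L rowKu row0.
  by right; exists j; rewrite /L rowKd row1.
have H2 : smooth (fun u : 'rV[R]_(n + n) => expi (2 * pi * \sum_i (sec_freq c q 0 i)%:~R * lsubmx u 0 i)).
  apply: smooth_expi.
  have -> : (fun u : 'rV[R]_(n + n) => (2 * pi * \sum_i (sec_freq c q 0 i)%:~R * lsubmx u 0 i)%:C) =
    (fun u => \sum_i (2 * pi * (sec_freq c q 0 i)%:~R)%:C * (u 0 (lshift n i))%:C).
    apply/funext => u; rewrite big_distrr rmorph_sum; apply: eq_bigr => i _ /=.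
    by rewrite [lsubmx _ _ _]mxE mulrA rmorphM.
  apply: smooth_sum => i; apply: smoothM; first exact: smooth_cst.
  exact: smooth_coord.
exact: smoothM H1 H2.
Qed.

Lemma smooth_sec_fun c phi : test_function phi -> smooth (sec_fun c phi).
Proof.
move=> [sp [r Hr]]; apply: smooth_local => u.
pose rho := `|u| + 1; pose N := (Num.truncn (rho + 1 + `|r|)).+1.
have rN : rho + 1 + r <= N%:R.
  by rewrite (le_trans _ (ltW (truncnS_gt _)))// lerD2l ler_norm.
exists (fun v => expi (- wbphase k (lsubmx v) (rsubmx v)) *
    \sum_(q <- box N) sec_term c phi (lsubmx v) (rsubmx v) q).
  apply: (@smoothM R _ (fun v => expi (- wbphase k (lsubmx v) (rsubmx v)))); last first.
    by apply: smooth_sum => q; exact: smooth_sec_term.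
  apply: smooth_expi.
  have -> : (fun v : 'rV[R]_(n + n) => (- wbphase k (lsubmx v) (rsubmx v))%:C) =
     (-1) *: (fun u : 'rV[R]_(n + n) => (k%:R * pi * \sum_(i < n) u 0 (xcoord i) * u 0 (ycoord i))%:C).
    apply/funext => v; rewrite fctE scaleN1r -rmorphN; congr ((- _)%:C); rewrite /wbphase.
    by congr (_ * _); apply: eq_bigr => i _; rewrite !mxE.
  by apply: smoothZ; exact: smooth_dot.
have n1 : nbhs u [set v | `|u - v| < 1].
  by apply/nbhs_ballP; exists 1 => //= v; rewrite -ball_normE.
apply: filterS n1 => v /= uv; rewrite /sec_fun (@sec_sum_box c phi r rho N) //.
rewrite (@le_trans _ _ `|v|)//.
  rewrite [leLHS]/Num.Def.normr/= mx_normrE; apply/bigmax_leP; split=> // -[a i] _ /=.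
  by rewrite mxE (ord1 a); exact: row_norm_ge.
rewrite /rho -lerBlDl (le_trans (lerB_dist _ _))// distrC; exact: ltW.
Qed.

Lemma wb_section_subproof c phi : test_function phi -> sec_fun c phi \in @smooth_section R n k.
Proof.
move=> tp; apply/asboolP; split; first exact: smooth_sec_fun.
by move=> l u; exact: sec_fun_lattice.
Qed.

Definition wb_section c phi (tp : test_function phi) : GammaL R n k := MkGammaL (wb_section_subproof c tp).

Lemma twist_wb_section c phi (tp : test_function phi) x y :
  twist (wb_section c tp) (row_mx x y) = sec_sum c phi x y.
Proof.
rewrite twistE [wb_section _ _ _]sec_fun_row_mx mulrA -expiD subrr expi0 mul1r.
by [].
Qed.

(** Integration over x selects the frequency c', and c + k q = c' with 0 <= c,
c' < k forces c = c' and q = 0. *)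
Lemma weil_brezin_wb_section c c' phi (tp : test_function phi) y :
  weil_brezin (wb_section c tp) c' y = if c' == c then phi y else 0.
Proof.
have [sp [r Hr]] := tp; have [B B0 bB] := test_bounded tp.
set y' := y + yshift R c'.
pose N := (Num.truncn (`|y'| + 1 + `|r|)).+1.
have rN : `|y'| + 1 + r <= N%:R.
  by rewrite (le_trans _ (ltW (truncnS_gt _)))// lerD2l ler_norm.
pose p q := sec_freq c q - zrow c'.
have E : wb_integrand (wb_section c tp) c' y = (fun x => \sum_(q <- box N)
    phi (y' - yshift R c - map_mx intr q) *
    expi (2 * pi * \sum_i (p q 0 i)%:~R * x 0 i)).
  apply/funext => x; rewrite /wb_integrand twist_wb_section (@sec_sum_box c phi r `|y'| N) //.
  rewrite big_distrl; apply: eq_bigr => q _ /=; rewrite /sec_term -mulrA; congr (_ * _).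
  rewrite /wb_char -expiD; congr expi; rewrite -[LHS]mulrBr; congr (_ * _).
  rewrite -sumrB; apply: eq_bigr => i _; rewrite Zkn_rowE /p !mxE intrB; ring.
rewrite weil_brezinE E.
have bt q : bounded_by B (fun x : 'rV[R]_n => phi (y' - yshift R c - map_mx intr q) *
    expi (2 * pi * \sum_i (p q 0 i)%:~R * x 0 i)).
  by move=> x; rewrite cnM cn_expi mulr1.
rewrite (ci01_sum _ _ bt); last by move=> q; apply: cscontM; [exact: cscont_cst|exact: cscont_char].
have Eq q : integral_unit_cube (fun x : 'rV[R]_n => phi (y' - yshift R c - map_mx intr q) *
    expi (2 * pi * \sum_i (p q 0 i)%:~R * x 0 i)) =
    phi (y' - yshift R c - map_mx intr q) * (p q == 0)%:R.
  rewrite (ci01Z _ (B := 1)) ?ci01_expi//; first exact: cscont_char.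
  by move=> x; rewrite cn_expi.
under eq_bigr do rewrite Eq.
case: eqP => [cc|cc].
  rewrite (bigD1_seq 0) ?box_uniq//=; last by apply: box_mem => i; rewrite mxE.
  rewrite big1 => [|q q0].
    have -> : p 0 = 0 by apply/rowP => i; rewrite !mxE cc mulr0 addr0 subrr.
    rewrite eqxx mulr1 addr0; congr phi; rewrite /y' cc addrK.
    by apply/rowP => i; rewrite !mxE subr0.
  case: eqP => [pq|]; last by rewrite mulr0.
  case/eqP: q0; apply/rowP => i; have /rowP/(_ i) := pq.
  rewrite !mxE cc addrAC subrr add0r => /eqP; rewrite mulf_eq0 => /orP[|/eqP//].
  by rewrite eqz_nat => /eqP k0; move: k_gt0; rewrite k0.
rewrite big1 // => q _; case: eqP => [pq|]; last by rewrite mulr0.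
case: cc; apply/ffunP => i; apply: ord_inj; have /rowP/(_ i) := pq.
rewrite !mxE; have := ltn_ord (c i); have := ltn_ord (c' i).
have kz : 0 < k%:Z by rewrite ltz_nat.
move: (nat_of_ord (c i)) (nat_of_ord (c' i)) (q 0 i) => a b z /= bk ak Ez.
have [z0|z0|z0] := ltrgtP z 0.
- have : k%:Z * z <= k%:Z * (-1) by rewrite ler_pM2l//; lia.
  lia.
- have : k%:Z * 1 <= k%:Z * z by rewrite ler_pM2l//; lia.
  lia.
- by move: Ez; rewrite z0 mulr0; lia.
Qed.

End InverseWeilBrezin.

(** * Tempered distributions given by bounded functions *)

Section TemperedWeights.
Variables (R : realType) (n : nat).
Implicit Types (phi h : 'rV[R]_n -> R[i]).

Definition sqword (S : {set 'I_n}) : seq 'I_n := flatten [seq [:: i; i] | i <- enum S].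

Lemma size_sqword S : (size (sqword S) <= n.*2)%N.
Proof.
have -> : size (sqword S) = (size (enum S)).*2.
  by rewrite /sqword; elim: (enum S) => //= i s ->; rewrite doubleS.
by rewrite leq_double -cardE -[X in (_ <= X)%N]card_ord max_card.
Qed.

Lemma prod_sqword S (y : 'rV[R]_n) : \prod_(i <- sqword S) y 0 i = \prod_(i in S) y 0 i ^+ 2.
Proof.
rewrite /sqword -big_enum /=; elim: (enum S) => [|i s IH] /=; first by rewrite !big_nil.
by rewrite !big_cons IH mulrA expr2.
Qed.

(** With S the set of the coordinates of y larger than 1 in modulus, prod (1 +
y_i^2) is at most 2^n prod_(i in S) y_i^2. Since S depends on y, all the
monomials of this type are used, but their degree is at most 2n. *)
Lemma schwartz_weight phi M : (forall S y, cn (schwartz_term (sqword S) [::] phi y) <= M) ->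
  cdom (@wR R) (2 ^+ n * M) phi.
Proof.
move=> H y; rewrite /wprod /wR prodfV ler_pdivlMr ?weight_gt0//.
pose S := [set i | 1 < `|y 0 i|]%SET.
have := H S y; rewrite /schwartz_term /= cnM cn_real prod_sqword => HS.
rewrite mulrC; apply: (@le_trans _ _ (2 ^+ n * `|\prod_(i in S) y 0 i ^+ 2| * cn (phi y))).
  apply: ler_wpM2r; first exact: cn_ge0.
  rewrite -[X in 2 ^+ X]card_ord -prodr_const [X in _ <= _ * `|X|]big_mkcond normr_prod -big_split /=.
  apply: ler_prod => i _; apply/andP; split; first by rewrite /oneDsqr addr_ge0// sqr_ge0.
  rewrite /oneDsqr; case: ifPn; rewrite inE.
    rewrite normrX => y1; have : 1 <= `|y 0 i| ^+ 2 by rewrite exprn_ege1// ltW.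
    rewrite -(real_normK (num_real (y 0 i))); lra.
  rewrite -leNgt normr1 mulr1 => y1; have : `|y 0 i| ^+ 2 <= 1 by rewrite exprn_ile1.
  rewrite -(real_normK (num_real (y 0 i))); lra.
by rewrite -mulrA ler_wpM2l// exprn_ge0.
Qed.

Lemma schwartz_cok phi : schwartz phi -> cok (@wR R) phi.
Proof.
move=> [sp dp]; split; first exact: smooth_cscont.
have H S : exists M : R, forall y, cn (schwartz_term (sqword S) [::] phi y) <= M.
  by have [M HM] := dp (sqword S) [::]; exists M => y; rewrite cn_le.
pose M S := projT1 (cid (H S)).
have HM S y : cn (schwartz_term (sqword S) [::] phi y) <= M S by rewrite /M; case: cid.
exists (2 ^+ n * \sum_S `|M S|); apply: schwartz_weight => S y.
apply: le_trans (HM S y) _; rewrite (bigD1 S) //= (le_trans (ler_norm _))// lerDl.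
by apply: sumr_ge0.
Qed.

Lemma tempered_distribution_of h B : cscont h -> bounded_by B h -> tempered (distribution_of h).
Proof.
move=> ch bh; have B0 : 0 <= B by exact: le_trans (cn_ge0 _) (bh 0).
have okh phi : schwartz phi -> cok (@wR R) (fun y => h y * phi y).
  by move=> sp; apply: cokM bh _ => //; exact: schwartz_cok.
split=> [c phi psi sp ss|].
  rewrite /distribution_of /integral_Rn.
  have -> : h * (c *: phi + psi) = (fun y => c * (h y * phi y) + h y * psi y).
    by apply/funext => y; rewrite !fctE mulrDr [h y * (c *: _)]mulrCA.
  rewrite (ciD (admR R) (cokZ _ (okh _ sp)) (okh _ ss)); congr (_ + _).
  apply: (ciZ (admR R)); exact: okh.
exists (2 * (B * 2 ^+ n * rint setT (@wR R) ^+ n)), n.*2 => phi M sp bM.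
rewrite -cn_le /distribution_of.
have dp : cdom (@wR R) (2 ^+ n * M) phi.
  by apply: schwartz_weight => S y; rewrite cn_le; apply: bM => //; exact: size_sqword.
have -> : 2 * (B * 2 ^+ n * rint setT (@wR R) ^+ n) * M =
  2 * ((B * (2 ^+ n * M)) * rint setT (@wR R) ^+ n) by ring.
apply: (ci_bound (admR R)); first by have [] := okh _ sp.
move=> y; rewrite fctE cnM -mulrA; apply: ler_pM (cn_ge0 _) (cn_ge0 _) (bh y) (dp y).
Qed.

End TemperedWeights.

(** * Orthogonality of characters modulo k *)

Section Orthogonality.
Variables (R : realType) (n k : nat).
Hypothesis k_gt0 : (0 < k)%N.
Implicit Types (b c j l : Zkn n k).

Let kn0 : k%:R != 0 :> R. Proof. by rewrite pnatr_eq0 -lt0n. Qed.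

(** A geometric sum of roots of unity. *)
Lemma root_sum (d : int) : \sum_(a < k) expi (2 * pi * (a%:R * (d%:~R / k%:R))) =
  if (k %| absz d)%N then k%:R else 0 :> R[i].
Proof.
set z := expi (2 * pi * (d%:~R / k%:R)) : R[i].
have E (a : nat) : expi (2 * pi * (a%:R * (d%:~R / k%:R))) = z ^+ a.
  by rewrite -expiMn; congr expi; exact: mulrCA.
under eq_bigr do rewrite E.
have zk : z ^+ k = 1 by rewrite -E [k%:R * _]mulrC divfK// expi2piz.
case: ifPn => kd.
  have -> : z = 1.
    have /dvdnP[q dq] := kd; rewrite /z.
    have [s ds] : exists s : int, d = s * k%:Z.
      by case: (intP d) dq => [|m|m] dq; [exists 0|exists q%:Z|exists (- q%:Z)]; lia.
    by rewrite ds intrM -pmulrn mulfK// expi2piz.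
  by under eq_bigr do rewrite expr1n; rewrite sumr_const card_ord.
have z1 : z != 1.
  apply: contra kd => /eqP z1; have [s] := expi_lower (d%:~R / k%:R : R).
  rewrite -/z z1 subrr cn0 normr_le0 subr_eq0 => /eqP ds.
  have : d%:~R = (s * k%:Z)%:~R :> R by rewrite intrM -pmulrn -ds divfK.
  by move=> /intr_inj ->; rewrite abszM dvdn_mull.
have := subrX1 z k; rewrite zk subrr => /esym/eqP; rewrite mulf_eq0 subr_eq0 (negbTE z1) /=.
by move/eqP.
Qed.

Lemma wb_char_orth j l : \sum_(c : Zkn n k) wb_char c (yshift R j) * conjc (wb_char c (yshift R l)) =
  (k%:R ^+ n) * (j == l)%:R :> R[i].
Proof.
have E c : wb_char c (yshift R j) * conjc (wb_char c (yshift R l)) =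
   \prod_i expi (2 * pi * ((c i)%:R * (((l i : nat)%:Z - (j i : nat)%:Z)%:~R / k%:R))) :> R[i].
  rewrite /wb_char -expiN opprK -expiD -expi_sum; congr expi.
  rewrite addrC -[LHS]mulrBr -mulr_sumr; congr (_ * _); rewrite -sumrB; apply: eq_bigr => i _.
  rewrite !mxE /hbar intrB -!pmulrn; field; exact: kn0.
under eq_bigr do rewrite E.
rewrite -(bigA_distr_bigA (fun i (a : 'I_k) => expi (2 * pi * (a%:R * (((l i : nat)%:Z - (j i : nat)%:Z)%:~R / k%:R))))).
under eq_bigr do rewrite root_sum.
have [->|jl] := eqVneq j l.
  rewrite mulr1 (eq_bigr (fun=> k%:R)) ?prodr_const ?card_ord// => i _.
  by rewrite subrr dvdn0.
rewrite mulr0; have [i ji] : exists i, j i != l i.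
  by apply/existsP; apply: contraNT jl => /existsPn H; apply/eqP/ffunP => i; apply/eqP; have := H i; rewrite negbK.
rewrite (bigD1 i) //= ifN ?mul0r//; apply/negP => /dvdnP[q].
have := ltn_ord (j i); have := ltn_ord (l i); move: ji; rewrite -(inj_eq val_inj) /=.
move: (nat_of_ord (j i)) (nat_of_ord (l i)) => a b ab bk ak E'.
have q0 : (q = 0)%N by apply/eqP; rewrite -leqn0 leqNgt; apply/negP => q1; nia.
by move: E'; rewrite q0; lia.
Qed.

End Orthogonality.

(** * Coefficients of the dual polarization times a function *)

Section Coefficients.
Variables (R : realType) (n k : nat).
Hypothesis k_gt0 : (0 < k)%N.
Implicit Types (t : GammaL R n k) (f : CinfX R n) (b c j l m : Zkn n k).

Let kn0 : k%:R != 0 :> R. Proof. by rewrite pnatr_eq0 -lt0n. Qed.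

Local Notation KC := ((basis_scale R n k * check_scale R n)%:C).
Local Notation pt := (@yshift R n k).

(** The c-th coefficient of conj(f) times the basis vector sigma_check^b.
Multiplication by conj(f) mixes the frequencies in x; the coefficients only see
them modulo k, hence the finite Fourier sum over the torsion points l/k. *)
Definition hcoef f b c (y : 'rV[R]_n) : R[i] := KC * ((k%:R^-1)%:C ^+ n * \sum_l
  (conjc (f (row_mx (pt l) (y + pt c))) * (conjc (wb_char b (pt l)) * wb_char c (pt l)))).

Lemma smooth_hcoef f b c : smooth (hcoef f b c).
Proof.
have H l : smooth (fun y => conjc (f (row_mx (pt l) (y + pt c))) * (conjc (wb_char b (pt l)) * wb_char c (pt l))).
  apply: (@smoothM R n (fun y => conjc (f (row_mx (pt l) (y + pt c)))) (cst _)); last exact: smooth_cst.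
  by apply: smooth_conj; apply: smooth_yslice; exact: CinfX_smooth.
exact: (smoothZ KC (smoothZ _ (smooth_sum _ H))).
Qed.

Lemma zperiodic_yslice f (x s : 'rV[R]_n) : zperiodic (fun y => f (row_mx x (y + s))).
Proof.
move=> q y; rewrite addrAC -[RHS](CinfX_zperiodic f (row_mx 0 q)).
rewrite -/(lattice R _) lattice_row_mx add_row_mx; congr (f (row_mx _ _)).
by apply/rowP => i; rewrite !mxE addr0.
Qed.

Lemma zperiodic_hcoef f b c : zperiodic (hcoef f b c).
Proof.
move=> q y; rewrite /hcoef; congr (_ * (_ * _)); apply: eq_bigr => l _.
by have := zperiodic_yslice f (pt l) (pt c) q y => /= ->.
Qed.

Lemma hcoef_tempered f b c : tempered (distribution_of (hcoef f b c)).
Proof.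
have [B bB] := zperiodic_bounded (smooth_hcoef f b c [::]) (zperiodic_hcoef f b c).
exact: tempered_distribution_of (smooth_cscont (smooth_hcoef f b c)) bB.
Qed.

(** Translating y by q multiplies by exp(2 pi i k q.x), which is 1 at k-torsion
points x. *)
Lemma zperiodic_twist t j : zperiodic (fun y => twist t (row_mx (pt j) y)).
Proof.
move=> q y; have := twist_lattice t 0 q (pt j) y.
have -> : pt j + map_mx intr (0 : 'rV[int]_n) = pt j by apply/rowP => i; rewrite !mxE addr0.
move=> ->; have -> : k%:R * \sum_i (q 0 i)%:~R * pt j 0 i = (\sum_i q 0 i * zrow j 0 i)%:~R :> R.
  rewrite dot_int big_distrr; apply: eq_bigr => i _ /=; rewrite !mxE /hbar -pmulrn.
  by field; exact: kn0.
by rewrite expi2piz mul1r.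
Qed.

(** The integral over the y-torus of f on the fibre x = l/k against the section
on the fibre x = j/k. The integrals with l <> j only occur before summation over
the coefficients, which cancels them. *)
Definition cross_int t f l j : R[i] :=
  integral_unit_cube (fun y => f (row_mx (pt l) y) * twist t (row_mx (pt j) y)).

Lemma cross_int_shift t f l j c : integral_unit_cube (fun y =>
  f (row_mx (pt l) (y + pt c)) * twist t (row_mx (pt j) (y + pt c))) = cross_int t f l j.
Proof.
have [[B bB] [B' _ bB']] := (CinfX_bounded f, twist_bounded t).
apply: (@ci01_shift R n (B * B') (fun y => f (row_mx (pt l) y) * twist t (row_mx (pt j) y))).
- have E : (fun y : 'rV[R]_n => y + 0) = id by apply/funext => y; rewrite addr0.
  apply: cscontM.
    have := smooth_yslice (pt l) 0 (CinfX_smooth f) => /smooth_cscont.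
    by under eq_fun do rewrite addr0.
  have := smooth_yslice (pt j) 0 (smooth_twist t) => /smooth_cscont.
  by under eq_fun do rewrite addr0.
- by move=> y; rewrite cnM; apply: ler_pM (cn_ge0 _) (cn_ge0 _) (bB _) (bB' _).
- move=> q y; congr (_ * _); last exact: zperiodic_twist.
  have := zperiodic_yslice f (pt l) 0 q y => /=; rewrite !addr0; exact.
Qed.

Lemma cavg_pt (F : 'rV[R]_n -> R[i]) : cavg k F = (k%:R^-1)%:C ^+ n * \sum_(j : Zkn n k) F (pt j).
Proof. exact: cavgE. Qed.

Lemma cok_weil_brezin t c : cok (@wR R) (weil_brezin t c).
Proof.
split; last by have [M _ HM] := weil_brezin_decay k_gt0 t c; exists M.
have [B _ bB] := wb_integrand_bounded t c.
apply: (cscont_ci01 (B := B) (F := wb_integrand t c)); last exact: bB.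
apply: (cscont_seq (g := fun p : 'rV[R]_n * 'rV[R]_n => (p.2, p.1)) (cscont_wb_pair t c)) => u v uv.
by apply: cvg_seq_pair; [exact: cvg_seq_snd uv|exact: cvg_seq_fst uv].
Qed.

Lemma integral_weil_brezin f t b : integral_Rn (weil_brezin (mul_section f t) b) =
  (k%:R^-1)%:C ^+ n * \sum_j wb_char b (pt j) * cross_int t f j j.
Proof.
transitivity (integral_Rn (fun y => (cst 1 : 'rV[R]_n -> R[i]) y * weil_brezin (mul_section f t) b y)).
  by congr integral_Rn; apply/funext => y; rewrite mul1r.
rewrite poisson_weil_brezin ?cavg_pt//; last exact: smooth_cst.
congr (_ * _); apply: eq_bigr => j _; congr (_ * _); rewrite -(cross_int_shift _ _ _ _ b).
congr integral_unit_cube; apply/funext => y; rewrite mul1r /twist /= mulrCA.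
by [].
Qed.

Lemma integral_hcoef f t b c : integral_Rn (fun y => conjc (hcoef f b c y) * weil_brezin t c y) =
  KC * ((k%:R^-1)%:C ^+ n * \sum_j \sum_l (k%:R^-1)%:C ^+ n *
     (wb_char b (pt l) * cross_int t f l j * (wb_char c (pt j) * conjc (wb_char c (pt l))))).
Proof.
have sh := smooth_conj (smooth_hcoef f b c).
rewrite poisson_weil_brezin //; last by move=> q y; rewrite /= zperiodic_hcoef.
rewrite cavg_pt mulrCA; congr (_ * _); rewrite mulr_sumr; apply: eq_bigr => j _.
have [[B bB] [B' _ bB']] := (CinfX_bounded f, twist_bounded t).
pose F l y := f (row_mx (pt l) (y + pt c)) * twist t (row_mx (pt j) (y + pt c)).
have sF l : cscont (F l).
  apply: cscontM; apply: smooth_cscont; apply: smooth_yslice; [exact: CinfX_smooth|exact: smooth_twist].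
have bF l : bounded_by (B * B') (F l).
  by move=> y; rewrite cnM; apply: ler_pM (cn_ge0 _) (cn_ge0 _) (bB _) (bB' _).
pose a l := KC * (k%:R^-1)%:C ^+ n * (wb_char b (pt l) * conjc (wb_char c (pt l))).
have E : (fun y => conjc (hcoef f b c y) * twist t (row_mx (pt j) (y + pt c))) =
    (fun y => \sum_l a l * F l y).
  apply/funext => y.
  have cM (z w : R[i]) : conjc (z * w) = conjc z * conjc w by rewrite -!conjE rmorphM.
  have cX : conjc ((k%:R^-1)%:C ^+ n) = (k%:R^-1)%:C ^+ n :> R[i] by rewrite -rmorphXn conjc_real.
  rewrite /hcoef !cM conjc_real cX -[conjc (\sum_l _)]conjE rmorph_sum.
  rewrite [X in X * _](_ : _ = \sum_l a l * f (row_mx (pt l) (y + pt c))); last first.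
    rewrite !mulr_sumr; apply: eq_bigr => l _; rewrite [X in _ * (_ * X)]conjE !cM !conjcK /a.
    by move: KC => K; ring.
  by rewrite big_distrl; apply: eq_bigr => l _; rewrite /F mulrA.
rewrite E (ci01_sum _ (B := fun l => cn (a l) * (B * B'))); last 2 first.
- by move=> l; apply: cscontM => //; exact: cscont_cst.
- by move=> l y; rewrite cnM; apply: ler_pM (cn_ge0 _) (cn_ge0 _) (lexx _) (bF l y).
rewrite !mulr_sumr; apply: eq_bigr => l _.
rewrite (ci01Z _ (sF l) (bF l)) cross_int_shift /a; move: KC (conjc _) (cross_int _ _ _ _) => K z J; ring.
Qed.

(** After Poisson summation both sides are sums over torsion points: a double
sum on the left, whose off-diagonal terms vanish upon summation over c by
orthogonality of characters, and a single sum on the right. *)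
Lemma sum_integral_hcoef f t b :
  \sum_c integral_Rn (fun y => conjc (hcoef f b c y) * weil_brezin t c y) =
  KC * integral_Rn (weil_brezin (mul_section f t) b).
Proof.
under eq_bigr do rewrite integral_hcoef.
rewrite -!mulr_sumr integral_weil_brezin; congr (_ * (_ * _)).
transitivity (\sum_j \sum_l (j == l)%:R * (wb_char b (pt l) * cross_int t f l j)).
  rewrite exchange_big; apply: eq_bigr => j _; rewrite exchange_big; apply: eq_bigr => l _.
  rewrite -!mulr_sumr; have O := wb_char_orth R k_gt0 j l.
  have -> : \sum_(c : Zkn n k) wb_char c (pt j) * conjc (wb_char c (pt l)) = (k%:R ^+ n) * (j == l)%:R := O.
  have kk : (k%:R^-1)%:C ^+ n * k%:R ^+ n = 1 :> R[i].
    have -> : k%:R = (k%:R : R)%:C :> R[i] by rewrite rmorph_nat.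
    by rewrite -exprMn -rmorphM mulVf// expr1n.
  by rewrite mulrCA (mulrA _ (k%:R ^+ n)) kk mul1r mulrC.
apply: eq_bigr => j _; rewrite (bigD1 j) //= eqxx mul1r big1 ?addr0// => l lj.
by rewrite eq_sym (negbTE lj) mul0r.
Qed.

Lemma sigma_checkE b t : sigma_check b t = KC * conjc (integral_Rn (weil_brezin t b)).
Proof.
have -> : sigma_check b t = (basis_scale R n k)%:C * theta_check b t by [].
have -> : KC = (basis_scale R n k)%:C * (check_scale R n)%:C by exact: rmorphM.
rewrite -mulrA; congr (_ * _); rewrite /theta_check /of_weil_brezin.
have E m' (z : R[i]) : distribution_of (cst z) (fun y => conjc (weil_brezin t m' y)) =
    z * conjc (integral_Rn (weil_brezin t m')).
  rewrite /distribution_of; have ok := cok_weil_brezin t m'.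
  rewrite -(ci_conj (admR R) ok); exact: (ciZ (admR R) z (cok_conj ok)).
under eq_bigr do rewrite E.
by rewrite (bigD1 b) //= eqxx big1 ?addr0 // => m' /negbTE ->; rewrite mul0r.
Qed.

Lemma sigma_check_weil_brezin f b : dmul (CinfX_conj f) (sigma_check b) =
  of_weil_brezin (fun c => distribution_of (hcoef f b c)).
Proof.
apply/funext => t; rewrite /dmul sigma_checkE.
have -> : mul_section (CinfX_conj (CinfX_conj f)) t = mul_section f t.
  congr mul_section; apply: CinfX_eq => u; exact: conjcK.
have -> : KC = conjc KC by rewrite conjc_real.
rewrite -!conjE -rmorphM -sum_integral_hcoef rmorph_sum; apply: eq_bigr => c _ /=.
have ok : cok (@wR R) (fun y => conjc (hcoef f b c y) * weil_brezin t c y).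
  have [B bB] := zperiodic_bounded (smooth_hcoef f b c [::]) (zperiodic_hcoef f b c).
  apply: (cokM (B := B)); [|by move=> y; rewrite cn_conj; exact: bB|exact: cok_weil_brezin].
  by apply: cscont_conj; exact/smooth_cscont/smooth_hcoef.
rewrite conjE -(ci_conj (admR R) ok); congr integral_cube; apply/funext => y.
have cM (z w : R[i]) : conjc (z * w) = conjc z * conjc w by rewrite -!conjE rmorphM.
by rewrite cM conjcK.
Qed.

End Coefficients.

(** * The pairing and the trace *)

Section Pairing.
Variables (R : realType) (n k : nat).
Hypothesis k_gt0 : (0 < k)%N.
Implicit Types (t : GammaL R n k) (f : CinfX R n) (b c j l m : Zkn n k).
Implicit Types (S T : Zkn n k -> ('rV[R]_n -> R[i]) -> R[i]).

Lemma conjcM (z w : R[i]) : conjc (z * w) = conjc z * conjc w.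
Proof. by rewrite -!conjE rmorphM. Qed.

Lemma conjc_sum (I : finType) (F : I -> R[i]) : conjc (\sum_i F i) = \sum_i conjc (F i).
Proof. by rewrite -conjE rmorph_sum. Qed.

Lemma test0 N : test_function (fun _ : 'rV[R]_N => 0 : R[i]).
Proof. by split; [exact: smooth0|exists 0]. Qed.

Lemma tempered0 (T : ('rV[R]_n -> R[i]) -> R[i]) : tempered T -> T (fun=> 0) = 0.
Proof.
move=> [lT _]; have s0 := test_schwartz (test0 n).
have := lT 1 _ _ s0 s0; rewrite mul1r.
have -> : 1 *: (fun=> 0) + (fun=> 0) = (fun=> 0) :> ('rV[R]_n -> R[i]).
  by apply/funext => y; rewrite !fctE scaler0 addr0.
by move/eqP; rewrite -subr_eq0 opprD addrA subrr add0r oppr_eq0 => /eqP.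
Qed.

Lemma of_weil_brezin_wb_section S c phi (tp : test_function phi) : (forall m, tempered (S m)) ->
  of_weil_brezin S (wb_section k_gt0 c tp) = S c (fun y => conjc (phi y)).
Proof.
move=> tS; rewrite /of_weil_brezin (bigD1 c) //= big1 ?addr0 => [|m mc].
  by congr (S c _); apply/funext => y; rewrite weil_brezin_wb_section eqxx.
rewrite -[RHS](tempered0 (tS m)); congr (S m _); apply/funext => y.
by rewrite weil_brezin_wb_section (negbTE mc) rmorph0.
Qed.

(** Evaluate at the section whose only non-zero coefficient is the conjugate of
the test function. *)
Lemma of_weil_brezin_inj S T c phi : (forall m, tempered (S m)) -> (forall m, tempered (T m)) ->
  of_weil_brezin S = of_weil_brezin T :> functional R n k -> test_function phi -> S c phi = T c phi.
Proof.
move=> tS tT ST tp; have := congr1 (@^~ (wb_section k_gt0 c (test_conj tp))) ST.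
rewrite !of_weil_brezin_wb_section//.
have -> : (fun y => conjc (conjc (phi y))) = phi by apply/funext => y; rewrite conjcK.
by [].
Qed.

Local Notation KC := ((basis_scale R n k * theta_scale R n k)%:C).

Definition delta_coef m m' (phi : 'rV[R]_n -> R[i]) : R[i] := if m' == m then KC * phi 0 else 0.

Lemma delta_coef_tempered m m' : tempered (delta_coef m m').
Proof.
rewrite /delta_coef; case: eqP => _; last first.
  split=> [c phi psi _ _|]; first by rewrite mulr0 addr0.
  by exists 0, 0%N => phi M _ _; rewrite mul0r normr0.
split=> [c phi psi _ _|].
  by rewrite !fctE mulrDr [c *: _](_ : _ = c * phi 0)//; congr (_ + _); exact: mulrCA.
exists `|basis_scale R n k * theta_scale R n k|, 0%N => phi M _ bM.
rewrite -cn_le cnM cn_real; apply: ler_pM (normr_ge0 _) (cn_ge0 _) (lexx _) _.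
by have := bM [::] [::] 0 isT isT; rewrite /schwartz_term big_nil mul1r -cn_le.
Qed.

Lemma sigma_weil_brezin m : sigma m = of_weil_brezin (delta_coef m) :> functional R n k.
Proof.
apply/funext => t; rewrite sigmaE /of_weil_brezin (bigD1 m) //= /delta_coef eqxx.
by rewrite big1 ?addr0 // => m' /negbTE ->.
Qed.

Lemma KC_neq0 : KC != 0 :> R[i].
Proof.
rewrite -[0]/(0%:C) (inj_eq (@complexI _)) gt_eqF//.
by rewrite !mulr_gt0 ?powR_gt0 ?mulr_gt0 ?ltr0n.
Qed.

Lemma is_pairing_sigma f m b : is_pairing (sigma m) (dmul (CinfX_conj f) (sigma_check b))
  (KC * conjc (hcoef f b m 0) : R[i]).
Proof.
exists (delta_coef m), (fun c => distribution_of (hcoef f b c)), (hcoef f b),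
  (fun m' => delta_coef m m' (fun y => conjc (hcoef f b m' y))); split.
- by split; [exact: delta_coef_tempered|exact: sigma_weil_brezin].
- by split=> [c|]; [exact: hcoef_tempered|exact: sigma_check_weil_brezin].
- by move=> c; split=> //; exact: smooth_hcoef.
- move=> c; exists (@bumpfun R n); split; first exact: bumpfun_test.
    by move=> phi _; rewrite /delta_coef fctE bumpfun0 mul1r.
  by rewrite /delta_coef fctE bumpfun0 mul1r.
- rewrite (bigD1 m) //= /delta_coef eqxx big1 ?addr0 // => m' /negbTE -> //.
Qed.

(** The coefficients S and T in the definition of the pairing are determined on
test functions, and their smooth representatives at 0. The cut-off function chi
is forced to take the value 1 at 0 by its invariance property applied to the
bump function. *)
Lemma is_pairing_sigma_unique f m b (z : R[i]) :
  is_pairing (sigma m) (dmul (CinfX_conj f) (sigma_check b)) z ->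
  z = KC * conjc (hcoef f b m 0).
Proof.
move=> [S [T [h [w [[tS ES] [tT ET] hT wS ->]]]]].
have SE c phi : test_function phi -> S c phi = delta_coef m c phi.
  apply: of_weil_brezin_inj => //; first exact: delta_coef_tempered.
  by rewrite -ES sigma_weil_brezin.
have h0 c : h c 0 = hcoef f b c 0.
  have [sh Th] := hT c; apply: represented_eq0 => //; first exact: smooth_hcoef.
  move=> phi tp; rewrite -Th//.
  apply: (of_weil_brezin_inj (T := fun c => distribution_of (hcoef f b c))) => //.
    by move=> c'; exact: hcoef_tempered.
  by rewrite -ET sigma_check_weil_brezin.
have wE c : w c = delta_coef m c (fun y => conjc (h c y)).
  have [chi [tchi Hchi ->]] := wS c; have [sh _] := hT c.
  have tch : test_function (chi * (fun y => conjc (h c y))).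
    by rewrite mulrC; apply: test_mul => //; exact: smooth_conj.
  rewrite SE// /delta_coef; case: eqP => // cm; rewrite fctE.
  have tb := bumpfun_test R n.
  have := Hchi _ (test_schwartz tb); rewrite !SE//; last first.
    by apply: test_mul => //; have [] := tchi.
  rewrite /delta_coef cm eqxx fctE bumpfun0 !mulr1 => /eqP.
  rewrite -[X in _ == X]mulr1 (inj_eq (mulfI KC_neq0)) => /eqP ->.
  by rewrite mul1r.
rewrite (bigD1 m) //= big1 ?addr0 => [|c /negbTE cm]; last by rewrite wE /delta_coef cm.
by rewrite wE /delta_coef eqxx h0.
Qed.

Lemma pairing_sigma f m b : pairing (sigma m) (dmul (CinfX_conj f) (sigma_check b)) =
  KC * conjc (hcoef f b m 0).
Proof.
apply: xget_unique; first exact: is_pairing_sigma.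
exact: is_pairing_sigma_unique.
Qed.

(** The half-form pairing is exactly what normalizes sigma and sigma_check to
dual bases. *)
Lemma scale_normalization : (2 `^ (n%:R / 2) * k%:R `^ (- (n%:R / 2))) *
  (basis_scale R n k * theta_scale R n k) * (basis_scale R n k * check_scale R n) = 1 :> R.
Proof.
have k0 : 0 < k%:R :> R by rewrite ltr0n.
rewrite /basis_scale /theta_scale /check_scale powRM ?ltW// !powRN.
have -> : 2 `^ (n%:R / 2) = 2 `^ (n%:R / 4) * 2 `^ (n%:R / 4) :> R.
  rewrite -powRD; first by congr (_ `^ _); field.
  by rewrite pnatr_eq0 implybT.
have a0 : 2 `^ (n%:R / 4) != 0 :> R by rewrite gt_eqF// powR_gt0.
have b0 : k%:R `^ (n%:R / 2) != 0 :> R by rewrite gt_eqF// powR_gt0.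
by field; rewrite a0 b0.
Qed.

Lemma hpairing_diag f m : hpairing f (sigma m) (sigma_check m) =
  (k%:R^-1)%:C ^+ n * \sum_(l : Zkn n k) f (row_mx (yshift R l) (yshift R m)).
Proof.
rewrite /hpairing pairing_sigma /half_form_pairing /hcoef.
have cX : conjc ((k%:R^-1)%:C ^+ n) = (k%:R^-1)%:C ^+ n :> R[i] by rewrite -rmorphXn conjc_real.
rewrite !conjcM conjc_real cX !mulrA -!rmorphM scale_normalization mul1r; congr (_ * _).
rewrite conjc_sum; apply: eq_bigr => l _; rewrite conjcM conjcK add0r.
by rewrite mulrC conjcM conjcK expi_conjM mul1r.
Qed.

Definition toeplitz_trace f : R[i] := \sum_(m : Zkn n k) hpairing f (sigma m) (sigma_check m).

Lemma toeplitz_traceE f : toeplitz_trace f = (k%:R ^+ n)%:C * cavg k f.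
Proof.
rewrite /toeplitz_trace cavg_row_mx cavg_pt; under eq_bigr do rewrite hpairing_diag.
rewrite -mulr_sumr mulrA.
have -> : (k%:R ^+ n)%:C * (k%:R^-1)%:C ^+ n = 1 :> R[i].
  by rewrite rmorphXn -exprMn -rmorphM mulfV ?expr1n// pnatr_eq0 -lt0n.
rewrite mul1r exchange_big mulr_sumr; apply: eq_bigr => l _.
by rewrite cavg_pt.
Qed.

Lemma sigma_free (a : Zkn n k -> R[i]) : \sum_m a m *: (sigma m : functional R n k) = 0 -> forall m, a m = 0.
Proof.
move=> E m; have tb := bumpfun_test R n.
have := congr1 (@^~ (wb_section k_gt0 m tb)) E; rewrite /= fct_sumE (bigD1 m) //= big1 ?addr0 => [|m' m'm].
  have -> : (a m *: sigma m) (wb_section k_gt0 m tb) = a m * sigma m (wb_section k_gt0 m tb) by [].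
  rewrite sigmaE weil_brezin_wb_section eqxx bumpfun0 conjc1 mulr1 => /eqP.
  by rewrite mulf_eq0 (negbTE KC_neq0) orbF => /eqP.
have -> : (a m' *: sigma m') (wb_section k_gt0 m tb) = a m' * sigma m' (wb_section k_gt0 m tb) by [].
by rewrite sigmaE weil_brezin_wb_section (negbTE m'm) conjc0 !mulr0.
Qed.

(** By definition Q_f maps into the span of the sigma^m, which are free and
polarized, and its matrix in this family is that of the pairings with the dual
family. *)
Lemma toeplitz_is_trace f : is_trace (@polarized R n k) (toeplitz f) (toeplitz_trace f).
Proof.
exists #|Zkn n k|, (fun i => sigma (enum_val i)),
  (\matrix_(i, j) hpairing f (sigma (enum_val j)) (sigma_check (enum_val i))).
have enumE (V : zmodType) (F : Zkn n k -> V) : \sum_m F m = \sum_(i < #|Zkn n k|) F (enum_val i).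
  rewrite (reindex (@enum_val _ (mem (Zkn n k)))) //=.
  exists enum_rank => x _; [exact: enum_valK|exact: enum_rankK].
split.
- by move=> i; exact: sigma_polarized.
- move=> a a0 i; have := @sigma_free (fun m => a (enum_rank m)).
  rewrite enumE; under eq_bigr do rewrite enum_valK.
  by move=> /(_ a0 (enum_val i)); rewrite enum_valK.
- by move=> s _; exists (fun i => hpairing f s (sigma_check (enum_val i))); rewrite /toeplitz enumE.
- by move=> j; rewrite /toeplitz enumE; apply: eq_bigr => i _; rewrite mxE.
- by rewrite /toeplitz_trace enumE; apply: eq_bigr => i _; rewrite mxE.
Qed.

End Pairing.

(** * Asymptotics and the formal trace *)

Section Asymptotics.
Variables (R : realType) (n : nat).
Implicit Types (f g : CinfX R n).

Lemma hbar_exprz k r : (0 < k)%N -> hbar R k ^ (r%:Z - n%:Z) = k%:R ^+ n * k%:R^-1 ^+ r :> R.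
Proof.
move=> k0; have kn0 : k%:R != 0 :> R by rewrite pnatr_eq0 -lt0n.
by rewrite /hbar expfzDr ?invr_eq0// -exprnN -exprVn invrK mulrC.
Qed.

Lemma hbar_exprN k : (0 < k)%N -> hbar R k ^- n = k%:R ^+ n :> R.
Proof. by move=> _; rewrite /hbar -exprVn invrK. Qed.

(** The difference is k^n times the error of the trapezoid rule on the torus, to
which the bound by the r-th derivatives applies. *)
Lemma toeplitz_trace_estimate f r : (0 < r)%N -> exists2 C : R, 0 < C & forall k, (0 < k)%N ->
  `|toeplitz_trace k f - (hbar R k ^- n)%:C * integral_X f| <= (C * hbar R k ^ (r%:Z - n%:Z))%:C.
Proof.
case: r => // r _.
have H i : exists B, bounded_by B (iter r.+1 (pd i) f).
  apply: zperiodic_bounded; last by apply: zperiodic_iter_pd; exact: CinfX_zperiodic.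
  exact: (smooth_iter_pd r.+1 i (CinfX_smooth f) [::]).
pose B i := projT1 (cid (H i)).
have bB i : bounded_by (B i) (iter r.+1 (pd i) f) by rewrite /B; case: cid.
have B0 i : 0 <= B i by exact: le_trans (cn_ge0 _) (bB i 0).
pose D := \sum_i B i; have D0 : 0 <= D by exact: sumr_ge0.
have bD i : bounded_by D (iter r.+1 (pd i) f).
  by move=> u; apply: (le_trans (bB i u)); rewrite /D (bigD1 i) //= lerDl sumr_ge0.
have C0 : 0 <= 4 * (n + n)%:R * D by rewrite !mulr_ge0.
exists (4 * (n + n)%:R * D + 1) => [|k k0]; first by rewrite ltr_wpDl.
rewrite -cn_le toeplitz_traceE// hbar_exprN// -mulrBr cnM cn_real ger0_norm ?exprn_ge0//.
rewrite hbar_exprz// mulrCA ler_wpM2l ?exprn_ge0//.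
have := trapezoid k0 (CinfX_smooth f) (CinfX_zperiodic f) bD.
move=> h; apply: (le_trans h); rewrite ler_wpM2r ?exprn_ge0 ?invr_ge0//.
by rewrite lerDl.
Qed.

Definition formal_trace : formal_functional R n := fun F j => integral_X (F j).

Lemma formal_trace_linear : formal_linear formal_trace.
Proof.
split=> [F G|c F]; apply/funext => j; first exact: integral_XD.
by rewrite /formal_trace /formal_scale integral_X_sum; apply: eq_bigr => i _; exact: integral_XZ.
Qed.

Lemma formal_trace_const f : formal_trace (formal_const f) = formal_const (integral_X f).
Proof.
apply/funext => j; rewrite /formal_trace /formal_const; case: eqP => // _.
exact: integral_X0.
Qed.

Lemma formal_scale_hbar (V : lmodType R[i]) (F : nat -> V) j :
  formal_scale (fun i => (i == 1%N)%:R) F j = if j is j'.+1 then F j' else 0.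
Proof.
rewrite /formal_scale; case: j => [|j].
  by rewrite big_ord1 scale0r.
rewrite (bigD1 (inord 1)) //= inordK// eqxx scale1r subn1 big1 ?addr0// => i i1.
rewrite (_ : (i : nat) == 1%N = false) ?scale0r//; apply: contra_neqF i1 => /eqP i1.
by apply: val_inj; rewrite /= inordK.
Qed.

Lemma formal_shift (F : nat -> CinfX R n) :
  F = formal_const (F 0%N) + formal_scale (fun i => (i == 1%N)%:R) (fun j => F j.+1).
Proof.
apply/funext => j; rewrite fctE formal_scale_hbar /formal_const.
by case: j => [|j]; rewrite ?addr0 ?add0r.
Qed.

(** A formal series is its constant term plus hbar times a shifted series, so
that linearity determines T one power of hbar at a time. *)
Lemma formal_trace_unique (T : formal_functional R n) : formal_linear T ->
  (forall f, T (formal_const f) = formal_const (integral_X f)) -> formal_trace = T.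
Proof.
move=> [TD TZ] Tc; apply/funext => F; apply/funext => j.
elim: j F => [|j IH] F.
  by rewrite [in RHS](formal_shift F) TD Tc TZ fctE formal_scale_hbar /formal_const addr0.
rewrite [in RHS](formal_shift F) TD Tc TZ fctE formal_scale_hbar /formal_const add0r.
exact: IH (fun j => F j.+1).
Qed.

Lemma formal_trace_map : trace_map formal_trace.
Proof.
split=> //; first exact: formal_trace_linear.
- move=> j; exists 2, j => F M bM; rewrite -cn_le; apply: ci01_bound; first exact: CinfX_cscont.
  by move=> u; rewrite cn_le; exact: (bM j [::] u).
- by move=> f g; apply/funext => j; exact: star_coef_trace.
Qed.

Lemma toeplitz_trace_asymptotic f :
  asymptotic_expansion n (fun k => toeplitz_trace k f) (formal_trace (formal_const f)).
Proof.
rewrite formal_trace_const; case=> [|N].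
  have [C C0 HC] := @toeplitz_trace_estimate f 1 isT.
  exists (cn (integral_X f) + C), 0%N => k k0 _; rewrite big_ord0 subr0 -cn_le.
  have := HC k k0; rewrite -cn_le; set tr := toeplitz_trace k f => h.
  have k1 : 0 <= k%:R ^+ n :> R by rewrite exprn_ge0.
  rewrite -[tr](subrK ((hbar R k ^- n)%:C * integral_X f)) addrC (le_trans (cnD _ _))// mulrDl lerD//.
    rewrite cnM cn_real hbar_exprN// ger0_norm// hbar_exprz// expr0 mulr1 mulrC.
    exact: lexx.
  apply: (le_trans h); apply: ler_wpM2l; first exact: ltW.
  rewrite !hbar_exprz// expr0 expr1 ler_wpM2l// invf_le1 ?ltr0n// ler1n.
  exact: k0.
have [C C0 HC] := @toeplitz_trace_estimate f N.+1 isT.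
exists C, 0%N => k k0 _; have := HC k k0; rewrite big_ord_recl big1 => [|i _]; last first.
  by rewrite /formal_const /= mul0r.
rewrite addr0 /formal_const /= mulrC !hbar_exprz// hbar_exprN// expr0 mulr1; exact.
Qed.

End Asymptotics.

Theorem theorem1p3 (R : realType) (n : nat) (n_gt0 : (0 < n)%N) :
  exists tr : CinfX R n -> nat -> R[i],
  [/\ forall (f : CinfX R n) (k : nat), (0 < k)%N ->
        is_trace (@polarized R n k) (toeplitz f) (tr f k),
      forall (f : CinfX R n) (r : nat), (0 < r)%N ->
        exists2 C : R, 0 < C & forall k : nat, (0 < k)%N ->
          `|tr f k - (hbar R k ^- n)%:C * integral_X f|
            <= (C * hbar R k ^ (r%:Z - n%:Z))%:C
    & exists Tr : formal_functional R n,
      [/\ unique (fun T : formal_functional R n => formal_linear T /\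
            forall f : CinfX R n,
              T (formal_const f) = formal_const (integral_X f)) Tr,
          forall f : CinfX R n,
            asymptotic_expansion n (tr f) (Tr (formal_const f))
        & trace_map Tr]].
Proof.
exists (fun f k => toeplitz_trace k f); split.
- by move=> f k k0; exact: toeplitz_is_trace.
- by move=> f r r0; exact: toeplitz_trace_estimate.
exists (@formal_trace R n); split.
- split; first by split; [exact: formal_trace_linear|exact: formal_trace_const].
  by move=> T [lT cT]; exact: formal_trace_unique.
- exact: toeplitz_trace_asymptotic.
- exact: formal_trace_map.
Qed.
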